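(* Let $G$ be a metabelian $3$-group with abelianisation $G/\gamma_2(G)$ of type $(3,3)$, of order $3^n$ and class $m-1$, of lower than second maximal class, i.e. with $e=n-m+2\ge 4$. Let generators of $G=\langle x,y\rangle$ be selected such that $\gamma_3(G)=\langle y^3,x^3,\gamma_4(G)\rangle$, $x\in G\setminus\chi_s(G)$ if $s<m-1$, and $y\in\chi_s(G)\setminus\gamma_2(G)$, and such that the relations $$s_2^3=\sigma_4\sigma_{m-1}^{-\rho\beta}\tau_4^{-1},\quad s_3\sigma_3\sigma_4=\sigma_{m-2}^{\rho\beta}\sigma_{m-1}^{\gamma}\tau_e^{\delta},\quad t_3^{-1}\tau_3\tau_4=\sigma_{m-2}^{\rho\delta}\sigma_{m-1}^{\alpha}\tau_e^{\beta},\quad \tau_{e+1}=\sigma_{m-1}^{-\rho}\qquad(\ast)$$ are satisfied with exponents $-1\le\alpha,\beta,\gamma,\delta,\rho\le 1$. Let the maximal normal subgroups of $G$ be ordered by $M_1=\langle y,\gamma_2(G)\rangle$, $M_2=\langle x,\gamma_2(G)\rangle$, $M_3=\langle xy,\gamma_2(G)\rangle$, $M_4=\langle xy^{-1},\gamma_2(G)\rangle$. Suppose that the transfer type of $G$ is one of section $\mathrm{d}$ (that is, $\mathrm{d}.19$, $\mathrm{d}.23$ or $\mathrm{d}.25$), which implies that $G$ has the invariant $k=0$. Then the position of $G$ as a node on the directed rooted tree of all metabelian $3$-groups with abelianisation of type $(3,3)$ determines the exponents $\alpha,\beta,\gamma,\delta$ in the relations $(\ast)$ and the canonical multiplet $\varkappa$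 of transfer types of $G$, which are given by the following tables. (1) For terminal nodes: - type $\mathrm{d}.19$: $(\alpha,\beta,\gamma,\delta)=(1,0,1,0)$, $\varkappa=(4,0,4,3)$; - type $\mathrm{d}.19$: $(\alpha,\beta,\gamma,\delta)=(1,0,-1,0)$, $\varkappa=(3,0,4,3)$; - type $\mathrm{d}.23$: $(\alpha,\beta,\gamma,\delta)=(1,0,0,0)$, $\varkappa=(1,0,4,3)$; - type $\mathrm{d}.25$: $(\alpha,\beta,\gamma,\delta)=(0,0,1,0)$, $\varkappa=(2,0,4,3)$; - type $\mathrm{d}.25$: $(\alpha,\beta,\gamma,\delta)=(0,0,-1,0)$, $\varkappa=(2,0,4,3)$. (2) For internal nodes (types then denoted with $\mathrm{d}^\ast$ in place of $\mathrm{d}$): - type $\mathrm{d}^\ast.19$: $(\alpha,\beta,\gamma,\delta)=(0,1,0,1)$, $\varkappa=(0,4,4,3)$; - type $\mathrm{d}^\ast.19$: $(\alpha,\beta,\gamma,\delta)=(0,-1,0,1)$, $\varkappa=(0,3,4,3)$; - type $\mathrm{d}^\ast.23$: $(\alpha,\beta,\gamma,\delta)=(0,0,0,1)$, $\varkappa=(0,2,4,3)$; - type $\mathrm{d}^\ast.25$: $(\alpha,\beta,\gamma,\delta)=(0,1,0,0)$, $\varkappa=(0,1,4,3)$; - type $\mathrm{d}^\ast.25$: $(\alpha,\beta,\gamma,\delta)=(0,-1,0,0)$, $\varkappa=(0,1,4,3)$.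
   Context: Conventions: $[a,b]=a^{-1}b^{-1}ab$. The lower central series is $\gamma_1(G)=G$, $\gamma_j(G)=[\gamma_{j-1}(G),G]$ for $j\ge 2$. Metabelian means that $\gamma_2(G)$ is abelian. Coclass: $\mathrm{cc}(G)=n-\mathrm{cl}(G)$. Invariants: $e=e(G)$ is defined by $e+1=\min\{3\le j\le m\mid 1\le|\gamma_j(G)/\gamma_{j+1}(G)|\le 3\}$ and equals $n-m+2=\mathrm{cc}(G)+1$. For $2\le j\le m-1$, $\chi_j(G)=\{g\in G\mid[g,u]\in\gamma_{j+2}(G)\text{ for all }u\in\gamma_j(G)\}$, and $s=\min\{2\le j\le m-1\mid\chi_j(G)>\gamma_2(G)\}$. The invariant $k\in\{0,1\}$ is defined by $[\chi_s(G),\gamma_e(G)]=\gamma_{m-k}(G)$; $k=0$ is equivalent to $\rho=0$. Elements in the relations $(\ast)$: $s_2=t_2=[y,x]$, $s_j=[s_{j-1},x]$, $t_j=[t_{j-1},y]$ for $j\ge3$; $\sigma_3=y^3$, $\tau_3=x^3$, $\sigma_j=[\sigma_{j-1},x]$, $\tau_j=[\tau_{j-1},y]$ for $j\ge4$. Such generators, with such relations, always exist for metabelian $3$-groups of non-maximal class with abelianisation of type $(3,3)$ (Nebelung). Transfer types: with $\mathrm{V}_i:G/\gamma_2(G)\to M_i/\gamma_2(M_i)$ the usual transfer, $\varkappa(i)=0$ if $\mathrm{Ker}(\mathrm{V}_i)=G/\gamma_2(G)$ and $\varkappa(i)=j$ if $\mathrm{Ker}(\mathrm{V}_i)=M_j/\gamma_2(G)$.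 The multiplet is $\varkappa=(\varkappa(1),\ldots,\varkappa(4))$; it is called canonical when it is formed with generators selected and maximal normal subgroups ordered as in the claim. The transfer type of $G$ is the orbit of $\varkappa$ under the action $\varkappa^\pi=\pi_0^{-1}\circ\varkappa\circ\pi$ of $\pi\in S_4$, where $\pi_0$ extends $\pi$ to $\{0,\ldots,4\}$ by $\pi_0(0)=0$. The types of section $\mathrm{d}$ are the orbits of $(2,1,1,0)$ (type $\mathrm{d}.19$), $(1,3,2,0)$ (type $\mathrm{d}.23$) and $(0,3,2,1)$ (type $\mathrm{d}.25$). Tree: its nodes are the isomorphism classes of metabelian $3$-groups with abelianisation of type $(3,3)$, its root is $C(3)\times C(3)$, and the immediate predecessor of a group $H$ of class $c\ge 2$ is $H/\gamma_c(H)$. A node is terminal if it has no successor, and internal otherwise. The internal nodes of the types of section $\mathrm{d}$ lie on infinite chains of nodes with constant transfer type $\mathrm{d}.19$, $\mathrm{d}.23$ or $\mathrm{d}.25$ (with $e\ge 4$); the terminal ones are successors of nodes on infinite chains all of whose nodes have the transfer type $\mathrm{b}.10$, the orbit of $(2,1,0,0)$.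
   Formalization: The tables hold for the generators after possibly replacing x, y by their inverses and/or exchanging them (all requirements still met), not for every selection: y→y⁻¹ turns the terminal d.19 exponents (1,0,1,0) into (−1,0,1,0), which is no row of the table. *)

(* Defs.v *)
From mathcomp Require Import all_boot all_order all_algebra all_fingroup all_solvable.

Set Implicit Arguments.
Unset Strict Implicit.
Unset Printing Implicit Defensive.

Import GroupScope.

Section Invariants.

Variables (gT : finGroupType) (G : {group gT}).

(* Nodes of the tree: metabelian 3-groups with abelianisation of type (3,3).
   The lower central subgroup gamma_j(G) is 'L_j(G), with 'L_1(G) = G. *)
Definition metabelian_3group_33 : Prop :=
  [/\ 3.-group G, abelian 'L_2(G) & abelian_type (G / 'L_2(G)) = [:: 3; 3]].

Definition inv_m : nat := (nil_class G).+1.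

(* e + 1 is the least j in [3, m] such that gamma_j / gamma_(j+1) has order at
   most 3; j = m qualifies, so using m as the default of the iterated minimum
   is harmless (when m >= 3). *)
Definition inv_e : nat :=
  (\big[minn/inv_m]_(3 <= j < inv_m.+1
      | 1 <= #|'L_j(G) / 'L_j.+1(G)| <= 3) j).-1.

Definition chi (j : nat) : {set gT} :=
  [set g in G | [forall u in 'L_j(G), [~ g, u] \in 'L_j.+2(G)]].

(* Here j = m - 1 qualifies. *)
Definition inv_s : nat :=
  \big[minn/inv_m.-1]_(2 <= j < inv_m | 'L_2(G) \proper chi j) j.

Definition is_inv_k (k : nat) : Prop :=
  k <= 1 /\ [~: chi inv_s, 'L_inv_e(G)] = 'L_(inv_m - k)(G).

End Invariants.

Section Presentation.

Variable gT : finGroupType.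
Implicit Types (G : {group gT}) (x y g : gT).

Definition expgz g (z : int) : gT :=
  match z with Posz n => g ^+ n | Negz n => g ^- n.+1 end.

(* The commutators [y, x] carry the index 2 and the cubes the index 3; values at
   smaller indices are meaningless and do not occur. *)
Definition elt_s x y (j : nat) : gT := iter (j - 2) (fun v => [~ v, x]) [~ y, x].
Definition elt_t x y (j : nat) : gT := iter (j - 2) (fun v => [~ v, y]) [~ y, x].
Definition elt_sigma x y (j : nat) : gT := iter (j - 3) (fun v => [~ v, x]) (y ^+ 3).
Definition elt_tau x y (j : nat) : gT := iter (j - 3) (fun v => [~ v, y]) (x ^+ 3).

Definition selected_generators G x y : Prop :=
  [/\ G :=: <<[set x; y]>>,
      'L_3(G) = <<[set y ^+ 3; x ^+ 3] :|: 'L_4(G)>>,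
      inv_s G < (inv_m G).-1 -> x \in G :\: chi G (inv_s G)
    & y \in chi G (inv_s G) :\: 'L_2(G)].

Definition small_exponent (z : int) : bool := (-1 <= z <= 1)%R.

Definition relations (m e : nat) x y (alpha beta gamma delta rho : int) : Prop :=
  let s := elt_s x y in
  let t := elt_t x y in
  let sigma := elt_sigma x y in
  let tau := elt_tau x y in
  [/\ s 2 ^+ 3 = sigma 4 * expgz (sigma m.-1) (- (rho * beta))%R * (tau 4)^-1,
      s 3 * sigma 3 * sigma 4
        = expgz (sigma m.-2) (rho * beta)%R
          * expgz (sigma m.-1) gamma * expgz (tau e) delta,
      (t 3)^-1 * tau 3 * tau 4
        = expgz (sigma m.-2) (rho * delta)%R
          * expgz (sigma m.-1) alpha * expgz (tau e) beta
    & tau e.+1 = expgz (sigma m.-1) (- rho)%R].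

(* M_1 = <y, G'>, M_2 = <x, G'>, M_3 = <xy, G'>, M_4 = <xy^-1, G'>; the index
   i : 'I_4 stands for M_(i+1). *)
Definition canonical_maximal G x y (i : 'I_4) : {group gT} :=
  nth G [seq [group of <<g |: 'L_2(G)>>]
        | g <- [:: y; x; x * y; x * y^-1]] i.

End Presentation.

Section Transfer.

Variables (gT : finGroupType) (G : {group gT}).

Definition abelianisation_map (M : {group gT}) : {morphism M >-> coset_of 'L_2(M)} :=
  [morphism of restrm (lcn_norm 2 M) (coset 'L_2(M))].

Lemma abelianisation_map_abelian (M : {group gT}) :
  abelian (abelianisation_map M @* M).
Proof.
rewrite morphim_restrm setIid; exact: (der_abelian 0 M).
Qed.

Definition transfer_ker (M : {group gT}) : {set gT} :=
  'ker (transfer_morphism G (abelianisation_map_abelian M)).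

(* The values of a multiplet are 0 : 'I_5 for a total kernel, and
   lift ord0 k (of numerical value k + 1) for the kernel M k / gamma_2(G). *)
Definition is_multiplet (M : 'I_4 -> {group gT})
    (kappa : {ffun 'I_4 -> 'I_5}) : Prop :=
  forall i : 'I_4,
    transfer_ker (M i) / 'L_2(G) = oapp M G (unlift ord0 (kappa i)) / 'L_2(G).

(* lift_perm ord0 ord0 pi extends pi to {0,...,4} by fixing 0. *)
Definition multiplet_act (kappa : {ffun 'I_4 -> 'I_5}) (pi : 'S_4) :
    {ffun 'I_4 -> 'I_5} :=
  [ffun i => (lift_perm ord0 ord0 pi)^-1 (kappa (pi i))].

Definition multiplet (a b c d : nat) : {ffun 'I_4 -> 'I_5} :=
  [ffun i : 'I_4 => inord (nth 0 [:: a; b; c; d] i)].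

(* The transfer type of G is the orbit of kappa0; the four maximal normal
   subgroups may be taken in any order. *)
Definition has_transfer_type (kappa0 : {ffun 'I_4 -> 'I_5}) : Prop :=
  exists (M : 'I_4 -> {group gT}) (kappa : {ffun 'I_4 -> 'I_5}) (pi : 'S_4),
    [/\ injective M, forall i, maxnormal (M i) G G,
        is_multiplet M kappa & kappa = multiplet_act kappa0 pi].

End Transfer.

Section Tree.

Variables (gT : finGroupType) (G : {group gT}).

Definition is_successor (hT : finGroupType) (H : {group hT}) : Prop :=
  [/\ metabelian_3group_33 H, 2 <= nil_class H
    & H / 'L_(nil_class H)(H) \isog G].

Definition internal_node : Prop :=
  exists (hT : finGroupType) (H : {group hT}), is_successor H.

Definition terminal_node : Prop := ~ internal_node.

End Tree.

Inductive section_d : Type := d19 | d23 | d25.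

Definition type_d (t : section_d) : {ffun 'I_4 -> 'I_5} :=
  match t with
  | d19 => multiplet 2 1 1 0
  | d23 => multiplet 1 3 2 0
  | d25 => multiplet 0 3 2 1
  end.

Definition table_row : Type := (int * int * int * int * {ffun 'I_4 -> 'I_5})%type.

(* Rows (alpha, beta, gamma, delta, kappa). *)
Definition terminal_table (t : section_d) : seq table_row :=
  match t with
  | d19 => [:: (1, 0, 1, 0, multiplet 4 0 4 3);
               (1, 0, -1, 0, multiplet 3 0 4 3)]%R
  | d23 => [:: (1, 0, 0, 0, multiplet 1 0 4 3)]%R
  | d25 => [:: (0, 0, 1, 0, multiplet 2 0 4 3);
               (0, 0, -1, 0, multiplet 2 0 4 3)]%R
  end.

Definition internal_table (t : section_d) : seq table_row :=
  match t with
  | d19 => [:: (0, 1, 0, 1, multiplet 0 4 4 3);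
               (0, -1, 0, 1, multiplet 0 3 4 3)]%R
  | d23 => [:: (0, 0, 0, 1, multiplet 0 2 4 3)]%R
  | d25 => [:: (0, 1, 0, 0, multiplet 0 1 4 3);
               (0, -1, 0, 0, multiplet 0 1 4 3)]%R
  end.

Section Normalisation.

Variable gT : finGroupType.
Implicit Types (G : {group gT}) (x y : gT).

(* The exponents depend on the selected generators. For the types of section d,
   (alpha, beta, gamma, delta) becomes
     (- alpha, (-1)^(e+1) beta, gamma, (-1)^e delta)   under y -> y^-1,
     ((-1)^(m+1) alpha, beta, (-1)^m gamma, - delta)   under x -> x^-1,
     (delta, gamma, beta, alpha)                       under x <-> y,
   the last one being an admissible selection only if e = m - 1, that is, if
   chi_s(G) = G. *)
Definition renamed_generators x y x' y' : bool :=
  [|| (x' \in [set x; x^-1]) && (y' \in [set y; y^-1])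
    | (x' \in [set y; y^-1]) && (y' \in [set x; x^-1])].

(* The exponents and the canonical multiplet are given by a row of the table,
   for a selection of generators satisfying the same requirements as x, y. *)
Definition given_by_table G (m e : nat) x y (rho : int) (table : seq table_row) :
    Prop :=
  exists (x' y' : gT) (alpha beta gamma delta : int) (kappa : {ffun 'I_4 -> 'I_5}),
    [/\ renamed_generators x y x' y',
        selected_generators G x' y',
        relations m e x' y' alpha beta gamma delta rho,
        is_multiplet G (canonical_maximal G x' y') kappa
      & (alpha, beta, gamma, delta, kappa) \in table].

End Normalisation.

(* Main.v *)
(* G' is written additively, as a module over Z[X, Y], where X and Y stand for
   u |-> [u, x] and u |-> [u, y]. With s = [y, x], sigma_j = X^(j-3) y^3 and
   tau_j = Y^(j-3) x^3, one has Y sigma_j = X tau_j = 0, and gamma_j(G) is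
   generated by the sigma_i and tau_i with i >= j. Since
   |gamma_3(G)| >= 3^(m+e-5), no further collapse is possible, which shows that
   sigma_(m-1) is not in M_1' (when rho = 0) and tau_e is not in M_2'.

   Modulo M_i' the transfers are V(g) = g^3 for g outside M_i and
   V(g) = g^3 [g, h]^3 [g, h, h] for g in M_i and h outside M_i. For rho = 0 the
   relations give V_1(x) = alpha sigma_(m-1), V_1(y) = gamma sigma_(m-1),
   V_2(x) = beta tau_e, V_2(y) = delta tau_e, so that kappa(1) is a function of
   (alpha, gamma) and kappa(2) of (beta, delta), while kappa(3) = 4 and
   kappa(4) = 3 always. If rho <> 0, the kernels of V_1 and V_2 are total for
   the same (beta, delta). The types of section d require exactly one total
   kernel; hence rho = 0 and exactly one of (alpha, gamma), (beta, delta)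
   vanishes. The signs are then normalised by x -> x^-1 or y -> y^-1.

   If e = m - 1, then x and y may be exchanged, and both tables apply. Let
   e < m - 1. In a successor H of G the elements P = X s + y^3 + X y^3 and
   Q = - Y s + x^3 + Y x^3 satisfy X Q = - Y P and X P = - Y Q, which forces
   alpha = gamma = 0 as soon as beta = delta = 0. Conversely, if
   alpha = gamma = rho = 0, then the relations do not involve m and also hold
   in the subgroup H of K x G generated by the pairs of generators, K being the
   quotient of class m of Z[omega] x| C(3), omega a primitive cube root of
   unity; by counting, the kernel of H -> G is gamma_m(H), so H is a
   successor of G. *)

From HB Require Import structures.
From mathcomp Require Import all_boot all_order all_algebra all_fingroup all_solvable.
From mathcomp Require Import ring zify.
Require Import Defs.

Set Implicit Arguments.
Unset Strict Implicit.
Unset Printing Implicit Defensive.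

Import GRing.Theory GroupScope FiniteModule.

(** G is known only through relations and its order, so nothing says beforehand that sigma_(m-1) or
    tau_e survives modulo M_i'. Every such claim is obtained by counting: generators are adjoined
    from the bottom of the lower central series upwards, and each multiplies the order by at most 3
    because its cube lies in what is already built. For sigma_j and tau_j with j >= 4 the cubes are
    controlled by (1 + X)^3 = (1 + Y)^3 = 1 on G'; for j = 3 this fails and the relations are used.
    The opposite bound is the given order, since gamma_3(G) has index at most 27. The constant
    entries kappa(3) and kappa(4) depend only on the second and third relation modulo gamma_4(G):
    there [s, xy] is x^3 y^(-3), the transfer of xy^(-1) to M_3, while x^3 in M_3' would make
    gamma_3 / gamma_4 too small. Replacing y by y^(-1) gives M_4. The group K is chosen because
    omega has order 3, which trivialises all tau_j, and because (omega - 1)^2 = - 3 omega is the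
    second relation. The count applied to H gives |H| <= 3 |G|, and gamma_m(H), which maps onto
    gamma_m(K) <> 1, uses up the factor 3. *)

Section SquareZeroExtension.

Variable V : zmodType.

(* The ring Z + V with V ^ 2 = 0: it lets [ring] decide linear identities in
   the abelian group V. *)
Definition sqzero : Type := (int * V)%type.

HB.instance Definition _ := GRing.Zmodule.on sqzero.

Local Open Scope ring_scope.

Definition sqzero_mul (p q : sqzero) : sqzero :=
  (p.1 * q.1, q.2 *~ p.1 + p.2 *~ q.1).

Let mulA : associative sqzero_mul.
Proof.
move=> [a u] [b v] [c w]; congr (_, _); rewrite /= ?mulrA //.
rewrite !mulrzDl -!mulrzA -addrA; congr (_ + (_ + _)); first by rewrite mulrC.
by rewrite mulrC.
Qed.

Let mulC : commutative sqzero_mul.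
Proof. by move=> [a u] [b v]; congr (_, _); rewrite /= 1?mulrC // addrC. Qed.

Let mul1 : left_id ((1, 0) : sqzero) sqzero_mul.
Proof. by move=> [a u]; congr (_, _); rewrite /= ?mul1r // mul0rz addr0. Qed.

Let mulD : left_distributive sqzero_mul +%R.
Proof.
move=> [a u] [b v] [c w]; congr (_, _); rewrite /= ?mulrDl //.
by rewrite mulrzDr mulrzDl addrACA.
Qed.

HB.instance Definition _ :=
  GRing.Zmodule_isComPzRing.Build sqzero mulA mulC mul1 mulD.

Definition sqzero_in (u : V) : sqzero := (0, u).

Fact sqzero_in_additive : zmod_morphism sqzero_in.
Proof. by move=> u v; congr (_, _); rewrite /= subr0. Qed.

HB.instance Definition _ :=
  GRing.isZmodMorphism.Build V sqzero sqzero_in sqzero_in_additive.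

Lemma sqzero_in_inj : injective sqzero_in.
Proof. by move=> u v []. Qed.

End SquareZeroExtension.

Ltac zmod_ring := apply: sqzero_in_inj; ring.

Ltac nat_lia :=
  repeat match goal with
  | H : ?T |- _ =>
    lazymatch T with
    | is_true (leq _ _) => fail
    | @eq nat _ _ => fail
    | nat => fail
    | _ => clear H
    end
  end; lia.

(** * Identities for P and Q in a module with two commuting operators *)

Section CommutingOperators.

Local Open Scope ring_scope.

Variables (V : zmodType) (X Y : {additive V -> V}) (s S T : V).

Hypotheses (XYC : forall u, X (Y u) = Y (X u)) (YS : Y S = 0) (XT : X T = 0).
Hypothesis XS : X S = s *+ 3 + Y s *+ 3 + Y (Y s).
Hypothesis YT : Y T = - (s *+ 3 + X s *+ 3 + X (X s)).

(** With sigma_3 and tau_3 for [S] and [T], this is the defect of the first relation at rho = 0. In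
    a successor of G it lies in the last non-trivial term of the lower central series, so [X] and
    [Y] kill it. *)
Let nu := s *+ 3 - X S + Y T.

Hypotheses (Xnu : X nu = 0) (Ynu : Y nu = 0).

(** Two terms [X s *+ 3] cancel: one comes from solving [YT] for [X (X s)], the other is [X (X S)],
    by [Xnu] and [X (Y T) = Y (X T) = 0]. *)
Lemma defect_XP : X (X s + S + X S) = - nu.
Proof.
have E : X (X s) = - Y T - s *+ 3 - X s *+ 3 by rewrite YT; zmod_ring.
have E3 : X s *+ 3 = X (X S).
  apply/eqP; rewrite -subr_eq0 -Xnu /nu; apply/eqP.
  have -> : X (s *+ 3 - X S + Y T) = X s *+ 3 - X (X S) + Y (X T).
    by rewrite -XYC; zmod_ring.
  by rewrite XT raddf0 addr0.
rewrite !raddfD /= E E3 /nu; zmod_ring.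
Qed.

Lemma defect_YQ : Y (- Y s + T + Y T) = nu.
Proof.
have E : Y (Y s) = X S - s *+ 3 - Y s *+ 3 by rewrite XS; zmod_ring.
have E3 : Y s *+ 3 = - Y (Y T).
  apply/eqP; rewrite -subr_eq0 -Ynu /nu; apply/eqP.
  have -> : Y (s *+ 3 - X S + Y T) = Y s *+ 3 - X (Y S) + Y (Y T).
    by rewrite XYC; zmod_ring.
  by rewrite YS raddf0 subr0 opprK.
rewrite !raddfD raddfN /= E E3 /nu; zmod_ring.
Qed.

Lemma defect_XQ : X (- Y s + T + Y T) = - Y (X s + S + X S).
Proof.
rewrite !raddfD raddfN /= XT !XYC XT -!XYC YS !raddf0. zmod_ring.
Qed.

End CommutingOperators.

(** * The derived subgroup as a module *)

Section CommutatorOperator.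

Variables (gT : finGroupType) (G : {group gT}).
Hypothesis cA : abelian 'L_2(G).

Local Notation F := (fmod_of cA).
Local Notation fm := (fmod cA).

Lemma norm_lcn2 g : g \in G -> g \in 'N('L_2(G)).
Proof. exact/subsetP/lcn_norm. Qed.

Lemma comm_lcn2 g h : g \in G -> h \in G -> [~ g, h] \in 'L_2(G).
Proof. exact: mem_commg. Qed.

Definition com (g : gT) (u : F) : F := (u ^@ g - u)%R.

Fact com_additive g : zmod_morphism (com g).
Proof. by move=> u v; rewrite /com actAr actNr; zmod_ring. Qed.

HB.instance Definition _ g :=
  GRing.isZmodMorphism.Build F F (com g) (com_additive g).

Lemma actE g (u : F) : (u ^@ g = com g u + u)%R.
Proof. by rewrite /com subrK. Qed.

Lemma fmval_com g (u : F) : g \in G -> fmval (com g u) = [~ fmval u, g].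
Proof.
by move=> Gg; rewrite /com addrC fmvalA fmvalN fmvalJ ?norm_lcn2 //.
Qed.

Lemma fmod_comm g h : g \in 'L_2(G) -> h \in G -> fm [~ g, h] = com h (fm g).
Proof.
move=> Ag Gh; have AgG := subsetP (lcn_sub 2 G) _ Ag.
by apply: fmod_inj; rewrite fmval_com // !(fmodK cA) // comm_lcn2.
Qed.

Lemma com_lcn2 g (u : F) : g \in 'L_2(G) -> com g u = 0%R.
Proof.
move=> Ag; apply: fmod_inj; rewrite fmval_com ?(subsetP (lcn_sub 2 G)) //.
apply: (etrans (y := 1)); last by rewrite fmval0.
apply/eqP/commgP; apply: (centsP cA) => //; exact: fmodP.
Qed.

Lemma comM g h (u : F) : g \in G -> h \in G ->
  com (g * h) u = (com g u + com h u + com h (com g u))%R.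
Proof.
move=> Gg Gh; rewrite {1}/com actrM ?norm_lcn2 // !actE raddfD /=.
by zmod_ring.
Qed.

(** The products [g * h] and [h * g] differ by a commutator, which acts trivially on the abelian
    group ['L_2(G)]. *)
Lemma comC g h (u : F) : g \in G -> h \in G -> com g (com h u) = com h (com g u).
Proof.
move=> Gg Gh.
suff E : (u ^@ h ^@ g = u ^@ g ^@ h)%R.
  have /eqP := E; rewrite !actE !raddfD /= -subr_eq0 => /eqP E0.
  by apply/eqP; rewrite -subr_eq0 -E0; apply/eqP; zmod_ring.
rewrite -!actrM ?norm_lcn2 // commgC.
have Gc : [~ h, g] \in G by rewrite groupR.
rewrite [LHS]actrM ?norm_lcn2 ?(groupM Gg Gh) //.
by rewrite actE com_lcn2 ?add0r ?comm_lcn2.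
Qed.

(** The element [g ^+ 3] acts trivially on ['L_2(G)], that is, [(1 + com g)^3 = 1]. *)
Lemma com_cube g (u : F) : g \in G -> g ^+ 3 \in 'L_2(G) ->
  (com g (com g (com g u)) = - (com g u *+ 3 + com g (com g u) *+ 3))%R.
Proof.
move=> Gg Ag3; apply/eqP; rewrite -addr_eq0; apply/eqP.
rewrite -(com_lcn2 u Ag3) !expgS expg0 mulg1 !comM ?groupM // !raddfD /=.
by zmod_ring.
Qed.

(** This is [1 + (1 + Z) + (1 + Z)^2 = 3 + 3 Z + Z^2] with [Z = com g], applied to [[~ g, h]]. *)
Lemma comm_cube g h : g \in G -> h \in G ->
  (fm [~ g ^+ 3, h] = fm [~ g, h] *+ 3 + com g (fm [~ g, h]) *+ 3
                      + com g (com g (fm [~ g, h])))%R.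
Proof.
move=> Gg Gh; set c := [~ g, h].
have Ac : c \in 'L_2(G) by apply: comm_lcn2.
have -> : [~ g ^+ 3, h] = c ^ (g * g) * c ^ g * c.
  rewrite commgEl conjXg (_ : g ^ h = g * c); last by rewrite /c commgEl mulKVg.
  by rewrite !expgS expg0 !mulg1 !conjgE !invMg !mulgA !mulgK.
have nAg := norm_lcn2 Gg.
have AJ k : k \in G -> c ^ k \in 'L_2(G).
  by move=> Gk; rewrite memJ_norm ?norm_lcn2.
have Ggg : g * g \in G by apply: groupM.
have AJ2 := groupM (AJ _ Ggg) (AJ _ Gg).
rewrite (fmodM cA AJ2 Ac) (fmodM cA (AJ _ Ggg) (AJ _ Gg)).
rewrite !fmodJ ?norm_lcn2 // actrM //.
rewrite !actE !raddfD /=; zmod_ring.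
Qed.

Lemma comV g (u : F) : g \in G -> com g^-1 u = (- (com g u) ^@ g^-1)%R.
Proof. by move=> Gg; rewrite /com actAr actNr actrK opprB. Qed.

End CommutatorOperator.

(** * Generators and orders along the lower central series *)

Lemma commg_gen_sub (gT : finGroupType) (S R : {set gT}) (N : {group gT}) :
    <<S>> \subset 'N(N) -> <<R>> \subset 'N(N) ->
    {in S & R, forall a b, [~ a, b] \in N} ->
  [~: <<S>>, <<R>>] \subset N.
Proof.
move=> nS nR cSR; rewrite -quotient_cents2 //.
have [nS1 nR1] := (subset_trans (subset_gen S) nS, subset_trans (subset_gen R) nR).
rewrite !quotient_gen // cent_gen gen_subG.
apply/centsP=> _ /morphimP[a Na Sa ->] _ /morphimP[b Nb Rb ->].
by apply/commgP; rewrite -morphR //= coset_id ?cSR.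
Qed.

(** All upper bounds on orders below are iterations of this step. *)
Lemma card_gen_cube (gT : finGroupType) (a : gT) (M : {group gT}) :
  a \in 'N(M) -> a ^+ 3 \in M -> #|<<a |: M>>| <= 3 * #|M|.
Proof.
move=> nMa Ma3.
have nMA : <[a]> \subset 'N(M) by rewrite cycle_subG.
have -> : <<a |: M>> = <[a]> <*> M by rewrite joing_idl.
rewrite -(Lagrange (joing_subr <[a]> M)) mulnC leq_mul2r; apply/orP; right.
rewrite -card_quotient ?join_subG ?nMA ?normG // quotientYidr //.
rewrite quotient_cycle // -orderE dvdn_leq // order_dvdn.
by rewrite -morphX //= coset_id.
Qed.

Lemma lcn_quotient_norm (gT : finGroupType) (G : {group gT}) j (S : {set gT}) :
  S \subset 'L_j.+1(G) -> G \subset 'N(<<S :|: 'L_j.+2(G)>>).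
Proof.
move=> sS; have sN : <<S :|: 'L_j.+2(G)>> \subset 'L_j.+1(G).
  by rewrite gen_subG subUset sS lcn_subS.
rewrite -commg_subl (subset_trans (commSg G sN)) //.
by rewrite sub_gen // subsetUr.
Qed.

(** The group generated by [S'] and ['L_j.+3(G)] is normal, and modulo it the generators of
    ['L_j.+1(G)] commute with those of [G]; hence it contains the whole commutator ['L_j.+2(G)]. *)
Lemma lcn_gen_step (gT : finGroupType) (G : {group gT}) j (R S S' : {set gT}) :
    G :=: <<R>> -> 'L_j.+1(G) = <<S :|: 'L_j.+2(G)>> -> S' \subset 'L_j.+2(G) ->
    {in S & R, forall a g, [~ a, g] \in <<S' :|: 'L_j.+3(G)>>} ->
  'L_j.+2(G) = <<S' :|: 'L_j.+3(G)>>.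
Proof.
move=> defG defL sS' cS; apply/eqP.
rewrite eqEsubset [X in _ && X]gen_subG subUset sS' lcn_subS !andbT.
have nN := lcn_quotient_norm sS'.
rewrite lcnSn defL {2}defG; apply: commg_gen_sub => [||a g /setUP[Sa|La] Rg].
- by rewrite -defL (subset_trans (lcn_sub _ _)).
- by rewrite -defG.
- exact: cS.
apply: mem_gen; apply/setUP; right.
by apply: mem_commg => //; rewrite defG mem_gen.
Qed.

Section TwoGenerators.

Variables (gT : finGroupType) (G : {group gT}) (x y : gT).
Hypothesis defG : G :=: <<[set x; y]>>.

Lemma mem_gen2 : x \in G /\ y \in G.
Proof. by rewrite defG !mem_gen ?set21 ?set22. Qed.

Lemma lcn2_gen : 'L_2(G) = <<[set [~ y, x]] :|: 'L_3(G)>>.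
Proof.
have [Gx Gy] := mem_gen2.
apply: (lcn_gen_step (R := [set x; y]) (S := [set x; y])) => //.
- rewrite lcn1; apply/eqP; rewrite eqEsubset; apply/andP; split.
    by rewrite {1}defG genS ?subsetUl.
  by rewrite gen_subG subUset lcn_sub andbT; apply/subsetP=> z /set2P[] ->.
- by rewrite sub1set mem_commg.
- have s_in : [~ y, x] \in <<[set [~ y, x]] :|: 'L_3(G)>>.
    by rewrite mem_gen // inE set11.
move=> a b /set2P[] -> /set2P[] ->; rewrite ?commgg ?group1 //.
by rewrite -invg_comm groupV.
Qed.

Lemma card_lcn2 : x ^+ 3 \in 'L_2(G) -> y ^+ 3 \in 'L_2(G) -> #|G| <= 9 * #|'L_2(G)|.
Proof.
move=> Ax3 Ay3; have [Gx Gy] := mem_gen2.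
pose M := <<y |: 'L_2(G)>>%G.
have nA g : g \in G -> g \in 'N('L_2(G)) by apply/subsetP/lcn_norm.
have sAM : 'L_2(G) \subset M by rewrite sub_gen ?subsetUr.
have sMG : M \subset G by rewrite gen_subG subUset sub1set Gy lcn_sub.
have nMG : G \subset 'N(M).
  by rewrite -commg_subl (subset_trans _ sAM) ?commSg.
have -> : #|G| = #|<<x |: M>>|.
  congr #|pred_of_set _|; apply/eqP; rewrite eqEsubset gen_subG subUset sub1set Gx sMG.
  rewrite !andbT {1}defG gen_subG subUset !sub1set !mem_gen ?setU11 //.
  by rewrite inE mem_gen ?orbT // setU11.
have xM : x ^+ 3 \in M := subsetP sAM _ Ax3.
apply: leq_trans (card_gen_cube (subsetP nMG _ Gx) xM) _.
by rewrite -[9]/(3 * 3)%N -mulnA leq_mul2l /= card_gen_cube ?nA.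
Qed.

End TwoGenerators.

(** * Orders of groups generated by consecutive members of a sequence *)

Section Chains.

Variables (gT : finGroupType) (A : {group gT}).
Hypothesis cA : abelian A.

(** The member of smallest index is adjoined last, so that its cube, a combination of later members,
    is already present. The indices run over [a <= i < a + d]. *)
Fixpoint chain (f : nat -> gT) (M : {group gT}) (a d : nat) : {group gT} :=
  if d is d'.+1 then <<f a |: chain f M a.+1 d'>>%G else M.

Variables (f : nat -> gT) (M : {group gT}).
Hypotheses (Af : forall i, f i \in A) (sMA : M \subset A).

Lemma chain_sub a d : M \subset chain f M a d.
Proof.
elim: d a => [|d IH] a //=; apply: subset_trans (IH a.+1) _.
by rewrite sub_gen // subsetUr.
Qed.

Lemma chain_in a d i : a <= i < a + d -> f i \in chain f M a d.
Proof.
elim: d a => [|d IH] a /=; first by rewrite addn0 ltnNge andbC; case: leqP.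
case: (ltngtP a i) => //= [lt_ai lt_id | -> _]; last by rewrite mem_gen ?setU11.
by rewrite mem_gen // inE IH ?orbT // lt_ai addSnnS.
Qed.

Lemma chain_norm a d : chain f M a d \subset A.
Proof.
elim: d a => [|d IH] a //=.
by rewrite gen_subG subUset sub1set Af IH.
Qed.

(** The pattern of [com_cube]: the triple of a member is a combination of the next two. *)
Definition cube_descends a := forall i (N : {group gT}),
  a <= i -> f i.+1 \in N -> f i.+2 \in N -> f i ^+ 3 \in N.

(** The last member of the chain has its cube expressed by the two members beyond the end; these
    must therefore lie in [M]. *)
Lemma card_chain a d : cube_descends a ->
  f (a + d) \in M -> f (a + d).+1 \in M -> #|chain f M a d| <= 3 ^ d * #|M|.
Proof.
elim: d a => [|d IH] a Hf Md Md1; first by rewrite mul1n.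
have Hf1 : cube_descends a.+1 by move=> i N /ltnW; apply: Hf.
rewrite -addSnnS in Md Md1.
rewrite expnS -mulnA; apply: leq_trans (card_gen_cube _ _) _; last first.
- by rewrite leq_mul2l IH.
- have in_chain i : a.+1 <= i <= (a.+1 + d).+1 -> f i \in chain f M a.+1 d.
    case/andP=> lei; rewrite leq_eqVlt => /predU1P[->|].
      exact: subsetP (chain_sub _ _) _ Md1.
    rewrite ltnS leq_eqVlt => /predU1P[->|lti].
      exact: subsetP (chain_sub _ _) _ Md.
    by rewrite chain_in ?lei.
  apply: Hf => //; apply: in_chain; lia.
apply: (subsetP (sub_abelian_norm cA (chain_norm _ _))); exact: Af.
Qed.

End Chains.

Lemma card_chain1 (gT : finGroupType) (A : {group gT}) (f : nat -> gT) a d :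
    abelian A -> (forall i, f i \in A) -> cube_descends f a ->
    f (a + d) = 1 -> f (a + d).+1 = 1 ->
  #|chain f 1%G a d| <= 3 ^ d.
Proof.
move=> cA Af cf f1 f2; have := @card_chain _ _ cA f 1%G Af (sub1G _) a d cf.
by rewrite f1 f2 cards1 muln1; apply; apply: group1.
Qed.

(** * The elements s, sigma_j, tau_j and the relations in additive form *)

Section ModuleOfDerivedSubgroup.

Variables (gT : finGroupType) (G : {group gT}) (x y : gT).
Hypothesis cA : abelian 'L_2(G).
Hypotheses (Gx : x \in G) (Gy : y \in G).

Local Notation F := (fmod_of cA).
Local Notation X := (com (cA := cA) x).
Local Notation Y := (com (cA := cA) y).

Definition smod : F := fmod cA [~ y, x].
Definition sigmod j : F := iter (j - 3) X (fmod cA (y ^+ 3)).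
Definition taumod j : F := iter (j - 3) Y (fmod cA (x ^+ 3)).

Hypotheses (Ax3 : x ^+ 3 \in 'L_2(G)) (Ay3 : y ^+ 3 \in 'L_2(G)).

Lemma fmval_smod : fmval smod = [~ y, x].
Proof. by rewrite (fmodK cA) ?comm_lcn2. Qed.

Lemma smod_invy : fmod cA [~ y^-1, x] = (- (smod ^@ y^-1))%R.
Proof.
rewrite -fmodJ ?norm_lcn2 ?groupV // -fmodV; congr fmod.
by rewrite !commgEl !conjgE !mulgA mulVg mul1g !invMg !invgK !mulgA.
Qed.

Lemma elt_sigmaE j : elt_sigma x y j = fmval (sigmod j).
Proof.
rewrite /elt_sigma /sigmod; elim: (j - 3) => [|k IH] /=; first by rewrite (fmodK cA).
by rewrite IH fmval_com.
Qed.

Lemma elt_tauE j : elt_tau x y j = fmval (taumod j).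
Proof.
rewrite /elt_tau /taumod; elim: (j - 3) => [|k IH] /=; first by rewrite (fmodK cA).
by rewrite IH fmval_com.
Qed.

Lemma sigmodS j : 3 <= j -> X (sigmod j) = sigmod j.+1.
Proof. by move=> le3j; rewrite /sigmod subSn. Qed.

Lemma taumodS j : 3 <= j -> Y (taumod j) = taumod j.+1.
Proof. by move=> le3j; rewrite /taumod subSn. Qed.

(** The element [y] commutes with [y ^+ 3], and [Y] passes through the powers of [X] by [comC]. *)
Lemma com_y_sigmod j : Y (sigmod j) = 0%R.
Proof.
rewrite /sigmod; elim: (j - 3) => [|k IH] /=; last first.
  by rewrite comC // IH raddf0.
by rewrite -fmod_comm // (_ : [~ _, y] = 1) ?fmod1 //; exact/eqP/commgP/commute_sym/commuteX.
Qed.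

Lemma com_x_taumod j : X (taumod j) = 0%R.
Proof.
rewrite /taumod; elim: (j - 3) => [|k IH] /=; last first.
  by rewrite comC // IH raddf0.
by rewrite -fmod_comm // (_ : [~ _, x] = 1) ?fmod1 //; exact/eqP/commgP/commute_sym/commuteX.
Qed.

Lemma sigmod4 : X (sigmod 3) = (smod *+ 3 + Y smod *+ 3 + Y (Y smod))%R.
Proof. by rewrite -fmod_comm // comm_cube. Qed.

Lemma taumod4 : Y (taumod 3) = (- (smod *+ 3 + X smod *+ 3 + X (X smod)))%R.
Proof.
rewrite -fmod_comm // comm_cube // -(invg_comm y x) fmodV -/smod !raddfN /=.
by zmod_ring.
Qed.

(** [com_cube] speaks about images under [X], and sigma_j is one from index 4 on. Index 3 has to
    wait for the relations, in [sigmod3_cube]. *)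
Lemma sigmod_cube j : 4 <= j ->
  (sigmod j *+ 3 = - (sigmod j.+1 *+ 3 + sigmod j.+2))%R.
Proof.
case: j => // j le4j; have := com_cube (sigmod j) Gx Ax3.
rewrite !sigmodS ?(leqW, leqW (leqW _)) //; try lia.
by move=> ->; zmod_ring.
Qed.

Lemma taumod_cube j : 4 <= j ->
  (taumod j *+ 3 = - (taumod j.+1 *+ 3 + taumod j.+2))%R.
Proof.
case: j => // j le4j; have := com_cube (taumod j) Gy Ay3.
rewrite !taumodS //; try lia.
by move=> ->; zmod_ring.
Qed.

Lemma expgzE (u : F) z : expgz (fmval u) z = fmval (u *~ z)%R.
Proof. by case: z => n; rewrite /= ?NegzE ?mulrNz ?fmvalN fmvalZ. Qed.

Definition mod_relations m e (alpha beta gamma delta rho : int) : Prop :=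
  [/\ smod *+ 3 = sigmod 4 - sigmod m.-1 *~ (rho * beta) - taumod 4,
      X smod + sigmod 3 + sigmod 4
        = sigmod m.-2 *~ (rho * beta) + sigmod m.-1 *~ gamma + taumod e *~ delta,
      - Y smod + taumod 3 + taumod 4
        = sigmod m.-2 *~ (rho * delta) + sigmod m.-1 *~ alpha + taumod e *~ beta
    & taumod e.+1 = - (sigmod m.-1 *~ rho)]%R.

Lemma relationsE m e alpha beta gamma delta rho :
  relations m e x y alpha beta gamma delta rho
    <-> mod_relations m e alpha beta gamma delta rho.
Proof.
rewrite /relations !elt_sigmaE !elt_tauE.
have -> : elt_s x y 2 = fmval smod by rewrite fmval_smod.
have -> : elt_s x y 3 = fmval (X smod) by rewrite fmval_com // fmval_smod.
have -> : elt_t x y 3 = fmval (Y smod) by rewrite fmval_com // fmval_smod.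
rewrite !expgzE -!fmvalN -!fmvalZ -!fmvalA !mulrNz; split.
  by case=> /fmod_inj ? /fmod_inj ? /fmod_inj ? /fmod_inj ?.
by case=> ? ? ? ?; split; congr fmval.
Qed.

End ModuleOfDerivedSubgroup.

(** * Generators of the gamma_j(G) and the derived subgroups of the maximal subgroups *)

Section LowerCentralSeries.

Variables (gT : finGroupType) (G : {group gT}) (x y : gT).
Hypotheses (defG : G :=: <<[set x; y]>>) (cA : abelian 'L_2(G)).

Local Notation F := (fmod_of cA).
Local Notation X := (com (cA := cA) x).
Local Notation Y := (com (cA := cA) y).
Local Notation s := (smod x y cA).
Local Notation sig := (sigmod x y cA).
Local Notation tau := (taumod x y cA).

Section Membership.

Variable W : {group gT}.
Implicit Types u v : F.

Lemma fmvalD_in u v : fmval u \in W -> fmval v \in W -> fmval (u + v)%R \in W.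
Proof. by move=> Wu Wv; rewrite fmvalA groupM. Qed.

Lemma fmvalN_in u : fmval u \in W -> fmval (- u)%R \in W.
Proof. by move=> Wu; rewrite fmvalN groupV. Qed.

Lemma fmvalMn_in u k : fmval u \in W -> fmval (u *+ k)%R \in W.
Proof. by move=> Wu; rewrite fmvalZ groupX. Qed.

Lemma fmvalMz_in u k : fmval u \in W -> fmval (u *~ k)%R \in W.
Proof. by case: k => k Wu; rewrite ?NegzE ?mulrNz ?fmvalN ?groupV fmvalMn_in. Qed.

Lemma fmval0_in : fmval (0 : F)%R \in W.
Proof. by rewrite fmval0. Qed.

End Membership.

Let Gx : x \in G. Proof. by have [] := mem_gen2 defG. Qed.
Let Gy : y \in G. Proof. by have [] := mem_gen2 defG. Qed.

Lemma com_lcn g j (u : F) :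
  g \in G -> fmval u \in 'L_j.+1(G) -> fmval (com g u) \in 'L_j.+2(G).
Proof. by move=> Gg Lu; rewrite fmval_com // mem_commg. Qed.

Lemma smod_lcn : fmval s \in 'L_2(G).
Proof. exact: fmodP. Qed.

Hypothesis defL3 : 'L_3(G) = <<[set y ^+ 3; x ^+ 3] :|: 'L_4(G)>>.

Lemma cubes_lcn3 : (x ^+ 3 \in 'L_3(G)) /\ (y ^+ 3 \in 'L_3(G)).
Proof. by rewrite defL3 !mem_gen // !inE eqxx ?orbT. Qed.

Lemma cubes_lcn2 : (x ^+ 3 \in 'L_2(G)) /\ (y ^+ 3 \in 'L_2(G)).
Proof.
by have [? ?] := cubes_lcn3; split; apply: (subsetP (lcn_subS 2 G)).
Qed.

Let Ax3 : x ^+ 3 \in 'L_2(G). Proof. by have [] := cubes_lcn2. Qed.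
Let Ay3 : y ^+ 3 \in 'L_2(G). Proof. by have [] := cubes_lcn2. Qed.

Lemma sigmod_lcn j : 3 <= j -> fmval (sig j) \in 'L_j(G).
Proof.
elim: j => // j IH; rewrite leq_eqVlt => /predU1P[<-|]; last first.
  rewrite ltnS => le3j; rewrite -sigmodS //.
  by case: j le3j IH => // j le3j IH; apply: com_lcn => //; apply: IH.
by rewrite /sigmod /= (fmodK cA) //; case: cubes_lcn3.
Qed.

Lemma taumod_lcn j : 3 <= j -> fmval (tau j) \in 'L_j(G).
Proof.
elim: j => // j IH; rewrite leq_eqVlt => /predU1P[<-|]; last first.
  rewrite ltnS => le3j; rewrite -taumodS //.
  by case: j le3j IH => // j le3j IH; apply: com_lcn => //; apply: IH.
by rewrite /taumod /= (fmodK cA) //; case: cubes_lcn3.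
Qed.

(** Two generators suffice at every level because the mixed commutators [Y (sig j)] and [X (tau j)]
    vanish. *)
Lemma lcn_gen j : 3 <= j ->
  'L_j(G) = <<[set fmval (sig j); fmval (tau j)] :|: 'L_j.+1(G)>>.
Proof.
elim: j => // j IH; rewrite leq_eqVlt => /predU1P[<-|].
  by rewrite /sigmod /taumod /= !(fmodK cA).
rewrite ltnS => le3j; case: j le3j IH => // j le3j IH.
apply: (lcn_gen_step defG (IH le3j)).
  apply/subsetP=> z /set2P[] ->; [apply: sigmod_lcn | apply: taumod_lcn]; exact: (leqW le3j).
move=> a b /set2P[] -> /set2P[] ->; rewrite -fmval_com //.
- by rewrite sigmodS // mem_gen // !inE eqxx.
- by rewrite com_y_sigmod // fmval0 group1.
- by rewrite com_x_taumod // fmval0 group1.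
by rewrite taumodS // mem_gen // !inE eqxx orbT.
Qed.

(** Descending induction from a trivial term of the series; each step adds the two generators of
    [lcn_gen]. *)
Lemma lcn_sub_gen k (W : {group gT}) : nilpotent G -> 3 <= k ->
    (forall j, k <= j -> fmval (sig j) \in W) ->
    (forall j, k <= j -> fmval (tau j) \in W) ->
  'L_k(G) \subset W.
Proof.
move=> /lcnP[c Lc1] le3k Wsig Wtau.
have: 'L_(k + c)(G) \subset W.
  have le_c : c < k + c by rewrite -[c.+1]add1n leq_add2r (leq_trans _ le3k).
  by apply: subset_trans (lcn_sub_leq G le_c) _; rewrite Lc1 sub1G.
elim: c {Lc1} => [|c IH]; first by rewrite addn0.
rewrite addnS => sLW; apply: IH; rewrite lcn_gen ?(leq_trans le3k) ?leq_addr //.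
rewrite gen_subG subUset sLW andbT.
by apply/subsetP=> z /set2P[] ->; [apply: Wsig | apply: Wtau]; rewrite leq_addr.
Qed.

(** In [sigmod4] every term other than [s *+ 3] visibly lies in gamma_3(G). *)
Lemma smod_cube_lcn : fmval (s *+ 3)%R \in 'L_3(G).
Proof.
have -> : (s *+ 3 = X (sig 3) - (Y s *+ 3 + Y (Y s)))%R.
  by rewrite sigmod4 //; zmod_ring.
have LYs : fmval (Y s) \in 'L_3(G) by apply: com_lcn => //; apply: smod_lcn.
have L34 := subsetP (lcn_subS 3 G).
apply: fmvalD_in; first by apply/L34/com_lcn; rewrite ?sigmod_lcn.
by apply/fmvalN_in/fmvalD_in; rewrite ?fmvalMn_in //; apply/L34/com_lcn.
Qed.

(** One factor 3 for each of [x], [y] and [s]. With |G| = 3^(m+e-2) this gives the lower bound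
    3^(m+e-5) for gamma_3(G). *)
Lemma card_lcn3 : #|G| <= 27 * #|'L_3(G)|.
Proof.
apply: leq_trans (card_lcn2 defG Ax3 Ay3) _.
rewrite -[27]/(9 * 3)%N -mulnA leq_mul2l /= (lcn2_gen defG).
apply: card_gen_cube; first exact: (subsetP (lcn_norm 3 G)) (groupR Gy Gx).
by rewrite -(fmval_smod cA) // -fmvalZ smod_cube_lcn.
Qed.

Lemma card_lcn_quotient_gen1 j (u : F) :
    'L_j(G) = <<fmval u |: 'L_j.+1(G)>> -> fmval (u *+ 3)%R \in 'L_j.+1(G) ->
  #|'L_j(G) / 'L_j.+1(G)| <= 3.
Proof.
move=> defL Lu3; have Gu : fmval u \in G := subsetP (lcn_sub 2 G) _ (fmodP u).
have nLG := lcn_norm j.+1 G.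
rewrite card_quotient ?(subset_trans (lcn_sub _ _)) //.
rewrite -(leq_pmul2l (cardG_gt0 'L_j.+1(G))) Lagrange ?lcn_subS // mulnC.
by rewrite [gval _]defL card_gen_cube ?(subsetP nLG) // -fmvalZ.
Qed.

(** The elements s, sigma_j and tau_j generate ['L_2(G)] as an abelian group, so the preimage [W] of
    [D] under the additive map [phi] is everything once it contains them. *)
Lemma lcn2_image_sub (D : {group gT}) (phi : F -> F) : nilpotent G ->
    {morph phi : u v / (u + v)%R} -> fmval (phi s) \in D ->
    (forall j, 3 <= j -> fmval (phi (sig j)) \in D) ->
    (forall j, 3 <= j -> fmval (phi (tau j)) \in D) ->
  forall u, fmval (phi u) \in D.
Proof.
move=> nilG phiD Ds Dsig Dtau.
have phi0 : phi 0%R = 0%R by apply: (addrI (phi 0%R)); rewrite -phiD !addr0.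
pose W := [set fmval u | u : F & fmval (phi u) \in D].
have gW : group_set W.
  apply/group_setP; split=> [|_ _ /imsetP[u Du ->] /imsetP[v Dv ->]].
    by apply/imsetP; exists 0%R; rewrite ?inE ?phi0 ?fmval0.
  apply/imsetP; exists (u + v)%R; rewrite // inE phiD fmvalD_in //.
    by rewrite inE in Du.
  by rewrite inE in Dv.
have WP (u : F) : fmval (phi u) \in D -> fmval u \in Group gW.
  by move=> Du; apply/imsetP; exists u; rewrite ?inE.
have sAW : 'L_2(G) \subset Group gW.
  rewrite (lcn2_gen defG) gen_subG subUset sub1set -(fmval_smod cA) // WP //.
  by apply: lcn_sub_gen => // j le3j; apply: WP; auto.
move=> u; have /imsetP[v Dv /fmod_inj->] := subsetP sAW _ (fmodP u).
by rewrite inE in Dv.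
Qed.

Lemma lcn2_cube (u : F) : nilpotent G -> fmval (u *+ 3)%R \in 'L_3(G).
Proof.
move=> nilG; move: u; apply: (lcn2_image_sub (D := [group of 'L_3(G)])) => //.
- by move=> u v; rewrite mulrnDl.
- exact: smod_cube_lcn.
- move=> j le3j; apply/fmvalMn_in/(subsetP (lcn_sub_leq G le3j)).
  exact: sigmod_lcn.
move=> j le3j; apply/fmvalMn_in/(subsetP (lcn_sub_leq G le3j)).
exact: taumod_lcn.
Qed.

Section MaximalSubgroup.

Variable g : gT.
Hypothesis Gg : g \in G.

Let M := <<g |: 'L_2(G)>>%G.

(** Since [M] extends the abelian normal subgroup ['L_2(G)] by the single element [g], the image of
    the endomorphism [com g] is already normal in [M] and contains all commutators of generators. *)
Lemma der_maxP v :
  reflect (exists u : F, v = fmval (com g u)) (v \in 'L_2(M)).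
Proof.
have Mg : g \in M by rewrite mem_gen ?setU11.
have sAM : 'L_2(G) \subset M by rewrite sub_gen ?subsetUr.
apply: (iffP idP) => [|[u ->]]; last first.
  by rewrite fmval_com // mem_commg // (subsetP sAM) // fmodP.
pose I := [set fmval (com g u) | u : F].
have gI : group_set I.
  apply/group_setP; split=> [|_ _ /imsetP[u _ ->] /imsetP[v' _ ->]].
    by apply/imsetP; exists 0%R; rewrite ?raddf0 ?fmval0.
  by apply/imsetP; exists (u + v')%R; rewrite // raddfD fmvalA.
have IP (u : F) : fmval (com g u) \in I by apply/imsetP; exists u.
suff: 'L_2(M) \subset Group gI by move/subsetP=> sMI /sMI/imsetP[u _ ->]; exists u.
have sIA : I \subset 'L_2(G) by apply/subsetP=> _ /imsetP[u _ ->]; apply: fmodP.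
have nIM : M \subset 'N(Group gI).
  rewrite gen_subG subUset sub1set (sub_abelian_norm cA) // andbT inE.
  apply/subsetP=> _ /imsetP[_ /imsetP[u _ ->] ->].
  rewrite -[_ ^ _](fmvalJ _ (norm_lcn2 Gg)) (_ : (com g u ^@ g = com g (u ^@ g))%R).
    exact: IP.
  by rewrite !actE [RHS]raddfD.
apply: commg_gen_sub => // a b /setU1P[->|Aa] /setU1P[->|Ab].
- by rewrite commgg group1.
- by rewrite -invg_comm groupV -(fmodK cA Ab) -fmval_com.
- by rewrite -(fmodK cA Aa) -fmval_com.
by rewrite (_ : [~ a, b] = 1) //; apply/eqP/commgP/(centsP cA).
Qed.

Lemma der_max_sub (D : {group gT}) : nilpotent G ->
    fmval (com g s) \in D ->
    (forall j, 3 <= j -> fmval (com g (sig j)) \in D) ->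
    (forall j, 3 <= j -> fmval (com g (tau j)) \in D) ->
  'L_2(M) \subset D.
Proof.
move=> nilG Ds Dsig Dtau; apply/subsetP=> _ /der_maxP[u ->]; move: u.
by apply: lcn2_image_sub => //; apply: raddfD.
Qed.

End MaximalSubgroup.

End LowerCentralSeries.

Lemma small_exponentP z : small_exponent z -> [\/ z = 0, z = 1 | z = -1]%R.
Proof.
move=> /andP[le1 ge1]; have [->|z0] := eqVneq z 0%R; [by constructor 1|].
have [->|z1] := eqVneq z 1%R; [by constructor 2|constructor 3]; lia.
Qed.

(** * Counting: sigma_(m-1) or sigma_(m-2) outside M_1', tau_e outside M_2' *)

Section Relations.

Variables (gT : finGroupType) (G : {group gT}) (x y : gT).
Hypotheses (defG : G :=: <<[set x; y]>>) (cA : abelian 'L_2(G)).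
Hypothesis defL3 : 'L_3(G) = <<[set y ^+ 3; x ^+ 3] :|: 'L_4(G)>>.

Local Notation F := (fmod_of cA).
Local Notation X := (com (cA := cA) x).
Local Notation Y := (com (cA := cA) y).
Local Notation s := (smod x y cA).
Local Notation sig := (sigmod x y cA).
Local Notation tau := (taumod x y cA).

Let Gx : x \in G. Proof. by have [] := mem_gen2 defG. Qed.
Let Gy : y \in G. Proof. by have [] := mem_gen2 defG. Qed.
Let Ax3 : x ^+ 3 \in 'L_2(G). Proof. by have [] := cubes_lcn2 defL3. Qed.
Let Ay3 : y ^+ 3 \in 'L_2(G). Proof. by have [] := cubes_lcn2 defL3. Qed.

Lemma cube_descends_sig4 : cube_descends (fun j => fmval (sig j)) 4.
Proof.
move=> j N le4j N1 N2; rewrite -fmvalZ sigmod_cube //.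
by apply/fmvalN_in/fmvalD_in; rewrite ?fmvalMn_in.
Qed.

Lemma cube_descends_tau4 : cube_descends (fun j => fmval (tau j)) 4.
Proof.
move=> j N le4j N1 N2; rewrite -fmvalZ taumod_cube //.
by apply/fmvalN_in/fmvalD_in; rewrite ?fmvalMn_in.
Qed.

Lemma fmvalMz_small (W : {group gT}) (u : F) z : small_exponent z ->
  fmval (u *~ z)%R \in W -> z = 0%R \/ fmval u \in W.
Proof.
case/small_exponentP=> -> //; [by left | by right | right].
by rewrite -groupV -fmvalN -mulrN1z.
Qed.

Let comBMz g (u v w : F) z :
  com g (u - v *~ z - w)%R = (com g u - com g v *~ z - com g w)%R.
Proof. by zmod_ring. Qed.

Variables (m e : nat) (alpha beta gamma delta rho : int).
Hypotheses (Lm1 : 'L_m(G) = 1) (le4e : 4 <= e) (lt_em : e < m).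
Hypothesis hrho : small_exponent rho.
Hypothesis rel : mod_relations x y cA m e alpha beta gamma delta rho.

Let nilG : nilpotent G.
Proof.
by apply/lcnP; exists m; apply/trivgP; rewrite -Lm1 lcn_subS.
Qed.

Lemma sigmod_vanish j : m <= j -> sig j = 0%R.
Proof.
move=> le_mj; apply: fmod_inj; rewrite [RHS]fmval0.
apply/set1gP; rewrite -Lm1; apply: (subsetP (lcn_sub_leq G le_mj)).
apply: (sigmod_lcn defG cA defL3); nat_lia.
Qed.

Lemma sigmod_last_cube : (sig m.-1 *+ 3 = 0)%R.
Proof.
rewrite sigmod_cube //; last nat_lia.
by rewrite !sigmod_vanish ?mul0rn ?addr0 ?oppr0 //; nat_lia.
Qed.

(** By the last relation tau_(e+1) is a multiple of some sigma_j, and [Y] kills those. *)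
Lemma taumod_e2 : (tau e.+2 = 0)%R.
Proof.
rewrite -taumodS; last nat_lia.
have [_ _ _ ->] := rel.
by rewrite raddfN raddfMz /= com_y_sigmod // mul0rz oppr0.
Qed.

Lemma taumod_e_cube : (tau e *+ 3 = 0)%R.
Proof.
rewrite taumod_cube // taumod_e2 addr0.
have [_ _ _ ->] := rel.
have -> : (- ((- (sig m.-1 *~ rho)) *+ 3) = sig m.-1 *+ 3 *~ rho)%R by zmod_ring.
by rewrite sigmod_last_cube mul0rz.
Qed.

Lemma taumod_vanish_e2 j : e.+2 <= j -> tau j = 0%R.
Proof.
elim: j => // j IH; rewrite leq_eqVlt => /predU1P[<-|]; first exact: taumod_e2.
by rewrite ltnS => le_ej; rewrite -taumodS ?IH ?raddf0 //; nat_lia.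
Qed.

(* For m = e + 1 the last relation reads 1 = sigma_(m-1)^(-rho). *)
Hypothesis rho_em : rho != 0%R -> e.+1 < m.

Let rho_term z : (sig m.-2 *~ (rho * z) *+ 3 = 0)%R.
Proof.
have [->|rho0] := eqVneq rho 0%R; first by rewrite mul0r mulr0z mul0rn.
have ltm := rho_em rho0; rewrite mulrzA.
have -> : (sig m.-2 *~ rho *~ z *+ 3 = sig m.-2 *+ 3 *~ rho *~ z)%R by zmod_ring.
rewrite sigmod_cube //; last nat_lia.
have -> : m.-2.+1 = m.-1 by nat_lia.
have -> : m.-1.+1 = m by nat_lia.
by rewrite sigmod_last_cube sigmod_vanish // addr0 oppr0 !mul0rz.
Qed.

(** Three times the second relation: its right-hand side has order dividing 3, and [X] applied to
    the first relation turns [X s *+ 3] into sigma_5. *)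
Lemma sigmod3_cube : (sig 3 *+ 3 = - (sig 4 *+ 3 + sig 5))%R.
Proof.
have [R1 R2 _ _] := rel.
have E1 : (X s *+ 3 = sig 5)%R.
  rewrite -raddfMn /= R1 comBMz com_x_taumod // !sigmodS //; last nat_lia.
  have -> : m.-1.+1 = m by nat_lia.
  by rewrite (sigmod_vanish (leqnn m)) mul0rz !subr0.
have E2 : ((X s + sig 3 + sig 4) *+ 3 = 0)%R.
  rewrite R2 !mulrnDl rho_term add0r.
  have -> : (sig m.-1 *~ gamma *+ 3 + tau e *~ delta *+ 3
           = sig m.-1 *+ 3 *~ gamma + tau e *+ 3 *~ delta)%R by zmod_ring.
  by rewrite sigmod_last_cube taumod_e_cube !mul0rz addr0.
rewrite -E1; apply/eqP; rewrite -subr_eq0 -E2; apply/eqP; zmod_ring.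
Qed.

Lemma taumod3_cube : (tau 3 *+ 3 = - (tau 4 *+ 3 + tau 5))%R.
Proof.
have [R1 _ R3 _] := rel.
have E1 : (Y s *+ 3 = - tau 5)%R.
  rewrite -raddfMn /= R1 comBMz !com_y_sigmod // !taumodS //.
  by rewrite mul0rz !sub0r oppr0 add0r.
have E2 : ((- Y s + tau 3 + tau 4) *+ 3 = 0)%R.
  rewrite R3 !mulrnDl rho_term add0r.
  have -> : (sig m.-1 *~ alpha *+ 3 + tau e *~ beta *+ 3
           = sig m.-1 *+ 3 *~ alpha + tau e *+ 3 *~ beta)%R by zmod_ring.
  by rewrite sigmod_last_cube taumod_e_cube !mul0rz addr0.
have -> : (tau 5 = - (Y s *+ 3))%R by rewrite E1 opprK.
apply/eqP; rewrite -subr_eq0 -E2; apply/eqP; zmod_ring.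
Qed.

Lemma cube_descends_sig3 : cube_descends (fun j => fmval (sig j)) 3.
Proof.
move=> j N; rewrite leq_eqVlt => /predU1P[<-|]; last exact: cube_descends_sig4.
move=> N1 N2; rewrite -fmvalZ sigmod3_cube //.
by apply/fmvalN_in/fmvalD_in; rewrite ?fmvalMn_in.
Qed.

Lemma cube_descends_tau3 : cube_descends (fun j => fmval (tau j)) 3.
Proof.
move=> j N; rewrite leq_eqVlt => /predU1P[<-|]; last exact: cube_descends_tau4.
move=> N1 N2; rewrite -fmvalZ taumod3_cube //.
by apply/fmvalN_in/fmvalD_in; rewrite ?fmvalMn_in.
Qed.

Hypothesis cardG : #|G| = (3 ^ (m + e - 2))%N.

Lemma lcn3_not_small : ~ (#|'L_3(G)| <= 3 ^ (m + e - 6)).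
Proof.
move=> small; have := card_lcn3 defG cA defL3.
apply/negP; rewrite -ltnNge cardG.
have -> : m + e - 2 = (m + e - 6) + 4 by nat_lia.
apply: leq_ltn_trans (leq_mul (leqnn 27) small) _.
by rewrite expnD mulnC ltn_pmul2l ?expn_gt0.
Qed.

Local Notation M1 := <<y |: 'L_2(G)>>%G.
Local Notation M2 := <<x |: 'L_2(G)>>%G.

Lemma com_in_der_max g (u : F) : g \in G ->
  fmval (com g u) \in 'L_2(<<g |: 'L_2(G)>>%G).
Proof. by move=> Gg; apply/(der_maxP cA Gg); exists u. Qed.

Let A_f (u : nat -> F) j : fmval (u j) \in 'L_2(G). Proof. exact: fmodP. Qed.

(* If tau_e were in M2', then M2' and the tau_j with j < e would generate
   gamma_3(G), which has order at least 3^(m+e-5); but |M2'| <= 3^(m-3). *)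
Lemma tau_e_notin_M2 : fmval (tau e) \notin 'L_2(M2).
Proof.
apply/negP=> D2te; apply: lcn3_not_small.
have D2sig j : 4 <= j -> fmval (sig j) \in 'L_2(M2).
  by case: j => // j le3j; rewrite -sigmodS // com_in_der_max.
have D2e1 : fmval (tau e.+1) \in 'L_2(M2).
  have [_ _ _ ->] := rel; rewrite fmvalN_in ?fmvalMz_in ?D2sig //; nat_lia.
have bound : #|'L_2(M2)| <= 3 ^ (m - 3).
  (* [X] kills every tau_j, so M_2' needs only [X s] and sigma_4, ..., sigma_(m-1): in all m - 3
     generators. *)
  pose C := chain (fun j => fmval (sig j)) 1%G 4 (m - 4).
  have Csig j : 4 <= j -> fmval (sig j) \in C.
    move=> le4j; have [le_mj|lt_jm] := leqP m j.
      by rewrite sigmod_vanish // fmval0_in.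
    by apply: chain_in; nat_lia.
  have Em : 4 + (m - 4) = m by nat_lia.
  have cardC : #|C| <= 3 ^ (m - 4).
    apply: (card_chain1 cA) => //; first exact: cube_descends_sig4.
      by rewrite Em sigmod_vanish // fmval0.
    by rewrite Em sigmod_vanish // fmval0.
  have sCA : C \subset 'L_2(G) by apply: chain_norm => //; apply: sub1G.
  have Xs3 : fmval (X s) ^+ 3 \in C.
    have [R1 _ _ _] := rel.
    rewrite -fmvalZ -raddfMn /= R1 comBMz com_x_taumod // !sigmodS //; last nat_lia.
    rewrite subr0; apply: fmvalD_in; first exact: Csig.
    by apply/fmvalN_in/fmvalMz_in/Csig; nat_lia.
  have nC := subsetP (sub_abelian_norm cA sCA) _ (fmodP (X s)).
  have -> : m - 3 = (m - 4).+1 by nat_lia.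
  apply: leq_trans (subset_leq_card _) (leq_trans (card_gen_cube nC Xs3) _).
    have sub_gen_C : C \subset <<fmval (X s) |: C>> by rewrite sub_gen ?subsetUr.
    apply: (der_max_sub (D := <<fmval (X s) |: C>>%G) defG defL3 Gx) => // [|j le3j|j _].
    - by rewrite mem_gen // setU11.
    - by rewrite sigmodS // (subsetP sub_gen_C) ?Csig.
    by rewrite com_x_taumod // fmval0_in.
  by rewrite expnS leq_mul2l.
pose W := chain (fun j => fmval (tau j)) 'L_2(M2)%G 3 (e - 3).
have sDW : 'L_2(M2) \subset W := chain_sub _ _ _ _.
have E3e : 3 + (e - 3) = e by nat_lia.
have Wtau j : 3 <= j -> fmval (tau j) \in W.
  move=> le3j; case: (ltngtP j e) => [lt_je|lt_ej|->].
  - by apply: chain_in; nat_lia.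
  - rewrite (subsetP sDW) //; have [le_e2|] := leqP e.+2 j.
      by rewrite taumod_vanish_e2 // fmval0_in.
    by rewrite ltnS => ?; have -> : j = e.+1 by nat_lia.
  exact: subsetP sDW _ D2te.
(* Only sigma_3 is not an image under [X]; the second relation expresses it by elements of M_2',
   among them tau_e by assumption. *)
have Wsig j : 3 <= j -> fmval (sig j) \in W.
  rewrite leq_eqVlt => /predU1P[<-|le4j]; apply: (subsetP sDW); last exact: D2sig.
  have [_ R2 _ _] := rel.
  have -> : (sig 3 = (X s + sig 3 + sig 4) - X s - sig 4)%R by zmod_ring.
  rewrite R2; apply: fmvalD_in; last by rewrite fmvalN_in ?D2sig.
  apply: fmvalD_in; last by rewrite fmvalN_in // com_in_der_max.
  apply: fmvalD_in; last by rewrite fmvalMz_in.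
  apply: fmvalD_in; last by rewrite fmvalMz_in // D2sig //; nat_lia.
  have [->|rho0] := eqVneq rho 0%R; first by rewrite mul0r mulr0z fmval0_in.
  have lt_e1m := rho_em rho0.
  by rewrite fmvalMz_in // D2sig //; nat_lia.
have sDA : 'L_2(M2) \subset 'L_2(G).
  by apply/subsetP=> _ /(der_maxP cA Gx)[u ->]; apply: fmodP.
have cardW : #|W| <= 3 ^ (e - 3) * #|'L_2(M2)|.
  apply: (card_chain cA) => //; rewrite ?E3e //; exact: cube_descends_tau3.
have -> : m + e - 6 = (e - 3) + (m - 3) by nat_lia.
have sLW : 'L_3(G) \subset W by apply: (lcn_sub_gen defG defL3).
rewrite expnD; apply: leq_trans (subset_leq_card sLW) (leq_trans cardW _).
by rewrite leq_mul2l bound orbT.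
Qed.

(* For rho <> 0 the relation for tau_(e+1) puts sigma_(m-1) into M1', and the
   role of sigma_(m-1) is taken by sigma_(m-2). *)
Lemma sig_last_notin_M1 : fmval (sig (m.-1 - (rho != 0%R))) \notin 'L_2(M1).
Proof.
have [k Ek] : exists k, k = (rho != 0%R) :> nat by exists (rho != 0%R).
rewrite -Ek; apply/negP=> D1sig; apply: lcn3_not_small.
have D1tau j : 4 <= j -> fmval (tau j) \in 'L_2(M1).
  by case: j => // j le3j; rewrite -taumodS // com_in_der_max.
have ltk : e + k < m.
  by rewrite Ek; case: eqP => [_|/eqP/rho_em]; rewrite ?addn0 ?addn1.
have e1_last : k = 0 -> tau e.+1 = 0%R.
  rewrite Ek; case: eqP => // rho0 _; have [_ _ _ ->] := rel.
  by rewrite rho0 mulr0z oppr0.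
have D1last : fmval (sig m.-1) \in 'L_2(M1).
  have [rho0|rho0] := eqVneq rho 0%R.
    by have -> : m.-1 = m.-1 - k by rewrite Ek rho0 eqxx subn0.
  have /fmvalN_in := D1tau e.+1 (leqW le4e).
  have [_ _ _ ->] := rel; rewrite opprK => /(fmvalMz_small hrho)[E|//].
  by rewrite E eqxx in rho0.
(* [B] is trivial for rho = 0 and generated by sigma_(m-1) otherwise; in both cases it absorbs
   tau_(e+1). Above it, M_1' needs tau_4, ..., tau_e and [Y s], that is, e - 2 further
   generators. *)
pose B := chain (fun j => fmval (sig j)) 1%G (m - 1) k.
pose C := chain (fun j => fmval (tau j)) B 4 (e - 3).
have sBA : B \subset 'L_2(G) by apply: chain_norm => //; apply: sub1G.
have sCA : C \subset 'L_2(G) by apply: chain_norm.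
have cardB : #|B| <= 3 ^ k.
  case: (posnP k) => [k0|k_gt0]; first by rewrite /B k0 /= cards1.
  have Em : m - 1 + k = m by nat_lia.
  apply: (card_chain1 cA) => //; rewrite ?Em ?sigmod_vanish ?fmval0 //.
  by move=> j N lej; apply: cube_descends_sig4; nat_lia.
have Be1 : fmval (tau e.+1) \in B.
  have [k0|k1] := posnP k; first by rewrite e1_last // fmval0_in.
  have [_ _ _ ->] := rel; apply/fmvalN_in/fmvalMz_in.
  by rewrite -subn1; apply: chain_in; rewrite leqnn -[X in X < _]addn0 ltn_add2l.
have cardC : #|C| <= 3 ^ (e - 3 + k).
  apply: leq_trans (_ : 3 ^ (e - 3) * #|B| <= _); last first.
    by rewrite expnD leq_mul2l cardB orbT.
  have E4e : 4 + (e - 3) = e.+1 by nat_lia.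
  apply: (card_chain cA) => //; rewrite ?E4e //; first exact: cube_descends_tau4.
  by rewrite taumod_e2 fmval0_in.
have Ctau j : 4 <= j -> fmval (tau j) \in C.
  move=> le4j; have [lt_je|lt_ej] := leqP j e; first by apply: chain_in; nat_lia.
  apply: (subsetP (chain_sub _ _ _ _)); have [le_e2|] := leqP e.+2 j.
    by rewrite taumod_vanish_e2 // fmval0_in.
  by rewrite ltnS => ?; have -> : j = e.+1 by nat_lia.
have bound : #|'L_2(M1)| <= 3 ^ (e - 2 + k).
  have Ys3 : fmval (Y s) ^+ 3 \in C.
    have [R1 _ _ _] := rel.
    rewrite -fmvalZ -raddfMn /= R1 comBMz !com_y_sigmod // !taumodS //.
    by rewrite mul0rz subr0 sub0r fmvalN_in // Ctau.
  have nC := subsetP (sub_abelian_norm cA sCA) _ (fmodP (Y s)).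
  have -> : e - 2 + k = (e - 3 + k).+1 by nat_lia.
  apply: leq_trans (subset_leq_card _) (leq_trans (card_gen_cube nC Ys3) _).
    have sub_gen_C : C \subset <<fmval (Y s) |: C>> by rewrite sub_gen ?subsetUr.
    apply: (der_max_sub (D := <<fmval (Y s) |: C>>%G) defG defL3 Gy) => //.
    - by rewrite mem_gen // setU11.
    - by move=> j _; rewrite com_y_sigmod // fmval0_in.
    by move=> j le3j; rewrite taumodS // (subsetP sub_gen_C) ?Ctau.
  by rewrite expnS leq_mul2l.
(* The generators sigma_j with 3 <= j < m - 1 - k; sigma_(m-1-k) is in M_1' by assumption. The
   exponents m - 4 - k and e - 2 + k add up to m + e - 6. *)
pose W := chain (fun j => fmval (sig j)) 'L_2(M1)%G 3 (m - 4 - k).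
have sDW : 'L_2(M1) \subset W := chain_sub _ _ _ _.
have E3m : 3 + (m - 4 - k) = m.-1 - k by nat_lia.
have D1m : fmval (sig (m.-1 - k).+1) \in 'L_2(M1).
  have [k0|k1] := posnP k.
    by rewrite k0 subn0 prednK ?sigmod_vanish ?fmval0_in //; nat_lia.
  by have -> : (m.-1 - k).+1 = m.-1 by nat_lia.
have Wsig j : 3 <= j -> fmval (sig j) \in W.
  move=> le3j; have [le_mj|lt_jm] := leqP m j.
    by rewrite sigmod_vanish // fmval0_in.
  have [lt_j|le_j] := ltnP j (m.-1 - k); first by apply: chain_in; nat_lia.
  rewrite (subsetP sDW) //; move: le_j; rewrite leq_eqVlt => /predU1P[<- //|?].
  by have -> : j = (m.-1 - k).+1 by nat_lia.
have Wtau j : 3 <= j -> fmval (tau j) \in W.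
  rewrite leq_eqVlt => /predU1P[<-|le4j]; apply: (subsetP sDW); last exact: D1tau.
  have [_ _ R3 _] := rel.
  have -> : (tau 3 = (- Y s + tau 3 + tau 4) + Y s - tau 4)%R by zmod_ring.
  rewrite R3; apply: fmvalD_in; last by rewrite fmvalN_in ?D1tau.
  apply: fmvalD_in; last exact: com_in_der_max.
  apply: fmvalD_in; last by rewrite fmvalMz_in ?D1tau.
  apply: fmvalD_in; last by rewrite fmvalMz_in.
  have [->|rho0] := eqVneq rho 0%R; first by rewrite mul0r mulr0z fmval0_in.
  apply: fmvalMz_in; have -> : m.-2 = m.-1 - k; last by [].
  by rewrite Ek rho0 subn1.
have sDA : 'L_2(M1) \subset 'L_2(G).
  by apply/subsetP=> _ /(der_maxP cA Gy)[u ->]; apply: fmodP.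
have cardW : #|W| <= 3 ^ (m - 4 - k) * #|'L_2(M1)|.
  apply: (card_chain cA) => //; rewrite ?E3m //; exact: cube_descends_sig3.
have -> : m + e - 6 = (m - 4 - k) + (e - 2 + k) by nat_lia.
have sLW : 'L_3(G) \subset W by apply: (lcn_sub_gen defG defL3).
rewrite expnD; apply: leq_trans (subset_leq_card sLW) (leq_trans cardW _).
by rewrite leq_mul2l bound orbT.
Qed.

End Relations.

(** * Transfers *)

Section TransferToNormalSubgroupOfIndexThree.

Variables (gT : finGroupType) (G M : {group gT}).
Hypotheses (nMG : M <| G) (indexM : #|G : M| = 3).

Local Notation abM := (abelianisation_map_abelian M).
Definition abelianised (w : gT) : fmod_of abM := fmod abM (abelianisation_map M w).
Local Notation fM := abelianised.

(** Transfers are tracked by representatives in [M]; the value matters only modulo ['L_2(M)]. *)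
Definition transfer_value g w : Prop :=
  [/\ g \in G, w \in M & transfer G abM g = fM w].

Let sMG : M \subset G := normal_sub nMG.

Let fMM v w : v \in M -> w \in M -> (fM (v * w)%g = fM v + fM w)%R.
Proof.
by move=> Mv Mw; rewrite /abelianised morphM // (fmodM abM) // mem_morphim.
Qed.

Lemma transfer_valueM g h v w :
  transfer_value g v -> transfer_value h w -> transfer_value (g * h) (v * w).
Proof.
move=> [Gg Mv Eg] [Gh Mw Eh]; split; rewrite ?groupM //.
by rewrite transferM // Eg Eh fMM.
Qed.

Lemma transfer_valueV g v : transfer_value g v -> transfer_value g^-1 v^-1.
Proof.
move=> [Gg Mv Eg]; split; rewrite ?groupV //.
apply: (addrI (transfer G abM g)); rewrite -transferM ?groupV // Eg -fMM ?groupV //.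
rewrite !mulgV.
have -> : transfer G abM 1 = 0%R by exact: (morph1 (transfer_morphism G abM)).
by rewrite /abelianised morph1 fmod1.
Qed.

Lemma transfer_value_ker g w :
  transfer_value g w -> (g \in transfer_ker G M) = (w \in 'L_2(M)).
Proof.
move=> [Gg Mw Eg]; rewrite inE Gg /= inE /= Eg.
have nMw := subsetP (lcn_norm 2 M) _ Mw.
have am : abelianisation_map M w = coset 'L_2(M) w by [].
apply/set1gP/idP => [E|Dw]; last first.
  by rewrite /abelianised am coset_id // fmod1.
have /(congr1 (@fmval _ _ abM)) : fM w = 0%R by [].
rewrite /abelianised fmval0 (fmodK abM) ?mem_morphim // am.
exact: coset_idr.
Qed.

Section Representatives.

Variable h : gT.
Hypotheses (Gh : h \in G) (notMh : h \notin M).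

Let Mh3 : h ^+ 3 \in M.
Proof.
have nMh := subsetP (normal_norm nMG) _ Gh.
apply: coset_idr; first exact: groupX.
rewrite morphX //; apply/eqP; rewrite -order_dvdn -indexM -card_quotient ?normal_norm //.
by rewrite order_dvdG // mem_quotient.
Qed.

Let notMh2 : h ^+ 2 \notin M.
Proof.
apply: contra notMh => Mh2.
have := groupM Mh3 (groupVr Mh2).
by rewrite [h ^+ 3]expgS mulgK.
Qed.

Lemma index3_cosets z : z \in G -> exists2 i, i < 3 & z \in M :* h ^+ i.
Proof.
move=> Gz; have nM := normal_norm nMG.
have [nMz nMh] := (subsetP nM _ Gz, subsetP nM _ Gh).
have cMG : <[coset M h]> = G / M.
  apply/eqP; rewrite eqEcard cycle_subG mem_quotient //= card_quotient // indexM.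
  rewrite -orderE; have : #[coset M h] %| 3 by rewrite order_dvdn -morphX //= coset_id.
  rewrite dvdn_divisors // => /predU1P[o1|/predU1P[->|//]] //.
  by case/negP: notMh; apply: coset_idr => //; apply/eqP; rewrite -order_eq1 o1.
have : coset M z \in <[coset M h]> by rewrite cMG mem_quotient.
case/cyclePmin => i lti Ez; exists i.
  apply: leq_trans lti _; rewrite dvdn_leq // order_dvdn -morphX //=.
  by rewrite coset_id.
rewrite mem_rcoset; apply: coset_idr; first by rewrite groupM ?groupV ?groupX.
rewrite morphM ?groupV ?groupX // morphV ?groupX // morphX //= Ez.
exact: mulgV.
Qed.

Lemma powers_transversal :
  is_transversal [set 1; h; h ^+ 2] (rcosets M G) G.
Proof.
apply/and3P; split.
- exact: rcosets_partition.
- by apply/subsetP=> z; rewrite !inE => /orP[/orP[]|] /eqP->; rewrite ?group1 ?groupX.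
apply/forall_inP=> _ /rcosetsP[z Gz ->].
have [i lt_i3 /rcoset_eqP->] := index3_cosets Gz.
have Mh : (h \in M) = false by apply: negbTE.
have Mh2 : (h ^+ 2 \in M) = false by apply: negbTE.
apply/cards1P; exists (h ^+ i); apply/setP=> w; rewrite !inE mem_rcoset.
case: i lt_i3 => [|[|[|//]]] _; rewrite ?expg0 ?expg1 ?invg1 ?mulg1.
- apply/idP/eqP => [/andP[/orP[/orP[]|] /eqP-> //]|->]; rewrite ?eqxx ?group1 //.
    by rewrite Mh.
  by rewrite Mh2.
- apply/idP/eqP => [/andP[/orP[/orP[]|] /eqP-> //]|->].
  + by rewrite mul1g groupV Mh.
  + by rewrite [h ^+ 2]expgS mulgK Mh.
  by rewrite eqxx orbT mulgV group1.
apply/idP/eqP => [/andP[/orP[/orP[]|] /eqP-> //]|->].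
+ by rewrite mul1g groupV Mh2.
+ by rewrite [h ^+ 2]expgS invMg mulKVg groupV Mh.
by rewrite eqxx orbT mulgV group1.
Qed.

Lemma big_powers (T : nmodType) (F : gT -> T) :
  (\sum_(z in [set 1%g; h; (h ^+ 2)%g]) F z = F 1%g + F h + F (h ^+ 2)%g)%R.
Proof.
have h1 : h != 1 by apply: contraNneq notMh => ->; apply: group1.
have h2 : h ^+ 2 != 1 by apply: contraNneq notMh2 => ->; apply: group1.
have h12 : h != h ^+ 2.
  by apply: contraNneq h1 => /(congr1 (fun z => h^-1 * z)); rewrite mulVg mulKg => <-.
rewrite -setUA big_setU1 /=; last first.
  by rewrite !inE ![1 == _]eq_sym negb_or h1.
by rewrite big_setU1 ?inE // !big_set1 addrA.
Qed.

(** The powers of [h] permute the three cosets transitively, so the cycle expansion has one term, of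
    length 3. *)
Lemma transfer_value_out : transfer_value h (h ^+ 3).
Proof.
split=> //.
have trX : is_transversal [set 1] (rcosets M G :* <[h]>) G.
  apply/and3P; split; first exact: rcosets_cycle_partition.
    by rewrite sub1set group1.
  apply/forall_inP=> _ /mulsgP[_ _ /rcosetsP[z Gz ->] /set1P-> ->].
  have [i _ /rcoset_eqP->] := index3_cosets Gz.
  apply/cards1P; exists 1; apply/setIidPl; rewrite sub1set.
  by rewrite -(mulgV (h ^+ i)) mem_mulg ?rcoset_refl ?groupV ?mem_cycle.
have := sum_index_rcosets_cycle sMG Gh trX.
by rewrite (transfer_cycle_expansion sMG abM Gh trX) !big_set1 indexM invg1 conjg1 => ->.
Qed.

End Representatives.

(** Here [g] fixes each of the three cosets, so all cycles have length 1 and three conjugates of [g]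
    are multiplied. *)
Lemma transfer_value_in g h : g \in M -> h \in G -> h \notin M ->
  transfer_value g (g * g ^ h * g ^ (h * h)).
Proof.
move=> Mg Gh notMh; have Gg := subsetP sMG _ Mg; have nM := normal_norm nMG.
have MJ z : z \in G -> g ^ z \in M by move=> Gz; rewrite memJ_norm ?(subsetP nM).
have [Mgh Mghh] := (MJ _ Gh, MJ _ (groupM Gh Gh)).
have Mggh := groupM Mg Mgh; split=> //; first exact: groupM.
have Gk : h^-1 \in G by rewrite groupV.
have notMk : h^-1 \notin M by rewrite groupV.
(* Powers of [h^-1] are taken because the expansion conjugates by the inverses of the
   representatives. *)
have trX : is_transversal [set 1; h^-1; h^-1 ^+ 2] (rcosets M G :* <[g]>) G.
  suff -> : rcosets M G :* <[g]> = rcosets M G by apply: powers_transversal.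
  have E z : z \in G -> M :* z * <[g]> = M :* z.
    move=> Gz; rewrite norm_rlcoset ?(subsetP nM) // -mulgA.
    by rewrite mulGSid // cycle_subG.
  apply/setP=> B; apply/mulsgP/rcosetsP => [[_ _ /rcosetsP[z Gz ->] /set1P-> ->]|[z Gz ->]].
    by exists z; rewrite ?E.
  by exists (M :* z) <[g]>; rewrite ?set11 ?E //; apply/rcosetsP; exists z.
have pos z : 0 < #|<[g]> : M :* z| by apply: indexg_gt0.
have := sum_index_rcosets_cycle sMG Gg trX.
rewrite (transfer_cycle_expansion sMG abM Gg trX) !big_powers // indexM.
have := pos 1; have := pos h^-1; have := pos (h^-1 ^+ 2).
move: (#|<[g]> : M :* 1|) (#|<[g]> : M :* h^-1|) (#|<[g]> : M :* (h^-1 ^+ 2)|).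
move=> a b c c_gt0 b_gt0 a_gt0 sum3.
have {a_gt0 b_gt0 c_gt0 sum3} [-> -> ->] : [/\ a = 1, b = 1 & c = 1]%N.
  by have E : (a + b + c = 3)%N := sum3; split; nat_lia.
rewrite !expg1 invg1 conjg1 invgK -expgVn invgK expgS expg1.
by rewrite (fMM Mggh Mghh) (fMM Mg Mgh).
Qed.

Lemma transfer_value_in_comm g h : g \in M -> h \in G -> h \notin M ->
  transfer_value g (g ^+ 3 * [~ g, h] ^+ 3 * [~ g, h, h]).
Proof.
move=> Mg Gh notMh; have [Gg _ Eg] := transfer_value_in Mg Gh notMh.
have nMh := subsetP (normal_norm nMG) _ Gh.
have Mc k : k \in M -> [~ k, h] \in M.
  by move=> Mk; rewrite commgEl groupM ?groupV ?memJ_norm.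
have gh : g ^ h = g * [~ g, h] by rewrite commgEl mulKVg.
have ghh : g ^ (h * h) = g * [~ g, h] * ([~ g, h] * [~ g, h, h]).
  by rewrite conjgM gh conjMg gh (commgEl [~ g, h] h) !mulKVg.
rewrite gh ghh in Eg; move: (Mc _ Mg) (Mc _ (Mc _ Mg)) Eg.
move: [~ g, h] [~ g, h, h] => c d Mc1 Md Eg; split; rewrite ?groupM ?groupX // Eg.
rewrite !expgS !expg0 !mulg1 !fMM ?groupM //.
have E (V : zmodType) (u v w : V) :
  (u + (u + v) + (u + v + (v + w)) = u + (u + u) + (v + (v + v)) + w)%R by zmod_ring.
exact: E.
Qed.

Lemma transfer_value_mod g v w :
  w \in M -> w^-1 * v \in 'L_2(M) -> transfer_value g v -> transfer_value g w.
Proof.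
move=> Mw Dwv [Gg Mv Eg]; split=> //; rewrite Eg -{1}(mulKVg w v) fMM ?groupM ?groupV //.
have -> : fM (w^-1 * v)%g = 0%R.
  by rewrite /abelianised (_ : abelianisation_map M _ = coset 'L_2(M) (w^-1 * v)) //
    coset_id ?fmod1.
by rewrite addr0.
Qed.

End TransferToNormalSubgroupOfIndexThree.

Lemma index9_factor p q : p != 1%N -> q != 1%N -> (p * q = 9)%N -> p = 3.
Proof.
move=> p1 q1 E; have : p \in [:: 1; 3; 9]%N.
  by rewrite (_ : [:: _; _; _] = divisors 9) // -dvdn_divisors // -E dvdn_mulr.
rewrite !inE (negPf p1) /= => /orP[/eqP//|/eqP p9].
by move: E q1; rewrite p9 -[RHS](muln1 9) => /eqP; rewrite eqn_pmul2l // => ->.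
Qed.

(** * Subgroups between G' and G, and the possible transfer kernels *)

Section MaximalSubgroups.

Variables (gT : finGroupType) (G : {group gT}).
Hypothesis index_lcn2 : #|G : 'L_2(G)| = 9.

Local Notation Max z := <<z |: 'L_2(G)>>%G.

Lemma lcn2_sub_max z : 'L_2(G) \subset Max z.
Proof. by rewrite sub_gen ?subsetUr. Qed.

Lemma mem_max z : z \in Max z.
Proof. by rewrite mem_gen ?setU11. Qed.

Lemma max_sub z : z \in G -> Max z \subset G.
Proof. by move=> Gz; rewrite gen_subG subUset sub1set Gz lcn_sub. Qed.

Lemma normal_lcn2_sub (M : {group gT}) : 'L_2(G) \subset M -> M \subset G -> M <| G.
Proof.
move=> sAM sMG; rewrite /normal sMG -commg_subl.
by rewrite (subset_trans _ sAM) ?commSg.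
Qed.

Lemma cube_lcn2M z w : z \in G -> w \in G ->
  z ^+ 3 \in 'L_2(G) -> w ^+ 3 \in 'L_2(G) -> (z * w) ^+ 3 \in 'L_2(G).
Proof.
move=> Gz Gw Az Aw; have nA g : g \in G -> g \in 'N('L_2(G)).
  exact/subsetP/lcn_norm.
apply: coset_idr; first by rewrite nA ?groupX ?groupM.
rewrite morphX ?nA ?groupM // morphM ?nA //= expgMn.
  by rewrite -!morphX ?nA //= !coset_id // mulg1.
by apply/commgP; rewrite -morphR ?nA //= coset_id ?mem_commg.
Qed.

(** Otherwise G would be [Max z], of order at most 3 |G'| instead of 9 |G'|. *)
Lemma notin_max z w : G :=: <<[set z; w]>> -> z ^+ 3 \in 'L_2(G) -> w \notin Max z.
Proof.
move=> defG Az3; have [Gz Gw] := mem_gen2 defG; apply/negP=> Mw.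
have := card_gen_cube (subsetP (lcn_norm 2 G) _ Gz) Az3.
apply/negP; rewrite -ltnNge.
have sG : G \subset Max z.
  by rewrite {1}defG gen_subG; apply/subsetP=> v /set2P[] ->; rewrite ?mem_max.
apply: leq_trans (subset_leq_card sG).
by rewrite -(Lagrange (lcn_sub 2 G)) index_lcn2 mulnC ltn_pmul2l ?cardG_gt0.
Qed.

Lemma index_max z w : G :=: <<[set z; w]>> ->
  z ^+ 3 \in 'L_2(G) -> w ^+ 3 \in 'L_2(G) -> #|G : Max z| = 3.
Proof.
move=> defG Az3 Aw3; have [Gz Gw] := mem_gen2 defG.
have notMw := notin_max defG Az3.
have notAz : z \notin 'L_2(G).
  have defG' : G :=: <<[set w; z]>> by rewrite setUC.
  by apply: contra (notin_max defG' Aw3); apply/subsetP/lcn2_sub_max.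
have := Lagrange_index (max_sub Gz) (lcn2_sub_max z); rewrite index_lcn2.
have i1 : #|G : Max z| != 1%N.
  by rewrite indexg_eq1; apply: contra notMw => /subsetP->.
have i2 : #|Max z : 'L_2(G)| != 1%N.
  by rewrite indexg_eq1; apply: contra notAz => /subsetP->; rewrite ?mem_max.
exact: index9_factor i1 i2.
Qed.

Variables (M : {group gT}) (x y : gT).
Hypothesis defG : G :=: <<[set x; y]>>.

Lemma lcn2_sub_ker : 'L_2(G) \subset transfer_ker G M.
Proof.
pose V := transfer_morphism G (abelianisation_map_abelian M).
rewrite gen_subG; apply/subsetP=> _ /imset2P[a b Ga Gb ->].
apply/(kerP V); rewrite ?groupR // morphR //.
by apply/eqP/commgP; exact: addrC.
Qed.

Lemma transfer_ker_sub : transfer_ker G M \subset G.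
Proof. exact: subsetIl. Qed.

Lemma transfer_ker_full :
  x \in transfer_ker G M -> y \in transfer_ker G M -> transfer_ker G M = G.
Proof.
move=> Kx Ky; apply/eqP; rewrite eqEsubset transfer_ker_sub {1}defG gen_subG.
by apply/subsetP=> z /set2P[] ->.
Qed.

Lemma transfer_ker_max z : #|G : Max z| = 3 -> z \in transfer_ker G M ->
    (x \notin transfer_ker G M) || (y \notin transfer_ker G M) ->
  transfer_ker G M = Max z.
Proof.
move=> iz Kz notK.
have sMzK : Max z \subset transfer_ker G M.
  by rewrite gen_subG subUset sub1set Kz lcn2_sub_ker.
have notG : ~~ (G \subset transfer_ker G M).
  have [Gx Gy] := mem_gen2 defG.
  by apply: contraL notK => /subsetP sGK; rewrite !sGK.
apply/eqP; rewrite eq_sym eqEsubset sMzK /=.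
have := Lagrange_index transfer_ker_sub sMzK; rewrite iz.
rewrite -indexg_eq1 in notG; rewrite -indexg_eq1 => E.
apply: contraNT notG => K1; have : #|G : transfer_ker G M| \in [:: 1; 3]%N.
  by rewrite (_ : [:: _; _] = divisors 3) // -dvdn_divisors // -E dvdn_mulr.
rewrite !inE => /orP[//|/eqP G3].
by move/eqP: E K1; rewrite G3 -[X in _ == X](muln1 3) eqn_pmul2l // => ->.
Qed.

End MaximalSubgroups.

Lemma gen2_change (gT : finGroupType) (G : {group gT}) (x y z w : gT) :
    G :=: <<[set x; y]>> -> z \in G -> w \in G ->
    x \in <<[set z; w]>> -> y \in <<[set z; w]>> ->
  G :=: <<[set z; w]>>.
Proof.
move=> defG Gz Gw Hx Hy; apply/eqP; rewrite eqEsubset {1}defG !gen_subG.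
by apply/andP; split; apply/subsetP=> v /set2P[] ->.
Qed.

(** * The transfer to M_3 *)

Section CanonicalKernels.

Variables (gT : finGroupType) (G : {group gT}) (x y : gT).
Hypotheses (defG : G :=: <<[set x; y]>>) (cA : abelian 'L_2(G)).
Hypothesis defL3 : 'L_3(G) = <<[set y ^+ 3; x ^+ 3] :|: 'L_4(G)>>.
Hypotheses (nilG : nilpotent G) (index_lcn2 : #|G : 'L_2(G)| = 9).

Local Notation X := (com (cA := cA) x).
Local Notation Y := (com (cA := cA) y).
Local Notation s := (smod x y cA).
Local Notation sig := (sigmod x y cA).
Local Notation tau := (taumod x y cA).
Local Notation Max z := (generated_group (z |: 'L_2(G))).

Let Gx : x \in G. Proof. by have [] := mem_gen2 defG. Qed.
Let Gy : y \in G. Proof. by have [] := mem_gen2 defG. Qed.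
Let Ax3 : x ^+ 3 \in 'L_2(G). Proof. by have [] := cubes_lcn2 defL3. Qed.
Let Ay3 : y ^+ 3 \in 'L_2(G). Proof. by have [] := cubes_lcn2 defL3. Qed.

Lemma gen_yx : G :=: <<[set y; x]>>.
Proof. by rewrite setUC. Qed.

Lemma gen_xV z w : z \in [set x; x^-1] -> w \in [set y; y^-1] -> G :=: <<[set z; w]>>.
Proof.
move=> Hz Hw; have gz (u v : gT) : v \in [set u; u^-1] -> u \in <[v]>.
  by case/set2P=> ->; rewrite ?cycleV cycle_id.
have sz (u v : gT) : u \in [set z; w] -> v \in <[u]> -> v \in <<[set z; w]>>.
  by move=> Hu; apply/subsetP; rewrite cycle_subG mem_gen.
have Gz : z \in G by case/set2P: Hz => ->; rewrite ?groupV.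
have Gw : w \in G by case/set2P: Hw => ->; rewrite ?groupV.
apply: (gen2_change defG Gz Gw).
  exact: (sz z x (set21 _ _) (gz _ _ Hz)).
exact: (sz w y (set22 _ _) (gz _ _ Hw)).
Qed.

Lemma gen_xy_x : G :=: <<[set x * y; x]>>.
Proof.
have Hxy : x * y \in <<[set x * y; x]>> by rewrite mem_gen ?set21.
have Hx : x \in <<[set x * y; x]>> by rewrite mem_gen ?set22.
apply: (gen2_change defG (groupM Gx Gy) Gx Hx).
by have := groupM (groupVr Hx) Hxy; rewrite mulKg.
Qed.

Lemma gen_xy_y : G :=: <<[set x * y; y]>>.
Proof.
have Hxy : x * y \in <<[set x * y; y]>> by rewrite mem_gen ?set21.
have Hy : y \in <<[set x * y; y]>> by rewrite mem_gen ?set22.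
apply: (gen2_change defG (groupM Gx Gy) Gy _ Hy).
by have := groupM Hxy (groupVr Hy); rewrite mulgK.
Qed.

Lemma index_max_x : #|G : Max x| = 3.
Proof. exact: (index_max index_lcn2 defG Ax3 Ay3). Qed.

Lemma index_max_y : #|G : Max y| = 3.
Proof. exact: (index_max index_lcn2 gen_yx Ay3 Ax3). Qed.

Lemma index_max_xy : #|G : Max (x * y)| = 3.
Proof. exact: (index_max index_lcn2 gen_xy_x (cube_lcn2M Gx Gy Ax3 Ay3) Ax3). Qed.

Lemma fmval_sig3 : fmval (sig 3) = y ^+ 3.
Proof. by rewrite /sigmod (fmodK cA). Qed.

Lemma fmval_tau3 : fmval (tau 3) = x ^+ 3.
Proof. by rewrite /taumod (fmodK cA). Qed.

Section OutsideXY.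

Hypotheses (Xs_sig : fmval (X s + sig 3)%R \in 'L_4(G)).
Hypotheses (Ys_tau : fmval (- Y s + tau 3)%R \in 'L_4(G)).
Hypothesis big_L3 : 3 < #|'L_3(G) / 'L_4(G)|.

Hypothesis index_xyV : #|G : Max (x * y^-1)| = 3.

(** Modulo gamma_4(G), which lies in M_3', the commutator of [s] with [x * y] is tau_3 - sigma_3 by
    the two congruences, and this is the transfer of [x * y^-1]. The congruences are kept separate
    from the relations so that the lemma also applies to [x], [y^-1]. *)
Lemma transfer_ker_xy : transfer_ker G (Max (x * y)) = Max (x * y^-1).
Proof.
pose D := lower_central_at_group 2 (Max (x * y)); have Gxy : x * y \in G by rewrite groupM.
have nM : Max (x * y) <| G by rewrite (normal_lcn2_sub (lcn2_sub_max _ _)) ?max_sub.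
have notMx : x \notin Max (x * y).
  exact: (notin_max index_lcn2 gen_xy_x (cube_lcn2M Gx Gy Ax3 Ay3)).
have notMy : y \notin Max (x * y).
  exact: (notin_max index_lcn2 gen_xy_y (cube_lcn2M Gx Gy Ax3 Ay3)).
have Vx := transfer_value_out nM index_max_xy Gx notMx.
have Vy := transfer_value_out nM index_max_xy Gy notMy.
have VxyV := transfer_valueM Vx (transfer_valueV Vy).
have Dsig j : 3 <= j -> fmval (com (x * y) (sig j)) = fmval (sig j.+1).
  by move=> le3j; rewrite comM // com_y_sigmod // (comC _ Gy Gx) com_y_sigmod //
    raddf0 !addr0 sigmodS.
have Dtau j : 3 <= j -> fmval (com (x * y) (tau j)) = fmval (tau j.+1).
  by move=> le3j; rewrite comM // com_x_taumod // raddf0 add0r addr0 taumodS.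
(* [com (x * y)] shifts both sequences by one index, so every sigma_j and tau_j with j >= 4 is a
   commutator in M_3'. *)
have sL4D : 'L_4(G) \subset D.
  apply: (lcn_sub_gen defG defL3) => // [] [//|j] lej; rewrite -?Dsig -?Dtau //.
    by apply/(der_maxP cA Gxy); exists (sig j).
  by apply/(der_maxP cA Gxy); exists (tau j).
have YXs : fmval (Y (X s)) \in 'L_4(G).
  by apply: (com_lcn Gy); apply: (com_lcn Gx); apply: smod_lcn.
have DcE : (com (x * y) s = (X s + sig 3) - (- Y s + tau 3) + Y (X s) + (tau 3 - sig 3))%R.
  by rewrite comM //; zmod_ring.
have Dst : fmval (tau 3 - sig 3)%R \in D.
  have -> : (tau 3 - sig 3 = com (x * y) s - ((X s + sig 3) - (- Y s + tau 3) + Y (X s)))%R.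
    by rewrite DcE; zmod_ring.
  apply: fmvalD_in; first by apply/(der_maxP cA Gxy); exists s.
  apply/fmvalN_in/(subsetP sL4D); apply: fmvalD_in => //.
  by apply: fmvalD_in => //; apply: fmvalN_in.
apply: (transfer_ker_max defG index_xyV).
  by rewrite (transfer_value_ker VxyV) -fmval_sig3 -fmval_tau3 -fmvalN -fmvalA.
apply/orP; left; rewrite (transfer_value_ker Vx) -fmval_tau3.
(* With tau_3 also sigma_3 lies in M_3', hence all of gamma_3(G). But M_3' is contained in the group
   generated by [u] below and gamma_4(G), so gamma_3 / gamma_4 would have order at most 3. *)
apply/negP=> Dtau3; move: big_L3; apply/negP; rewrite -leqNgt.
pose u := com (x * y) s.
have Lu : fmval u \in 'L_3(G) by apply: com_lcn => //; apply: smod_lcn.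
have Lu3 : fmval (u *+ 3)%R \in 'L_4(G).
  by rewrite -raddfMn; apply: com_lcn => //; apply: (smod_cube_lcn defG).
apply: (card_lcn_quotient_gen1 _ Lu3); apply/eqP.
rewrite eqEsubset [X in _ && X]gen_subG subUset sub1set Lu lcn_subS !andbT.
have sDu : D \subset <<fmval u |: 'L_4(G)>>.
  apply: (der_max_sub defG defL3 Gxy (D := <<fmval u |: 'L_4(G)>>%G)) => //.
  - by rewrite mem_gen ?setU11.
  - move=> j le3j; rewrite mem_gen // Dsig // inE; apply/orP; right.
    apply: (subsetP (lcn_sub_leq G (_ : 4 <= j.+1))) => //.
    exact: (sigmod_lcn defG cA defL3 (leqW le3j)).
  move=> j le3j; rewrite mem_gen // Dtau // inE; apply/orP; right.
  apply: (subsetP (lcn_sub_leq G (_ : 4 <= j.+1))) => //.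
  exact: (taumod_lcn defG cA defL3 (leqW le3j)).
apply: subset_trans sDu; rewrite [X in pred_of_set X]defL3 gen_subG subUset sL4D andbT.
apply/subsetP=> z /set2P[] ->; last by rewrite -fmval_tau3.
rewrite -fmval_sig3 (_ : sig 3 = tau 3 - (tau 3 - sig 3))%R; last by zmod_ring.
by apply: fmvalD_in => //; apply: fmvalN_in.
Qed.

End OutsideXY.

End CanonicalKernels.

Section ChangeOfSign.

Variables (gT : finGroupType) (G : {group gT}) (x y : gT).

Lemma lcn3_gen_signs z w :
    z \in [set x; x^-1] -> w \in [set y; y^-1] ->
    'L_3(G) = <<[set y ^+ 3; x ^+ 3] :|: 'L_4(G)>> ->
  'L_3(G) = <<[set w ^+ 3; z ^+ 3] :|: 'L_4(G)>>.
Proof.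
move=> Hz Hw defL3.
have inv3 (g h : gT) (H : {group gT}) :
    h \in [set g; g^-1] -> (h ^+ 3 \in H) = (g ^+ 3 \in H).
  by case/set2P=> ->; rewrite ?expgVn ?groupV.
have sL4 (A : {set gT}) : 'L_4(G) \subset <<A :|: 'L_4(G)>>.
  by rewrite sub_gen ?subsetUr.
apply/eqP; rewrite eqEsubset {1}defL3 [X in X && _]gen_subG [X in _ && X]gen_subG.
rewrite !subUset !sub1set lcn_subS sL4 (inv3 _ _ _ Hw) (inv3 _ _ _ Hz) !andbT.
rewrite -(inv3 _ _ [group of <<_>>] Hw) -(inv3 _ _ [group of <<_>>] Hz).
have [-> ->] := cubes_lcn3 defL3.
by rewrite !mem_gen // !inE eqxx ?orbT.
Qed.

End ChangeOfSign.

(** * The kernel determined by the coefficients of the transfers of x and y *)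

Section KernelFromCoefficients.

Variables (gT : finGroupType) (G : {group gT}) (x y : gT).
Hypotheses (defG : G :=: <<[set x; y]>>) (cA : abelian 'L_2(G)).
Hypothesis defL3 : 'L_3(G) = <<[set y ^+ 3; x ^+ 3] :|: 'L_4(G)>>.

Hypotheses (nilG : nilpotent G) (index_lcn2 : #|G : 'L_2(G)| = 9).

Local Notation F := (fmod_of cA).

Lemma index_max_xyV : #|G : generated_group (x * y^-1 |: 'L_2(G))| = 3.
Proof.
have defG' := gen_xV defG (set21 x _) (set22 y _).
exact: (index_max_xy defG' (lcn3_gen_signs (set21 x _) (set22 y _) defL3)).
Qed.

(** Numbered like the entries of a multiplet: 0 stands for the total kernel, [k > 0] for M_k. *)
Definition kernel_group (k : nat) : {group gT} :=
  nth G (G :: [seq [group of <<g |: 'L_2(G)>>] | g <- [:: y; x; x * y; x * y^-1]]) k.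

(* The kernel { x^i y^j | a i + c j = 0 mod 3 }, for a and c in {-1, 0, 1}. *)
Definition kernel_index (a c : int) : nat :=
  if a == 0%R then if c == 0%R then 0 else 2
  else if c == 0%R then 1%N else if a == c then 4 else 3.

Lemma transfer_ker_coef (M : {group gT}) (u : F) (a c : int) :
    small_exponent a -> small_exponent c -> fmval u \notin 'L_2(M) ->
    transfer_value G M x (fmval (u *~ a)%R) ->
    transfer_value G M y (fmval (u *~ c)%R) ->
  transfer_ker G M = kernel_group (kernel_index a c).
Proof.
move=> sa sc notDu Vx Vy.
have ker0 g : transfer_value G M g (fmval (0 : F)%R) -> g \in transfer_ker G M.
  by move=> Vg; rewrite (transfer_value_ker Vg) fmval0_in.
have notK g z : small_exponent z -> z != 0%R ->
    transfer_value G M g (fmval (u *~ z)%R) -> g \notin transfer_ker G M.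
  move=> sz z0 Vg; rewrite (transfer_value_ker Vg); apply/negP.
  by case/(fmvalMz_small sz) => [E|]; [rewrite E in z0 | apply/negP].
have maxK z := @transfer_ker_max _ G M x y defG z.
have sumz (b d : int) : transfer_value G M x (fmval (u *~ b)%R) ->
    transfer_value G M y (fmval (u *~ d)%R) ->
    transfer_value G M (x * y) (fmval (u *~ (b + d))%R).
  by move=> V1 V2; rewrite mulrzDr fmvalA; apply: transfer_valueM.
have difz (b d : int) : transfer_value G M x (fmval (u *~ b)%R) ->
    transfer_value G M y (fmval (u *~ d)%R) ->
    transfer_value G M (x * y^-1) (fmval (u *~ (b - d))%R).
  move=> V1 V2; rewrite mulrzDr mulrNz fmvalA fmvalN.
  exact: (transfer_valueM V1 (transfer_valueV V2)).
rewrite /kernel_index /kernel_group.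
have [a0|a0] := eqVneq a 0%R; have [c0|c0] := eqVneq c 0%R.
- rewrite a0 mulr0z in Vx; rewrite c0 mulr0z in Vy.
  by apply: (transfer_ker_full defG); apply: ker0.
- rewrite a0 mulr0z in Vx; apply: maxK; first exact: (index_max_x defG defL3).
    exact: ker0.
  by rewrite (notK y c) ?orbT.
- rewrite c0 mulr0z in Vy; apply: maxK; first exact: (index_max_y defG defL3).
    exact: ker0.
  by rewrite (notK x a).
have [eac|nac] := eqVneq a c.
- apply: maxK; [exact: index_max_xyV | | by rewrite (notK x a)].
  by apply: ker0; have := difz _ _ Vx Vy; rewrite eac subrr mulr0z.
apply: maxK; [exact: (index_max_xy defG defL3) | | by rewrite (notK x a)].
apply: ker0; have := sumz _ _ Vx Vy.
have -> : (a + c = 0)%R; last by rewrite mulr0z.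
move: a0 c0 nac; case/small_exponentP: sa => ->; case/small_exponentP: sc => -> //.
Qed.

End KernelFromCoefficients.

Ltac fmval_in :=
  repeat first [ assumption | apply: fmvalD_in | apply: fmvalN_in
               | apply: fmvalMz_in | apply: fmval0_in ].

(** * The four transfer kernels *)

Section KernelsFromRelations.

Variables (gT : finGroupType) (G : {group gT}) (x y : gT).
Hypotheses (defG : G :=: <<[set x; y]>>) (cA : abelian 'L_2(G)).
Hypothesis defL3 : 'L_3(G) = <<[set y ^+ 3; x ^+ 3] :|: 'L_4(G)>>.

Local Notation F := (fmod_of cA).
Local Notation X := (com (cA := cA) x).
Local Notation Y := (com (cA := cA) y).
Local Notation s := (smod x y cA).
Local Notation sig := (sigmod x y cA).
Local Notation tau := (taumod x y cA).
Local Notation Max z := (generated_group (z |: 'L_2(G))).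

Let Gx : x \in G. Proof. by have [] := mem_gen2 defG. Qed.
Let Gy : y \in G. Proof. by have [] := mem_gen2 defG. Qed.
Let Ax3 : x ^+ 3 \in 'L_2(G). Proof. by have [] := cubes_lcn2 defL3. Qed.
Let Ay3 : y ^+ 3 \in 'L_2(G). Proof. by have [] := cubes_lcn2 defL3. Qed.

Variables (m e : nat) (alpha beta gamma delta rho : int).
Hypotheses (Lm1 : 'L_m(G) = 1) (le4e : 4 <= e) (lt_em : e < m).
Hypotheses (halpha : small_exponent alpha) (hbeta : small_exponent beta).
Hypotheses (hgamma : small_exponent gamma) (hdelta : small_exponent delta).
Hypothesis hrho : small_exponent rho.
Hypothesis rel : mod_relations x y cA m e alpha beta gamma delta rho.
Hypothesis rho_em : rho != 0%R -> e.+1 < m.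
Hypothesis cardG : #|G| = (3 ^ (m + e - 2))%N.
Hypothesis index_lcn2 : #|G : 'L_2(G)| = 9.

Let nilG : nilpotent G.
Proof.
by apply/lcnP; exists m; apply/trivgP; rewrite -Lm1 lcn_subS.
Qed.

Let small_mul z w : small_exponent z -> small_exponent w -> small_exponent (z * w)%R.
Proof. by case/small_exponentP=> ->; case/small_exponentP=> ->. Qed.

Let notM1x : x \notin Max y.
Proof. exact: (notin_max index_lcn2 (gen_yx defG) Ay3). Qed.

Let notM2y : y \notin Max x.
Proof. exact: (notin_max index_lcn2 defG Ax3). Qed.

Let nM1 : Max y <| G.
Proof. by rewrite (normal_lcn2_sub (lcn2_sub_max _ _)) ?max_sub. Qed.

Let nM2 : Max x <| G.
Proof. by rewrite (normal_lcn2_sub (lcn2_sub_max _ _)) ?max_sub. Qed.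

Let sL2M (M : {group gT}) (u : F) : 'L_2(G) \subset M -> fmval u \in M.
Proof. by move/subsetP; apply; apply: fmodP. Qed.

Lemma transfer_value_fmval (M : {group gT}) g (v w : F) : 'L_2(G) \subset M ->
    fmval (v - w)%R \in 'L_2(M) -> transfer_value G M g (fmval v) ->
  transfer_value G M g (fmval w).
Proof.
move=> sAM Dvw; apply: transfer_value_mod; first exact: sL2M.
by rewrite -fmvalN -fmvalA addrC.
Qed.

(** If rho <> 0, the last relation moves sigma_(m-1) into M_1'. The leading terms of the transfers
    are then those in sigma_(m-2), with coefficients [rho * delta] for [x] and [rho * beta] for
    [y]. *)
Lemma transfer_ker_M1 :
  transfer_ker G (Max y)
    = kernel_group G x y (if rho == 0%R then kernel_index alpha gamma
                          else kernel_index (rho * delta) (rho * beta)).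
Proof.
have [R1 R2 R3 R4] := rel.
have iM := index_max_y defG defL3 index_lcn2.
pose a := if rho == 0%R then alpha else (rho * delta)%R.
pose c := if rho == 0%R then gamma else (rho * beta)%R.
have -> : (if rho == 0%R then kernel_index alpha gamma
    else kernel_index (rho * delta) (rho * beta)) = kernel_index a c.
  by rewrite /a /c; case: eqP.
have sa : small_exponent a by rewrite /a; case: eqP => // _; apply: small_mul.
have sc : small_exponent c by rewrite /c; case: eqP => // _; apply: small_mul.
have notD := sig_last_notin_M1 defG defL3 Lm1 le4e lt_em hrho rel rho_em cardG.
set k := (_ - _) in notD; set D := lower_central_at_group 2 (Max y).
have DYs : fmval (Y s) \in D := com_in_der_max s Gy.
have Dt4 : fmval (tau 4) \in D by rewrite -taumodS // com_in_der_max.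
have Dte : fmval (tau e) \in D.
  by case: (e) le4e => // j le3j; rewrite -taumodS // com_in_der_max.
have Dlast : rho != 0%R -> fmval (sig m.-1) \in D.
  move=> rho0; have: fmval (tau e.+1) \in D.
    by rewrite -taumodS ?com_in_der_max //; nat_lia.
  rewrite R4 fmvalN groupV => /(fmvalMz_small hrho)[E|//].
  by rewrite E eqxx in rho0.
apply: (transfer_ker_coef defG defL3 index_lcn2 sa sc notD).
  apply: (transfer_value_fmval (v := tau 3) (lcn2_sub_max _ _)); last first.
    by rewrite fmval_tau3 //; apply: (transfer_value_out nM1 iM Gx notM1x).
  have -> : (tau 3 - sig k *~ a
             = (- Y s + tau 3 + tau 4) - sig k *~ a + Y s - tau 4)%R by zmod_ring.
  rewrite R3 /a /k; have [rho0|rho0] := eqVneq rho 0%R.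
    have -> : (sig m.-2 *~ (rho * delta) + sig m.-1 *~ alpha + tau e *~ beta
        - sig (m.-1 - false) *~ alpha + Y s - tau 4 = tau e *~ beta + Y s - tau 4)%R.
      by rewrite rho0 mul0r subn0; zmod_ring.
    by fmval_in.
  have Dm := Dlast rho0.
  have -> : (sig m.-2 *~ (rho * delta) + sig m.-1 *~ alpha + tau e *~ beta
      - sig (m.-1 - true) *~ (rho * delta) + Y s - tau 4
    = sig m.-1 *~ alpha + tau e *~ beta + Y s - tau 4)%R by rewrite subn1; zmod_ring.
  by fmval_in.
(* The transfer of [y], which lies in M_1, is y^3 [y,x]^3 [y,x,x]. Replacing [s *+ 3] by the first
   relation makes it the left-hand side of the second one, up to elements in M_1' and a multiple of
   sigma_(m-1) carrying the factor rho. *)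
apply: (transfer_value_fmval (v := (sig 3 + s *+ 3 + X s)%R) (lcn2_sub_max _ _)); last first.
  have := transfer_value_in_comm nM1 iM (mem_max _ _) Gx notM1x.
  rewrite -(fmval_smod cA) // -(fmval_sig3 cA defL3) -fmval_com // -!fmvalZ -!fmvalA.
have -> : (sig 3 + smod x y cA *+ 3 + X s - sig k *~ c
    = ((X s + sig 3 + sig 4) - sig k *~ c) + (s *+ 3 - sig 4))%R by zmod_ring.
rewrite R2 R1 /c /k; have [rho0|rho0] := eqVneq rho 0%R.
  have -> : (sig m.-2 *~ (rho * beta) + sig m.-1 *~ gamma + tau e *~ delta
      - sig (m.-1 - false) *~ gamma + (sig 4 - sig m.-1 *~ (rho * beta) - tau 4 - sig 4)
    = tau e *~ delta - tau 4)%R by rewrite rho0 mul0r subn0; zmod_ring.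
  by fmval_in.
have Dm := Dlast rho0.
have -> : (sig m.-2 *~ (rho * beta) + sig m.-1 *~ gamma + tau e *~ delta
    - sig (m.-1 - true) *~ (rho * beta)
    + (sig 4 - sig m.-1 *~ (rho * beta) - tau 4 - sig 4)
  = sig m.-1 *~ gamma + tau e *~ delta - sig m.-1 *~ (rho * beta) - tau 4)%R.
  by rewrite subn1; zmod_ring.
by fmval_in.
Qed.

(** All sigma_j with j >= 4 lie in M_2', including sigma_(m-2) whenever rho <> 0. Hence only the
    tau_e terms of the relations survive, whatever rho is. *)
Lemma transfer_ker_M2 :
  transfer_ker G (Max x) = kernel_group G x y (kernel_index beta delta).
Proof.
have [R1 R2 R3 R4] := rel.
have iM := index_max_x defG defL3 index_lcn2.
have notD := tau_e_notin_M2 defG defL3 Lm1 le4e lt_em rel rho_em cardG.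
set D := lower_central_at_group 2 (Max x).
have DXs : fmval (X s) \in D := com_in_der_max s Gx.
have Dsig j : 4 <= j -> fmval (sig j) \in D.
  by case: j => // j le3j; rewrite -sigmodS // com_in_der_max.
have Ds4 := Dsig 4 isT; have Dlast : fmval (sig m.-1) \in D by apply: Dsig; nat_lia.
have Dlast2 z : fmval (sig m.-2 *~ (rho * z))%R \in D.
  have [->|/rho_em lt_e1m] := eqVneq rho 0%R; first by rewrite mul0r fmval0_in.
  by apply: fmvalMz_in; apply: Dsig; nat_lia.
apply: (transfer_ker_coef defG defL3 index_lcn2 hbeta hdelta notD).
  apply: (transfer_value_fmval (v := (tau 3 + (- s) *+ 3 + Y (- s))%R) (lcn2_sub_max _ _));
    last first.
    have := transfer_value_in_comm nM2 iM (mem_max _ _) Gy notM2y.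
    rewrite -(invg_comm y x) -(fmval_smod cA) // -fmvalN -(fmval_tau3 cA defL3).
    by rewrite -fmval_com // -!fmvalZ -!fmvalA.
  have -> : (tau 3 + (- s) *+ 3 + Y (- s) - tau e *~ beta
    = ((- Y s + tau 3 + tau 4) - tau e *~ beta) - s *+ 3 - tau 4)%R by zmod_ring.
  rewrite R3 R1 addrK.
  have -> : (sig m.-2 *~ (rho * delta) + sig m.-1 *~ alpha
             - (sig 4 - sig m.-1 *~ (rho * beta) - tau 4) - tau 4
    = sig m.-2 *~ (rho * delta) + sig m.-1 *~ alpha
      - sig 4 + sig m.-1 *~ (rho * beta))%R by zmod_ring.
  have D1 := Dlast2 delta; by fmval_in.
apply: (transfer_value_fmval (v := sig 3) (lcn2_sub_max _ _)); last first.
  by rewrite fmval_sig3 //; apply: (transfer_value_out nM2 iM Gy notM2y).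
have -> : (sig 3 - tau e *~ delta
    = ((X s + sig 3 + sig 4) - tau e *~ delta) - X s - sig 4)%R by zmod_ring.
by rewrite R2 addrK; have D1 := Dlast2 beta; fmval_in.
Qed.

Hypothesis big_L3 : 3 < #|'L_3(G) / 'L_4(G)|.

Let lcn4_sigtau (z w v : int) :
  fmval (sig m.-2 *~ (rho * z) + sig m.-1 *~ w + tau e *~ v)%R \in 'L_4(G).
Proof.
have L4 i : 4 <= i -> fmval (sig i) \in 'L_4(G) /\ fmval (tau i) \in 'L_4(G).
  move=> le4i; split; apply: (subsetP (lcn_sub_leq G le4i)).
    by apply: (sigmod_lcn defG cA defL3); nat_lia.
  by apply: (taumod_lcn defG cA defL3); nat_lia.
have [_ Lte] := L4 e le4e.
have le4m1 : 4 <= m.-1 by nat_lia.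
have [Lm _] := L4 _ le4m1.
have [->|/rho_em lt_e1m] := eqVneq rho 0%R; first by rewrite mul0r mulr0z add0r; fmval_in.
have le4m2 : 4 <= m.-2 by nat_lia.
have [Lm2 _] := L4 _ le4m2.
by fmval_in.
Qed.

Let Xs_sig : fmval (X s + sig 3)%R \in 'L_4(G).
Proof.
have [_ R2 _ _] := rel.
have -> : (X s + sig 3 = (X s + sig 3 + sig 4) - sig 4)%R by zmod_ring.
rewrite R2; apply: fmvalD_in; first exact: lcn4_sigtau.
by apply/fmvalN_in/(sigmod_lcn defG cA defL3).
Qed.

Let Ys_tau : fmval (- Y s + tau 3)%R \in 'L_4(G).
Proof.
have [_ _ R3 _] := rel.
have -> : (- Y s + tau 3 = (- Y s + tau 3 + tau 4) - tau 4)%R by zmod_ring.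
rewrite R3; apply: fmvalD_in; first exact: lcn4_sigtau.
by apply/fmvalN_in/(taumod_lcn defG cA defL3).
Qed.

Lemma transfer_ker_M3 : transfer_ker G (Max (x * y)) = kernel_group G x y 4.
Proof.
apply: (transfer_ker_xy defG defL3) => //; exact: (index_max_xyV defG defL3).
Qed.

(** M_4 is the third maximal subgroup for the generators [x], [y^-1]. Passing to them changes [s]
    into [- s] and sigma_3 into [- sig 3] up to terms that disappear in the congruences modulo
    gamma_4(G). *)
Lemma transfer_ker_M4 : transfer_ker G (Max (x * y^-1)) = kernel_group G x y 3.
Proof.
have defG' := gen_xV defG (set21 x _) (set22 y _).
have defL3' := lcn3_gen_signs (set21 x _) (set22 y _) defL3.
have GyV : y^-1 \in G by rewrite groupV.
pose Z := com (cA := cA) y^-1.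
have Es : smod x y^-1 cA = (- (s + Z s))%R by rewrite [LHS]smod_invy // actE addrC.
have Esig : sigmod x y^-1 cA 3 = (- sig 3)%R.
  by rewrite /sigmod /= expgVn fmodV.
have L3c u : u \in G -> fmval (com u s) \in 'L_3(G).
  by move=> Gu; apply: com_lcn Gu _; apply: smod_lcn.
have L4c u v : u \in G -> v \in G -> fmval (com u (com v s)) \in 'L_4(G).
  by move=> Gu Gv; apply: com_lcn Gu _; apply: L3c.
have L1 := L4c _ _ Gx GyV; have L2 := L4c _ _ GyV Gy; have L3 := L4c _ _ GyV GyV.
have EZs : (Z s = - (Y s + Z (Y s)))%R by rewrite /Z comV // actE addrC.
rewrite (transfer_ker_xy defG' defL3' (cA := cA)) ?invgK //.
- rewrite Es Esig.
  have -> : (X (- (s + Z s)) - sig 3 = - (X s + sig 3) - X (Z s))%R by zmod_ring.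
  by fmval_in.
- rewrite Es /taumod /= -/(tau 3).
  have -> : (- Z (- (s + Z s)) + tau 3 = (- Y s + tau 3) - Z (Y s) + Z (Z s))%R.
    have -> : (- Z (- (s + Z s)) = Z s + Z (Z s))%R by zmod_ring.
    by rewrite {1}EZs; zmod_ring.
  by fmval_in.
exact: (index_max_xy defG defL3).
Qed.

End KernelsFromRelations.

(** * Transfer types *)

Section TransferTypes.

Variables (gT : finGroupType) (G : {group gT}).

(** The permutation is absorbed into the numbering of the maximal subgroups. *)
Lemma has_transfer_type_reindex (kappa0 : {ffun 'I_4 -> 'I_5}) :
    has_transfer_type G kappa0 ->
  exists M : 'I_4 -> {group gT},
    [/\ injective M, forall i, maxnormal (M i) G G & is_multiplet G M kappa0].
Proof.
case=> M [kappa [pi [injM maxM multM Ekappa]]].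
exists (M \o (pi^-1)%g); split=> [|i|i]; first exact: inj_comp injM perm_inj.
  exact: maxM.
rewrite /= multM Ekappa ffunE permKV.
suff -> : oapp M G (unlift ord0 ((lift_perm ord0 ord0 pi)^-1 (kappa0 i)))
  = oapp (M \o (pi^-1)%g) G (unlift ord0 (kappa0 i)) by [].
case: (unliftP ord0 (kappa0 i)) => [j ->|->].
  by rewrite lift_permV lift_perm_lift !liftK.
by rewrite lift_permV lift_perm_id !unlift_none.
Qed.

Lemma quotient_lcn2_inj (K N : {group gT}) :
    'L_2(G) \subset K -> K \subset G -> 'L_2(G) \subset N -> N \subset G ->
  K / 'L_2(G) = N / 'L_2(G) -> K :=: N.
Proof.
have nA (H : {group gT}) : 'L_2(G) \subset H -> H \subset G -> 'L_2(G) <| H.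
  by move=> sAH sHG; rewrite /normal sAH (subset_trans sHG) ?lcn_norm.
move=> sAK sKG sAN sNG E.
by rewrite -(quotientGK (nA K sAK sKG)) -(quotientGK (nA N sAN sNG)) E.
Qed.

Variables x y : gT.
Hypotheses (defG : G :=: <<[set x; y]>>).
Hypothesis defL3 : 'L_3(G) = <<[set y ^+ 3; x ^+ 3] :|: 'L_4(G)>>.
Hypotheses (pG : 3.-group G) (index_lcn2 : #|G : 'L_2(G)| = 9).

Local Notation C := (canonical_maximal G x y).

Let Gx : x \in G. Proof. by have [] := mem_gen2 defG. Qed.
Let Gy : y \in G. Proof. by have [] := mem_gen2 defG. Qed.

Lemma index_canonical i : #|G : C i| = 3.
Proof.
case: i => [[|[|[|[|//]]]] ?] /=.
- exact: (index_max_y defG defL3).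
- exact: (index_max_x defG defL3).
- exact: (index_max_xy defG defL3).
exact: (index_max_xyV defG defL3).
Qed.

Lemma canonical_sub i : 'L_2(G) \subset C i /\ C i \subset G.
Proof.
by case: i => [[|[|[|[|//]]]] ?] /=;
  rewrite lcn2_sub_max max_sub ?groupM ?groupV.
Qed.

Lemma maxnormal_index3 (M : {group gT}) :
  maxnormal M G G -> [/\ 'L_2(G) \subset M, M <| G & #|G : M| = 3].
Proof.
move=> maxM; have nMG : M <| G := maxnormal_normal maxM.
have simGM : simple (G / M) by rewrite quotient_simple.
have solGM : solvable (G / M) by apply/quotient_sol/nilpotent_sol/(pgroup_nil pG).
have prGM := simple_sol_prime solGM simGM.
split=> //.
  by apply: der1_min; [apply: normal_norm | apply/cyclic_abelian/prime_cyclic].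
rewrite -card_quotient ?normal_norm //.
have /pgroupP/(_ _ prGM (dvdnn _)) := quotient_pgroup M pG.
by rewrite inE => /eqP.
Qed.

Lemma index3_canonical (M : {group gT}) :
  'L_2(G) \subset M -> M <| G -> #|G : M| = 3 -> exists i, M = C i.
Proof.
move=> sAM nMG iM; have sMG := normal_sub nMG.
have eqM i z : z \in M -> C i = generated_group (z |: 'L_2(G)) -> exists i, M = C i.
  move=> Mz Ei; exists i; apply/val_inj/eqP; rewrite /= eq_sym eqEcard Ei.
  rewrite gen_subG subUset sub1set Mz sAM /=.
  rewrite -(leq_pmul2r (m := 3)) // -{1}iM -{1}(index_canonical i) Ei.
  by rewrite !Lagrange // -Ei; case: (canonical_sub i).
have [Mx|notMx] := boolP (x \in M); first by
  apply: (eqM (inord 1) x Mx); rewrite /canonical_maximal inordK.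
have [My|notMy] := boolP (y \in M); first by
  apply: (eqM (inord 0) y My); rewrite /canonical_maximal inordK.
have [[|[|[|//]]] _] := index3_cosets nMG iM Gx notMx Gy; rewrite mem_rcoset.
- by rewrite expg0 invg1 mulg1 (negPf notMy).
- move=> My; apply: (eqM (inord 3) (x * y^-1)); last by rewrite /canonical_maximal inordK.
  by rewrite -groupV invMg invgK.
have Mx3 : x ^+ 3 \in M.
  by apply: (subsetP sAM); have [] := cubes_lcn2 defL3.
move=> My; apply: (eqM (inord 2) (x * y)); last by rewrite /canonical_maximal inordK.
have: (y * (x ^+ 2)^-1 * x ^+ 3) ^ x^-1 \in M.
  by rewrite memJ_norm ?(groupM My Mx3) // groupV (subsetP (normal_norm nMG)).
have -> : y * (x ^+ 2)^-1 * x ^+ 3 = y * x by rewrite -mulgA [x ^+ 3]expgSr mulKg.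
by rewrite conjgE invgK mulgK.
Qed.

Lemma maxnormal_canonical (M : {group gT}) : maxnormal M G G -> exists i, M = C i.
Proof. by case/maxnormal_index3; apply: index3_canonical. Qed.

Definition type_codes (t : section_d) : seq nat :=
  match t with
  | d19 => [:: 2; 1; 1; 0]%N
  | d23 => [:: 1; 3; 2; 0]%N
  | d25 => [:: 0; 3; 2; 1]%N
  end.

(* The pairs (kappa(1), kappa(2)) compatible with kappa(3) = 4, kappa(4) = 3. *)
Definition kernel_pair (t : section_d) (k1 k2 : nat) : bool :=
  match t with
  | d19 => ((k1 == 0) && (k2 \in [:: 3; 4])) || ((k2 == 0) && (k1 \in [:: 3; 4]))
  | d23 => ((k1 == 0) && (k2 == 2)) || ((k1 == 1%N) && (k2 == 0))
  | d25 => ((k1 == 0) && (k2 == 1%N)) || ((k1 == 2) && (k2 == 0))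
  end.

(** The list [f] is a permutation of 0, ..., 3 with kappa o f = f_0 o cs, where f_0 fixes 0 and acts
    on positive values shifted by one. Lists of naturals, unlike finite functions on ordinals,
    compute well. *)
Definition relabels (k1 k2 : nat) (cs f : seq nat) : bool :=
  uniq f && all (fun i => nth 0 [:: k1; k2; 4; 3] (nth 0 f i) ==
    (if nth 0 cs i is j.+1 then (nth 0 f j).+1 else 0)) (iota 0 4).

(** An exhaustive check over 25 pairs and 256 lists for each type. *)
Lemma kernel_pair_by_relabelling t (k1 k2 a b c d : nat) :
    k1 < 5 -> k2 < 5 -> a < 4 -> b < 4 -> c < 4 -> d < 4 ->
  relabels k1 k2 (type_codes t) [:: a; b; c; d] -> kernel_pair t k1 k2.
Proof.
have in_iota i j : i < j -> i \in iota 0 j by rewrite mem_iota.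
have: all (fun k1 => all (fun k2 => all (fun a => all (fun b => all (fun c => all (fun d =>
    relabels k1 k2 (type_codes t) [:: a; b; c; d] ==> kernel_pair t k1 k2)
  (iota 0 4)) (iota 0 4)) (iota 0 4)) (iota 0 4)) (iota 0 5)) (iota 0 5).
  by case: t; vm_compute.
move=> /allP H /in_iota/H/allP{}H /in_iota/H/allP{}H /in_iota/H/allP{}H.
by move=> /in_iota/H/allP{}H /in_iota/H/allP{}H /in_iota/H/implyP.
Qed.

Lemma type_d_codes t : type_d t = [ffun i : 'I_4 => inord (nth 0 (type_codes t) i)].
Proof. by case: t. Qed.

Lemma oapp_unlift_inord (M : 'I_4 -> {group gT}) k : k < 5 ->
  oapp M G (unlift ord0 (inord k : 'I_5)) = if k is j.+1 then M (inord j) else G.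
Proof.
case: k => [|j] ltj.
  have -> : inord 0 = ord0 :> 'I_5 by apply: val_inj; rewrite /= inordK.
  by rewrite unlift_none.
have -> : inord j.+1 = lift ord0 (inord j : 'I_4) :> 'I_5.
  by apply: val_inj; rewrite /= !inordK.
by rewrite liftK.
Qed.

Lemma kernel_group_canonical k : k < 5 ->
  kernel_group G x y k = if k is j.+1 then C (inord j) else G.
Proof. by case: k => // j ltj; rewrite /canonical_maximal inordK. Qed.

Lemma is_multiplet_canonical (k1 k2 : nat) : k1 < 5 -> k2 < 5 ->
    (forall i : 'I_4, transfer_ker G (C i)
       = kernel_group G x y (nth 0 [:: k1; k2; 4; 3] i)) ->
  is_multiplet G C (multiplet k1 k2 4 3).
Proof.
move=> lt1 lt2 kerC i; rewrite ffunE oapp_unlift_inord; last first.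
  by case: i => [[|[|[|[|//]]]] ?].
rewrite kerC kernel_group_canonical //; by case: i => [[|[|[|[|//]]]] ?].
Qed.

Lemma has_transfer_type_kernels t k1 k2 : k1 < 5 -> k2 < 5 ->
    (forall i : 'I_4, transfer_ker G (C i)
       = kernel_group G x y (nth 0 [:: k1; k2; 4; 3] i)) ->
  has_transfer_type G (type_d t) -> kernel_pair t k1 k2.
Proof.
move=> lt1 lt2 kerC /has_transfer_type_reindex [M [injM maxM multM]].
have [f Ef] : exists f : 'I_4 -> 'I_4, forall i, M i = C (f i).
  by apply: (fin_all_exists (P := fun i j => M i = C j)) => i; apply/maxnormal_canonical.
have injf : injective f by move=> i j Eij; apply: injM; rewrite !Ef Eij.
have [g fK gK] := injF_bij injf.
have injC : injective C.
  by move=> i j; rewrite -(gK i) -(gK j) -!Ef => /injM ->.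
have CnG i : C i <> G.
  by move=> E; have := index_canonical i; rewrite E indexgg.
have kg_inj k l : k < 5 -> l < 5 ->
    kernel_group G x y k = kernel_group G x y l -> k = l.
  move=> ltk ltl; rewrite !kernel_group_canonical //.
  case: k l ltk ltl => [|k] [|l] // ltk ltl; [by move/esym/CnG|by move/CnG|].
  by move/injC/(congr1 val); rewrite /= !inordK // => ->.
have codes i : nth 0 (type_codes t) i < 5.
  by case: t {multM}; case: i => [|[|[|[|i]]]] //=; rewrite nth_nil.
have codesC (i : 'I_4) : nth 0 [:: k1; k2; 4; 3] i < 5.
  by case: i => [[|[|[|[|//]]]] ?].
(* The kernel of the transfer to [M i = C (f i)] is read off twice, once from the transfer type and
   once from the canonical kernels; [kg_inj] compares the labels. *)
have E (i : 'I_4) : nth 0 [:: k1; k2; 4; 3] (f i)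
    = if nth 0 (type_codes t) i is j.+1 then (f (inord j)).+1 else 0.
  have tgt : (if nth 0 (type_codes t) i is j.+1 then (f (inord j)).+1 else 0) < 5.
    by case: (nth 0 _ _) => [|j] //; rewrite ltnS.
  apply: (kg_inj _ _ (codesC _) tgt); apply: val_inj; rewrite /= -kerC -Ef.
  transitivity (gval (oapp M G (unlift ord0 (type_d t i)))).
    have sub_oapp o : 'L_2(G) \subset oapp M G o /\ oapp M G o \subset G.
      case: o => [j|] /=; last by rewrite lcn_sub subxx.
      by rewrite Ef; apply: canonical_sub.
    have [sAo soG] := sub_oapp (unlift ord0 (type_d t i)).
    apply: (quotient_lcn2_inj (K := [group of transfer_ker G (M i)]) (N := oapp M G _)) => //.
    - exact: lcn2_sub_ker.
    - exact: transfer_ker_sub.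
    by rewrite -(multM i).
  rewrite type_d_codes ffunE oapp_unlift_inord //.
  case: (nth 0 (type_codes t) i) => // j.
  rewrite Ef kernel_group_canonical; first by rewrite inord_val.
  by rewrite ltnS.
apply: (kernel_pair_by_relabelling (a := f ord0) (b := f (inord 1))
  (c := f (inord 2)) (d := f (inord 3)) lt1 lt2) => //.
have mem4 : [:: val (f ord0); val (f (inord 1)); val (f (inord 2)); val (f (inord 3))]
            = [seq val (f (inord j)) | j <- iota 0 4].
  by rewrite /= -[inord 0]/(inord (val (ord0 : 'I_4))) inord_val.
apply/andP; split.
  rewrite mem4 map_inj_in_uniq ?iota_uniq // => i j.
  rewrite !mem_iota => ltj lti /val_inj/injf/(congr1 val).
  by rewrite /= !inordK.
apply/allP=> i; rewrite mem_iota => lti; rewrite mem4.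
have nth4 j : j < 4 -> nth 0 [seq val (f (inord j)) | j <- iota 0 4] j = f (inord j).
  by move=> ltj; rewrite (nth_map 0) ?size_iota // nth_iota.
rewrite nth4 // E inordK //; case Ej: (nth 0 (type_codes t) i) (codes i) => [//|j].
by rewrite ltnS => ltj; rewrite nth4.
Qed.

End TransferTypes.

(** * Change of generators *)

Section ChangeOfGenerators.

Variables (gT : finGroupType) (G : {group gT}).
Hypothesis cA : abelian 'L_2(G).

Local Notation F := (fmod_of cA).

Definition act (g : gT) (u : F) : F := (u ^@ g)%R.

Fact act_additive g : zmod_morphism (act g).
Proof. by move=> u v; rewrite /act actAr actNr. Qed.

HB.instance Definition _ g :=
  GRing.isZmodMorphism.Build F F (act g) (act_additive g).

(** Exchanging [x] and [y] exchanges sigma with tau and negates [s]. So sigma_(m-1) and tau_e trade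
    places, which turns m, e into e + 1, m - 1, and the new last relation is sigma_m = 0. *)
Lemma mod_relations_swap x y m e alpha beta gamma delta :
    x \in G -> y \in G -> 0 < m -> sigmod x y cA m = 0%R ->
    mod_relations x y cA m e alpha beta gamma delta 0 ->
  mod_relations y x cA e.+1 m.-1 delta gamma beta alpha 0.
Proof.
move=> Gx Gy m_gt0 sig_m [R1 R2 R3 R4].
have Es : smod y x cA = (- smod x y cA)%R by rewrite /smod -(invg_comm y x) fmodV.
have Esig : sigmod y x cA = taumod x y cA by [].
have Etau : taumod y x cA = sigmod x y cA by [].
rewrite /mod_relations Es Esig Etau /= !mul0r !mulr0z in R1 R2 R3 R4 *.
rewrite prednK // sig_m oppr0 mulNrn R1; split=> //.
- by zmod_ring.
- by rewrite raddfN R3 addrAC.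
by rewrite raddfN opprK R2 addrAC.
Qed.

Variables x y : gT.
Hypotheses (Gx : x \in G) (Gy : y \in G).

Local Notation X := (com (cA := cA) x).
Local Notation Y := (com (cA := cA) y).
Local Notation s := (smod x y cA).
Local Notation sig := (sigmod x y cA).
Local Notation tau := (taumod x y cA).
Local Notation b := (act y^-1).

Hypotheses (Ax3 : x ^+ 3 \in 'L_2(G)) (Ay3 : y ^+ 3 \in 'L_2(G)).

Let smod_invy_act : smod x y^-1 cA = (- b s)%R.
Proof. exact: smod_invy. Qed.

Let bY u : com y^-1 u = (- b (Y u))%R.
Proof. exact: comV. Qed.

Let bE u : b (Y u + u)%R = u.
Proof. by rewrite -actE /act actrK. Qed.

Let bX u : X (b u) = b (X u).
Proof.
have E v : b v = (v + com y^-1 v)%R by rewrite /act actE addrC.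
by rewrite !E raddfD /= (comC _ Gx) ?groupV.
Qed.

Let bYC u : Y (b u) = b (Y u).
Proof.
have E v : b v = (v + com y^-1 v)%R by rewrite /act actE addrC.
by rewrite !E raddfD /= (comC _ Gy) ?groupV.
Qed.

Lemma act_invy_sigmod j : b (sig j) = sig j.
Proof. by rewrite -{2}(bE (sig j)) com_y_sigmod // add0r. Qed.

Lemma sigmod_invy j : sigmod x y^-1 cA j = (- sig j)%R.
Proof.
rewrite /sigmod; elim: (j - 3) => [|k IH] /=; first by rewrite expgVn fmodV.
by rewrite IH raddfN.
Qed.

Lemma taumod_invy j : taumod x y^-1 cA j = iter (j - 3) (fun u => - b u)%R (tau j).
Proof.
have E k v : Y (iter k (fun u => - b u)%R v) = iter k (fun u => - b u)%R (Y v).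
  by elim: k => //= k IH; rewrite raddfN /= bYC IH.
rewrite /taumod; elim: (j - 3) => [//|k IH].
by rewrite [LHS]/= IH bY E.
Qed.

(** The new operator is [- b Y], where [b] is the inverse of [1 + Y], commutes with [X] and [Y] and
    fixes every sigma_j. For beta = delta = rho = 0 the right-hand sides of the second and third
    relation consist of sigma terms only, so applying [b] to a relation leaves its right-hand side
    unchanged. *)
Lemma mod_relations_invy m e alpha gamma :
    mod_relations x y cA m e alpha 0 gamma 0 0 ->
  mod_relations x y^-1 cA m e (- alpha) 0 gamma 0 0.
Proof.
case=> R1 R2 R3 R4; rewrite /mod_relations.
rewrite !mul0r !mulr0z ?subr0 ?oppr0 ?addr0 ?add0r in R1 R2 R3 R4 *.
rewrite !sigmod_invy smod_invy_act !taumod_invy R4 /= !bY.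
have b0 : b 0%R = 0%R by rewrite raddf0.
split.
- have -> : ((- b s) *+ 3 = - b (s *+ 3))%R by zmod_ring.
  by rewrite R1 -{2}(act_invy_sigmod 4); zmod_ring.
- rewrite raddfN /= bX -{1}(act_invy_sigmod 3) -{1}(act_invy_sigmod 4).
  have -> : (- b (X s) - b (sig 3) - b (sig 4) = - b (X s + sig 3 + sig 4))%R.
    by zmod_ring.
  by rewrite R2 raddfMz /= act_invy_sigmod mulNrz.
(* The aim is to recognise the new left-hand side as [b (b _)] of the old one; T1 and T2 rewrite the
   tau terms, using that [b] inverts [1 + Y]. *)
- have T1 : (tau 3 - b (tau 4) = b (tau 3))%R.
    by rewrite -{1}(bE (tau 3)) taumodS //; zmod_ring.
  have T2 : b (tau 3) = b (b (tau 4 + tau 3))%R by rewrite -(taumodS x y cA (leqnn 3)) bE.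
  have T3 : Y (- b s)%R = (- b (Y s))%R by rewrite raddfN /= bYC.
  rewrite -addrA T1 T2 T3 !opprK.
  have -> : (b (- b (Y s)) + b (b (tau 4 + tau 3)) = b (b (- Y s + tau 3 + tau 4)))%R.
    by zmod_ring.
  by rewrite R3 !raddfMz /= !act_invy_sigmod mulrNz mulNrz opprK.
by elim: (e.+1 - 3) => //= k ->; rewrite b0 oppr0.
Qed.

End ChangeOfGenerators.

(** Inversion of [x] is inversion of [y] between two exchanges. The exchange is purely a statement
    about relations, so it may be used even when e < m - 1. *)
Lemma mod_relations_invx (gT : finGroupType) (G : {group gT}) (cA : abelian 'L_2(G))
    (x y : gT) m e beta delta :
    x \in G -> y \in G -> x ^+ 3 \in 'L_2(G) -> y ^+ 3 \in 'L_2(G) ->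
    0 < m -> sigmod x y cA m = 0%R ->
    mod_relations x y cA m e 0 beta 0 delta 0 ->
  mod_relations x^-1 y cA m e 0 beta 0 (- delta) 0.
Proof.
move=> Gx Gy Ax3 Ay3 m_gt0 sig_m rel; have [_ _ _ R4] := rel.
have rel1 := mod_relations_swap Gx Gy m_gt0 sig_m rel.
have rel2 := mod_relations_invy Gy Gx Ax3 rel1.
rewrite -(prednK m_gt0) -[e]/(e.+1.-1).
apply: (mod_relations_swap Gy _ _ _ rel2); rewrite ?groupV //.
by rewrite sigmod_invy // -[sigmod y x cA _]/(taumod x y cA e.+1) R4 mulr0z !oppr0.
Qed.

Lemma gen_set2_absorb (gT : finGroupType) (L : {group gT}) u v :
  u \in L -> <<[set u; v] :|: L>> = <<v |: L>>.
Proof.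
move=> Lu; rewrite -setUA; apply/eqP; rewrite eqEsubset [X in _ && X]genS ?subsetUr //.
by rewrite gen_subG subUset sub1set !mem_gen ?sub_gen // inE Lu orbT.
Qed.

(** * Iterated minima, the subgroups chi_j and the invariants e, s, k *)

Lemma bigmin_leq (r : seq nat) (P : pred nat) d :
  \big[minn/d]_(j <- r | P j) j <= d
  /\ {in r, forall j, P j -> \big[minn/d]_(i <- r | P i) i <= j}.
Proof.
elim: r => [|i r [IHd IHr]]; first by rewrite big_nil.
rewrite big_cons; case: ifP => Pi; split=> [|j].
- by rewrite geq_min IHd orbT.
- rewrite inE geq_min => /predU1P[->|rj] Pj; first by rewrite leqnn.
  by rewrite IHr ?orbT.
- exact: IHd.
by rewrite inE => /predU1P[->|]; [rewrite Pi | apply: IHr].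
Qed.

Lemma bigmin_mem (r : seq nat) (P : pred nat) d :
  \big[minn/d]_(j <- r | P j) j = d
  \/ \big[minn/d]_(j <- r | P j) j \in r /\ P (\big[minn/d]_(j <- r | P j) j).
Proof.
elim: r => [|i r IH]; first by rewrite big_nil; left.
rewrite big_cons inE; case: ifP => Pi.
  rewrite /minn; case: ltnP => _; first by right; rewrite eqxx.
  by case: IH => [->|[rb Pb]]; [left | right; rewrite rb orbT].
by case: IH => [->|[rb Pb]]; [left | right; rewrite rb orbT].
Qed.

Section ChiSubgroups.

Variables (gT : finGroupType) (G : {group gT}).

Lemma inv_e_bounds e : inv_e G = e -> 4 <= e ->
  e < inv_m G /\ forall j, 3 <= j <= e -> 3 < #|'L_j(G) / 'L_j.+1(G)|.
Proof.
have := bigmin_leq (index_iota 3 (inv_m G).+1)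
  (fun j => 1 <= #|'L_j(G) / 'L_j.+1(G)| <= 3) (inv_m G).
rewrite /inv_e; move: (\big[_/_]_(_ <- _ | _) _) => b [le_bm le_b] Ee le4e.
have lt_em : e < inv_m G by nat_lia.
split=> // j /andP[le3j leje]; rewrite ltnNge; apply/negP=> small.
have : b <= j; last by nat_lia.
by apply: le_b; rewrite ?mem_index_iota ?cardG_gt0 //; nat_lia.
Qed.

Lemma chiP j g : reflect
  (g \in G /\ forall u, u \in 'L_j(G) -> [~ g, u] \in 'L_j.+2(G)) (g \in chi G j).
Proof.
rewrite inE; apply: (iffP andP) => [[Gg /forall_inP H]|[Gg H]]; first by split.
by split=> //; apply/forall_inP.
Qed.

Lemma chi_group_set j : group_set (chi G j).
Proof.
apply/group_setP; split=> [|g h /chiP[Gg Hg] /chiP[Gh Hh]]; apply/chiP.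
  by split=> // u _; rewrite comm1g group1.
split=> [|u Lu]; first exact: groupM.
rewrite commMgJ groupM ?Hh //.
by rewrite memJ_norm ?Hg // (subsetP (lcn_norm _ _)).
Qed.

Canonical chi_group j := Group (chi_group_set j).

Hypothesis cA : abelian 'L_2(G).

Lemma lcn2_sub_chi j : 2 <= j -> 'L_2(G) \subset chi G j.
Proof.
move=> le2j; apply/subsetP=> g Ag; apply/chiP.
split=> [|u Lu]; first exact: subsetP (lcn_sub 2 G) _ Ag.
have Au := subsetP (lcn_sub_leq G le2j) _ Lu.
by rewrite (_ : [~ g, u] = 1) //; apply/eqP/commgP/(centsP cA).
Qed.

Lemma chi_sub j : chi G j \subset G.
Proof. by apply/subsetP=> g /chiP[]. Qed.

Lemma inv_s_leq j : 2 <= j < inv_m G -> 'L_2(G) \proper chi G j -> inv_s G <= j.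
Proof.
move=> ltj prj; have [_ H] := bigmin_leq (index_iota 2 (inv_m G))
  (fun j => 'L_2(G) \proper chi G j) (inv_m G).-1.
by apply: H => //; rewrite mem_index_iota.
Qed.

Lemma inv_s_mem : inv_s G = (inv_m G).-1 \/
  2 <= inv_s G < inv_m G /\ 'L_2(G) \proper chi G (inv_s G).
Proof.
have := bigmin_mem (index_iota 2 (inv_m G))
  (fun j => 'L_2(G) \proper chi G j) (inv_m G).-1.
by rewrite mem_index_iota.
Qed.

End ChiSubgroups.

Section InvariantsFromRelations.

Variables (gT : finGroupType) (G : {group gT}) (x y : gT).
Hypotheses (defG : G :=: <<[set x; y]>>) (cA : abelian 'L_2(G)).
Hypothesis defL3 : 'L_3(G) = <<[set y ^+ 3; x ^+ 3] :|: 'L_4(G)>>.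
Hypotheses (nilG : nilpotent G) (index_lcn2 : #|G : 'L_2(G)| = 9).

Local Notation X := (com (cA := cA) x).
Local Notation Y := (com (cA := cA) y).
Local Notation sig := (sigmod x y cA).
Local Notation tau := (taumod x y cA).
Local Notation C := (canonical_maximal G x y).

Let Gx : x \in G. Proof. by have [] := mem_gen2 defG. Qed.
Let Gy : y \in G. Proof. by have [] := mem_gen2 defG. Qed.

(** If chi_j misses [x], it is a proper subgroup strictly above G', hence of index 3 and one of the
    four M_i. *)
Lemma proper_chi_canonical j : 2 <= j -> 'L_2(G) \proper chi G j ->
  exists2 z, z \in [:: y; x; x * y; x * y^-1] & z \in chi G j.
Proof.
move=> le2j prchi; have sA := lcn2_sub_chi cA le2j.
have [|notx] := boolP (x \in chi G j); first by exists x => //; rewrite !inE eqxx orbT.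
have nchi : chi_group G j <| G := normal_lcn2_sub sA (chi_sub G j).
have i3 : #|G : chi G j| = 3.
  have E := Lagrange_index (chi_sub G j) sA; rewrite index_lcn2 in E.
  apply: (index9_factor _ _ E); rewrite indexg_eq1; last by rewrite proper_subn.
  by apply: contra notx => /subsetP->.
have [i Ei] := index3_canonical defG defL3 index_lcn2 sA nchi i3.
have : nth y [:: y; x; x * y; x * y^-1] i \in C i.
  by case: i {Ei} => [[|[|[|[|//]]]] ?]; apply: mem_max.
rewrite -Ei => chi_z; exists (nth y [:: y; x; x * y; x * y^-1] i) => //.
by rewrite mem_nth.
Qed.

Lemma chi_com j z (u : fmod_of cA) :
  z \in chi G j -> fmval u \in 'L_j(G) -> fmval (com z u) \in 'L_j.+2(G).
Proof.
by case/chiP=> Gz Hz Lu; rewrite fmval_com // -invg_comm groupV Hz.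
Qed.

Lemma lcn3_gen_com z w : G :=: <<[set z; w]>> ->
  'L_3(G) = <<[set fmval (com z (smod z w cA)); fmval (com w (smod z w cA))]
              :|: 'L_4(G)>>.
Proof.
move=> defG'; have [Gz Gw] := mem_gen2 defG'.
apply: (lcn_gen_step defG' (lcn2_gen defG')).
  by apply/subsetP=> v /set2P[] ->; rewrite fmval_com // mem_commg // fmodP.
move=> a b /set1P-> /set2P[] ->; rewrite -(fmval_smod cA) // -fmval_com //;
  by rewrite mem_gen // !inE eqxx ?orbT.
Qed.

(** One of the two generators [s,z], [s,w] of gamma_3 modulo gamma_4 becomes trivial. The index 2 is
    separate because gamma_2 / gamma_3 is generated by [s] alone. *)
Lemma chi2_small z w : G :=: <<[set z; w]>> -> z \in chi G 2 ->
  #|'L_3(G) / 'L_4(G)| <= 3.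
Proof.
move=> defG' chi_z; have [Gz Gw] := mem_gen2 defG'.
apply: (card_lcn_quotient_gen1 (u := com w (smod z w cA))).
  have sL4 : 'L_4(G) \subset <<fmval (com w (smod z w cA)) |: 'L_4(G)>>.
    by rewrite sub_gen ?subsetUr.
  have := lcn3_gen_com defG'.
  set a := fmval (com z _) => defL3'; set b := fmval (com w _) in sL4 defL3' *.
  have La : a \in 'L_4(G) by rewrite chi_com ?fmodP.
  have Lb : b \in 'L_3(G) by apply: com_lcn => //; apply: fmodP.
  apply/eqP; rewrite eqEsubset [X in _ && X]gen_subG subUset sub1set Lb lcn_subS !andbT.
  rewrite [X in pred_of_set X]defL3' gen_subG subUset sL4 andbT.
  by apply/subsetP=> v /set2P[] ->; rewrite ?mem_gen ?setU11 // inE La orbT.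
by rewrite -raddfMn /= com_lcn // (lcn2_cube defG defL3).
Qed.

(** Commutation with [y] sends tau_j to tau_(j+1); commutation with any of the other three sends
    sigma_j to sigma_(j+1). So membership in chi_j makes one of the two generators of gamma_(j+1)
    drop. *)
Lemma chi_small j z : 3 <= j -> z \in [:: y; x; x * y; x * y^-1] ->
  z \in chi G j -> #|'L_j.+1(G) / 'L_j.+2(G)| <= 3.
Proof.
move=> le3j; have [Ax3 Ay3] := cubes_lcn2 defL3.
have L2 i : j.+2 <= i -> fmval (sig i) \in 'L_j.+2(G) /\ fmval (tau i) \in 'L_j.+2(G).
  move=> lei; have le3i : 3 <= i by nat_lia.
  by split; apply: (subsetP (lcn_sub_leq G lei));
    [apply: (sigmod_lcn defG cA defL3) | apply: (taumod_lcn defG cA defL3)].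
have [Ls Lt] := L2 _ (leqnn _); have [Ls' Lt'] := L2 _ (leqnSn _).
have Lj := lcn_gen defG cA defL3 (leqW le3j).
have red (u v : fmod_of cA) :
    [set fmval (sig j.+1); fmval (tau j.+1)] = [set fmval u; fmval v] ->
    fmval u \in 'L_j.+2(G) -> 'L_j.+1(G) = <<fmval v |: 'L_j.+2(G)>>.
  by move=> E Lu; rewrite Lj E gen_set2_absorb.
have small_sig : fmval (sig j.+1) \in 'L_j.+2(G) -> #|'L_j.+1(G) / 'L_j.+2(G)| <= 3.
  move=> H; apply: (card_lcn_quotient_gen1 (red _ _ _ H)) => //.
  by rewrite taumod_cube //; fmval_in; apply: fmvalMn_in.
have small_tau : fmval (tau j.+1) \in 'L_j.+2(G) -> #|'L_j.+1(G) / 'L_j.+2(G)| <= 3.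
  move=> H; apply: (card_lcn_quotient_gen1 (red _ _ _ H)); first by rewrite setUC.
  by rewrite sigmod_cube //; fmval_in; apply: fmvalMn_in.
have Lsj := sigmod_lcn defG cA defL3 le3j; have Ltj := taumod_lcn defG cA defL3 le3j.
have Ysig : Y (sig j) = 0%R by rewrite com_y_sigmod.
have Xsig : X (sig j) = sig j.+1 by rewrite sigmodS.
have YVsig : com y^-1 (sig j) = 0%R by rewrite comV // Ysig act0r oppr0.
have GyV : y^-1 \in G by rewrite groupV.
rewrite mem_seq4 => /or4P[] /eqP-> /chi_com H.
- by apply: small_tau; rewrite -taumodS //; apply: H.
- by apply: small_sig; rewrite -Xsig; apply: H.
- apply: small_sig; have := H _ Lsj.
  by rewrite comM // Ysig (comC _ Gy Gx) Ysig raddf0 !addr0 Xsig.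
apply: small_sig; have := H _ Lsj.
by rewrite comM // YVsig (comC _ GyV Gx) YVsig raddf0 !addr0 Xsig.
Qed.

Lemma lcn_inv_m : 'L_(inv_m G)(G) = 1.
Proof. exact/(lcn_nil_classP _ nilG). Qed.

(** If s < m - 1 = e, some canonical generator lies in chi_s, and then gamma_(s+1) / gamma_(s+2) is
    too small for an index s + 1 <= e. *)
Lemma inv_s_last e : (forall j, 3 <= j <= e -> 3 < #|'L_j(G) / 'L_j.+1(G)|) ->
  3 <= e -> inv_m G = e.+1 -> inv_s G = (inv_m G).-1.
Proof.
move=> big_quo le3e Em; case: (inv_s_mem G) => // -[/andP[le2s lts] prs].
apply/eqP; rewrite Em /= eqn_leq; apply/andP; split; first by rewrite -ltnS -Em.
rewrite leqNgt; apply/negP=> lt_se.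
have [z zin chi_z] := proper_chi_canonical le2s prs.
have [le3s|lt_s2|s2] := ltngtP 2 (inv_s G).
- have := chi_small le3s zin chi_z; rewrite leqNgt big_quo //.
  by rewrite (leq_trans le3s) ?leqnSn.
- by rewrite leqNgt lt_s2 in le2s.
rewrite -s2 in chi_z.
suff [w defG'] : exists w, G :=: <<[set z; w]>>.
  by have := chi2_small defG' chi_z; rewrite leqNgt big_quo.
move: zin; rewrite mem_seq4 => /or4P[] /eqP->.
- by exists x; rewrite setUC.
- by exists y.
- by exists x; apply: gen_xy_x.
by exists x; apply: gen_xy_x (gen_xV defG (set21 _ _) (set22 _ _)).
Qed.

Lemma gen_notin_lcn2 : x \notin 'L_2(G) /\ y \notin 'L_2(G).
Proof.
have [Ax3 Ay3] := cubes_lcn2 defL3.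
split; [have := notin_max index_lcn2 (gen_yx defG) Ay3 | have := notin_max index_lcn2 defG Ax3];
  by apply: contra; apply/subsetP/lcn2_sub_max.
Qed.

(** For m = e + 1 the group gamma_e is central. Otherwise gamma_e is generated by elements commuting
    with [y], so [y] is in chi_e and s <= e < m - 1; then [x] is outside chi_s, which must be M_1,
    and M_1 centralises gamma_e. *)
Lemma is_inv_k0 e : inv_e G = e -> 3 <= e -> e < inv_m G -> tau e.+1 = 0%R ->
  (inv_s G < (inv_m G).-1 -> x \in G :\: chi G (inv_s G)) ->
  y \in chi G (inv_s G) :\: 'L_2(G) -> is_inv_k G 0.
Proof.
move=> Ee le3e lt_em te1 Hx Hy; split=> //; rewrite subn0 lcn_inv_m Ee.
have [Ax3 Ay3] := cubes_lcn2 defL3.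
apply/commG1P; have [Em|ltm] := eqVneq (inv_m G) e.+1.
  rewrite (subset_trans (chi_sub G _)) // centsC; apply/commG1P.
  by apply/trivgP; rewrite -lcn_inv_m Em lcnSnS.
have te j : e < j -> tau j = 0%R.
  elim: j => // j IH; rewrite ltnS leq_eqVlt => /predU1P[<- //|lt_ej].
  by rewrite -taumodS ?IH ?raddf0 //; nat_lia.
have sLC : 'L_e(G) \subset 'C[y].
  apply: (lcn_sub_gen defG defL3 (cA := cA)) => // j le_ej;
    apply/cent1P/commgP/eqP; rewrite -fmval_com //.
    by rewrite com_y_sigmod // fmval0.
  by rewrite taumodS ?te ?fmval0 //; nat_lia.
have sLA : 'L_e(G) \subset 'L_2(G) by rewrite lcn_sub_leq // ltnW.
have chi_y : y \in chi G e.
  apply/chiP; split=> // u Lu; rewrite (_ : [~ y, u] = 1) ?group1 //.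
  by apply/eqP/commgP/esym/cent1P; rewrite (subsetP sLC).
have [_ notAy] := gen_notin_lcn2.
have pr_e : 'L_2(G) \proper chi G e.
  rewrite properE lcn2_sub_chi ?(ltnW le3e) //; apply: contra notAy.
  by move/subsetP->.
have le_se : inv_s G <= e by apply: inv_s_leq => //; nat_lia.
have lt_sm : inv_s G < (inv_m G).-1 by move/eqP: ltm; nat_lia.
have /setDP[_ notx] := Hx lt_sm; have /setDP[chi_ys _] := Hy.
have le2s : 2 <= inv_s G.
  by case: (inv_s_mem G) => [E|[/andP[]//]]; rewrite E; nat_lia.
have sMchi : generated_group (y |: 'L_2(G)) \subset chi G (inv_s G).
  by rewrite gen_subG subUset sub1set chi_ys lcn2_sub_chi.
have Echi : chi G (inv_s G) = generated_group (y |: 'L_2(G)).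
  apply/eqP; rewrite eq_sym eqEsubset sMchi /=.
  have := Lagrange_index (chi_sub G (inv_s G)) sMchi.
  rewrite (index_max_y defG defL3 index_lcn2) -indexg_eq1 => E.
  have : #|G : chi G (inv_s G)| \in [:: 1; 3]%N.
    by rewrite (_ : [:: _; _] = divisors 3) // -dvdn_divisors // -E dvdn_mulr.
  rewrite !inE => /orP[G1|/eqP G3].
    rewrite (indexg_eq1 G (chi_group G (inv_s G))) in G1.
    by rewrite (subsetP G1) in notx.
  by move/eqP: E; rewrite G3 -[X in _ == X](muln1 3) eqn_pmul2l.
rewrite Echi gen_subG subUset sub1set; apply/andP; split.
  by rewrite -sub_cent1.
by rewrite centsC (subset_trans sLA).
Qed.

End InvariantsFromRelations.

Section SelectedGenerators.

Variables (gT : finGroupType) (G : {group gT}) (x y : gT).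

Lemma selected_generators_signs z w :
    z \in [set x; x^-1] -> w \in [set y; y^-1] ->
  selected_generators G x y -> selected_generators G z w.
Proof.
move=> Hz Hw [defG defL3 Hx Hy].
have inv (g h : gT) (H : {group gT}) : h \in [set g; g^-1] -> (h \in H) = (g \in H).
  by case/set2P=> ->; rewrite ?groupV.
split; first exact: (gen_xV defG Hz Hw).
- exact: (lcn3_gen_signs Hz Hw defL3).
- move/Hx; rewrite !in_setD -[chi G _]/(gval (chi_group G (inv_s G))).
  by rewrite !(inv _ _ _ Hz).
move: Hy; rewrite !in_setD -[chi G _]/(gval (chi_group G (inv_s G))).
by rewrite (inv _ _ (chi_group G (inv_s G)) Hw) (inv _ _ [group of 'L_2(G)] Hw).
Qed.

(** Since gamma_(m-1) is central, chi_(m-1) is G: the condition on the first generator is void and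
    the one on the second holds for any element outside G'. *)
Lemma selected_generators_swap (cA : abelian 'L_2(G)) : nilpotent G ->
    #|G : 'L_2(G)| = 9 -> inv_s G = (inv_m G).-1 -> 3 <= inv_m G ->
  selected_generators G x y -> selected_generators G y x.
Proof.
move=> nilG i9 Es le3m [defG defL3 Hx Hy].
have defL3' : 'L_3(G) = <<[set x ^+ 3; y ^+ 3] :|: 'L_4(G)>>.
  by rewrite [in RHS](setUC [set x ^+ 3]).
have [notAx notAy] := gen_notin_lcn2 defG defL3 i9.
split=> //; [by rewrite setUC | by rewrite Es ltnn |].
rewrite inE notAx /=; have [Gx Gy] := mem_gen2 defG.
apply/chiP; split=> // u Lu; rewrite -invg_comm groupV.
suff /set1gP-> : [~ u, x] \in [1 gT] by apply: group1.
have Em : inv_m G = (inv_m G).-2.+2 by nat_lia.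
rewrite -(lcn_inv_m nilG) Em lcnSn mem_commg //.
by rewrite Es in Lu; have -> : (inv_m G).-2.+1 = (inv_m G).-1 by nat_lia.
Qed.

End SelectedGenerators.

(** * Successors *)

Lemma quotient_isog_morphism (hT gT : finGroupType) (H N : {group hT}) (G : {group gT}) :
    N <| H -> H / N \isog G ->
  exists f : {morphism H >-> gT}, f @* H = G /\ 'ker f = N.
Proof.
move=> nNH /isogP[g injg imG]; have nN := subsetP (normal_norm nNH).
have fM : {in H &, {morph (fun h => g (coset N h)) : a b / a * b}}.
  by move=> a b Ha Hb /=; rewrite morphM ?nN // morphM ?mem_quotient.
exists (Morphism fM); split.
  rewrite -imG; apply/setP=> z.
  apply/morphimP/morphimP=> [[h _ Hh ->]|[w _ /morphimP[h _ Hh ->] ->]].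
    by exists (coset N h); rewrite ?mem_quotient.
  by exists h.
apply/setP=> h; apply/idP/idP => [/morphpreP[Hh /set1P /= gh1]|Nh].
  apply: coset_idr; first exact: nN.
  by apply: (injmP injg); rewrite ?mem_quotient ?group1 // gh1 morph1.
have Hh := subsetP (normal_sub nNH) _ Nh.
by apply/morphpreP; split=> //; apply/set1P; rewrite /= coset_id ?morph1.
Qed.

Section Lifting.

Variables (hT gT : finGroupType) (H : {group hT}) (G : {group gT}).
Variable f : {morphism H >-> gT}.
Hypothesis imG : f @* H = G.

Lemma mem_of_morphim (A : {group hT}) h :
  A \subset H -> 'ker f \subset A -> h \in H -> f h \in f @* A -> h \in A.
Proof.
move=> sAH skA Hh /morphimP[a Ha Aa E].
rewrite -(mulgKV a h) groupM // (subsetP skA) //.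
by apply/kerP; rewrite ?groupM ?groupV // morphM ?groupV // morphV // E mulgV.
Qed.

Lemma morph_elt_sigma h k j : h \in H -> k \in H ->
  f (elt_sigma h k j) = elt_sigma (f h) (f k) j.
Proof.
move=> Hh Hk; rewrite /elt_sigma.
suff : f (iter (j - 3) (fun v => [~ v, h]) (k ^+ 3)) =
    iter (j - 3) (fun v => [~ v, f h]) (f k ^+ 3) /\
    iter (j - 3) (fun v => [~ v, h]) (k ^+ 3) \in H by case.
elim: (j - 3) => [|i [IH Hi]] /=; first by rewrite morphX ?groupX.
by rewrite morphR // IH groupR.
Qed.

Variables (x y : gT) (x' y' : hT).
Hypotheses (Hx : x' \in H) (Hy : y' \in H) (fx : f x' = x) (fy : f y' = y).
Hypotheses (defG : G :=: <<[set x; y]>>).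

(** The kernel lies in the Frattini subgroup, so lifts of generators generate. *)
Lemma gen_lift : 3.-group H -> 'ker f \subset 'L_2(H) -> H :=: <<[set x'; y']>>.
Proof.
move=> pH skerL.
have sKH : <<[set x'; y']>> \subset H.
  by rewrite gen_subG; apply/subsetP=> z /set2P[] ->.
have sLPhi : 'L_2(H) \subset 'Phi(H) by rewrite (Phi_joing pH) joing_subl.
have E : 'Phi(H) <*> [set x'; y'] = H.
  apply/eqP; rewrite eqEsubset join_subG Phi_sub -gen_subG sKH /=.
  rewrite -(morphimSGK (f := f)) //; last first.
    by rewrite (subset_trans skerL) // (subset_trans sLPhi) // joing_subl.
  rewrite imG defG gen_subG; apply/subsetP=> z /set2P[] ->; rewrite -?fx -?fy mem_morphim //;
    by rewrite mem_gen // !inE eqxx ?orbT.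
by rewrite -(Phi_nongen E).
Qed.

Hypothesis defL3 : 'L_3(G) = <<[set y ^+ 3; x ^+ 3] :|: 'L_4(G)>>.

Lemma lcn3_lift : 'ker f \subset 'L_4(H) ->
  'L_3(H) = <<[set y' ^+ 3; x' ^+ 3] :|: 'L_4(H)>>.
Proof.
move=> skL4; have skL3 := subset_trans skL4 (lcn_subS 3 H).
have imL j : f @* 'L_j(H) = 'L_j(G) by rewrite morphim_lcn // imG.
have [Lx3 Ly3] := cubes_lcn3 defL3.
have Lx' : x' ^+ 3 \in 'L_3(H).
  by apply: mem_of_morphim; rewrite ?lcn_sub ?groupX // imL morphX // fx.
have Ly' : y' ^+ 3 \in 'L_3(H).
  by apply: mem_of_morphim; rewrite ?lcn_sub ?groupX // imL morphX // fy.
have sNL : <<[set y' ^+ 3; x' ^+ 3] :|: 'L_4(H)>> \subset 'L_3(H).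
  rewrite gen_subG subUset lcn_subS andbT.
  by apply/subsetP=> z /set2P[] ->.
apply/eqP; rewrite eqEsubset sNL andbT -(morphimSGK (f := f)) ?lcn_sub //; last first.
  by rewrite (subset_trans skL4) // sub_gen ?subsetUr.
rewrite imL [X in pred_of_set X]defL3 gen_subG subUset; apply/andP; split.
  have [Hx3 Hy3] : x' ^+ 3 \in H /\ y' ^+ 3 \in H by rewrite !groupX.
  apply/subsetP=> z /set2P[] ->; rewrite -?fx -?fy -morphX // mem_morphim //;
    by rewrite mem_gen // !inE eqxx ?orbT.
by rewrite -imL morphimS // sub_gen ?subsetUr.
Qed.

Variables (cA : abelian 'L_2(G)) (cB : abelian 'L_2(H)).

Definition fmod_morph (u : fmod_of cB) : fmod_of cA := fmod cA (f (fmval u)).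

Let L2f (u : fmod_of cB) : f (fmval u) \in 'L_2(G).
Proof.
rewrite -imG -morphim_lcn // mem_morphim ?fmodP //.
exact: (subsetP (lcn_sub 2 H)) (fmodP u).
Qed.

Let L2H (u : fmod_of cB) : fmval u \in H.
Proof. exact: (subsetP (lcn_sub 2 H)) (fmodP u). Qed.

Fact fmod_morph_additive : zmod_morphism fmod_morph.
Proof.
move=> u v; apply: fmod_inj.
rewrite fmvalA fmvalN !(fmodK cA) ?L2f // fmvalA fmvalN.
rewrite -[\val u]/(fmval u) -[\val v]/(fmval v).
by rewrite (morphM f (L2H u) (groupVr (L2H v))) (morphV f (L2H v)).
Qed.

Lemma fmod_morph_com h (u : fmod_of cB) : h \in H ->
  fmod_morph (com h u) = com (f h) (fmod_morph u).
Proof.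
move=> Hh; have Gfh : f h \in G by rewrite -imG mem_morphim.
apply: fmod_inj; rewrite fmval_com // !(fmodK cA) ?L2f // fmval_com //.
by rewrite morphR.
Qed.

Lemma fmod_morph_ker (u : fmod_of cB) : fmod_morph u = 0%R -> fmval u \in 'ker f.
Proof.
move=> /(congr1 (@fmval _ _ _)); rewrite (fmodK cA) // fmval0 => E.
by apply/kerP.
Qed.

End Lifting.

Lemma nil_class_image (hT gT : finGroupType) (H : {group hT}) (G : {group gT})
    (f : {morphism H >-> gT}) : nilpotent H -> 0 < nil_class H ->
  f @* H = G -> 'ker f = 'L_(nil_class H)(H) -> (nil_class G).+1 = nil_class H.
Proof.
move=> nilH c_gt0 imG kerf; set c := nil_class H in c_gt0 kerf *.
have nilG : nilpotent G by rewrite -imG morphim_nil.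
have imL j : f @* 'L_j(H) = 'L_j(G) by rewrite morphim_lcn // imG.
apply/eqP; rewrite -[X in _ == X](prednK c_gt0) eqSS eqn_leq; apply/andP; split.
  apply/(lcn_nil_classP _ nilG); rewrite prednK //.
  have -> : 'L_c(G) = f @* 'ker f by rewrite kerf imL.
  by rewrite morphim_ker.
rewrite leqNgt; apply/negP=> lt_c.
have Lk1 := elimT (lcn_nil_classP _ nilG) (leqnn (nil_class G)).
have sLc : 'L_(nil_class G).+1(H) \subset 'L_c(H).
  rewrite -kerf; apply/subsetP=> h Lh; have Hh := subsetP (lcn_sub _ H) _ Lh.
  by apply/kerP => //; apply/set1gP; rewrite -Lk1 -imL mem_morphim.
have : 'L_c(H) \subset 'L_c.+1(H).
  have E : c = c.-2.+2 by nat_lia.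
  rewrite {1}E; apply: subset_trans (lcnSnS c H); rewrite commSg //.
  apply: subset_trans sLc; apply: lcn_sub_leq; nat_lia.
rewrite (elimT (lcn_nil_classP _ nilH) (leqnn c)) => /trivgP Lc1.
have : nil_class H <= c.-1 by apply/(lcn_nil_classP _ nilH); rewrite prednK.
by rewrite -/c; nat_lia.
Qed.

(** For lifted generators the relations of G give X P = gamma sigma_m, X Q = alpha sigma_m and Y P =
    Y Q = 0 in the successor. The identities for P and Q then annihilate both multiples, while
    sigma_m itself is non-trivial. *)
Lemma internal_alpha_gamma (gT : finGroupType) (G : {group gT}) (x y : gT)
    (cA : abelian 'L_2(G)) m e alpha gamma :
    G :=: <<[set x; y]>> -> 'L_3(G) = <<[set y ^+ 3; x ^+ 3] :|: 'L_4(G)>> ->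
    inv_m G = m -> 4 <= e -> e.+1 < m ->
    small_exponent alpha -> small_exponent gamma ->
    mod_relations x y cA m e alpha 0 gamma 0 0 -> internal_node G ->
  alpha = 0%R /\ gamma = 0%R.
Proof.
move=> defG defL3 Em le4e lt_em sa sg rel [hT [H [[pH cB _] le2c isoG]]].
have nilH := pgroup_nil pH.
have [f [imG kerf]] := quotient_isog_morphism (lcn_normal (nil_class H) H) isoG.
have Ec : nil_class H = m.
  by rewrite -Em /inv_m (nil_class_image nilH _ imG kerf) // ltnW.
rewrite Ec in kerf.
have Lm1 : 'L_m.+1(H) = 1 by apply/(lcn_nil_classP _ nilH); rewrite Ec.
have [Gx Gy] := mem_gen2 defG.
have [x' [Hx fx]] : exists x', x' \in H /\ f x' = x.
  by move: Gx; rewrite -imG => /morphimP[z _ Hz ->]; exists z.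
have [y' [Hy fy]] : exists y', y' \in H /\ f y' = y.
  by move: Gy; rewrite -imG => /morphimP[z _ Hz ->]; exists z.
have sker j : j <= m -> 'ker f \subset 'L_j(H).
  by move=> le_jm; rewrite kerf lcn_sub_leq.
have defH : H :=: <<[set x'; y']>>.
  by apply: (gen_lift imG Hx Hy fx fy defG pH); apply: sker; nat_lia.
have defL3H : 'L_3(H) = <<[set y' ^+ 3; x' ^+ 3] :|: 'L_4(H)>>.
  by apply: (lcn3_lift imG Hx Hy fx fy defL3); apply: sker; nat_lia.
have [Bx3 By3] := cubes_lcn2 defL3H; have [Ax3 Ay3] := cubes_lcn2 defL3.
pose phi := fmod_morph f cA (cB := cB).
have phiB : zmod_morphism phi := fmod_morph_additive imG cA (cB := cB).
pose X := com (cA := cB) x'; pose Y := com (cA := cB) y'.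
pose s := smod x' y' cB; pose sig := sigmod x' y' cB; pose tau := taumod x' y' cB.
have phi_s : phi s = smod x y cA.
  apply: fmod_inj; rewrite /phi /fmod_morph /s fmval_smod // morphR // fx fy.
  by rewrite (fmodK cA) ?fmval_smod ?comm_lcn2.
have phi_sig j : phi (sig j) = sigmod x y cA j.
  rewrite /phi /fmod_morph /sig -elt_sigmaE // morph_elt_sigma // fx fy.
  by rewrite (elt_sigmaE cA) // fmvalK.
have phi_tau j : phi (tau j) = taumod x y cA j.
  rewrite /phi /fmod_morph /tau -[taumod x' y' cB]/(sigmod y' x' cB).
  rewrite -elt_sigmaE // morph_elt_sigma // fx fy.
  by rewrite (elt_sigmaE cA) // fmvalK.
have phiX u : phi (X u) = com x (phi u) by rewrite /phi (fmod_morph_com imG) // fx.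
have phiY u : phi (Y u) = com y (phi u) by rewrite /phi (fmod_morph_com imG) // fy.
(* The kernel of [f] is gamma_m(H) and gamma_(m+1)(H) is trivial, so any defect of a relation of G
   is killed by both operators. *)
have central u : phi u = 0%R -> X u = 0%R /\ Y u = 0%R.
  move=> u0; have Em' : m = m.-1.+1 by nat_lia.
  have Lu : fmval u \in 'L_m.-1.+1(H).
    by rewrite -Em' -kerf; apply: (fmod_morph_ker imG u0).
  split; apply: fmod_inj; rewrite fmval0; apply/set1gP; rewrite -Lm1 Em'.
    exact: com_lcn Hx Lu.
  exact: com_lcn Hy Lu.
pose V := GRing.isZmodMorphism.Build _ _ phi phiB.
pose phiA : {additive fmod_of cB -> fmod_of cA} := HB.pack phi V.
have phiD u v : phi (u + v)%R = (phi u + phi v)%R := raddfD phiA u v.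
have phiS u v : phi (u - v)%R = (phi u - phi v)%R := raddfB phiA u v.
have phiMn u k : phi (u *+ k)%R = (phi u *+ k)%R := raddfMn phiA k u.
have phiMz u k : phi (u *~ k)%R = (phi u *~ k)%R := raddfMz phiA k u.
have phiN u : phi (- u)%R = (- phi u)%R := raddfN phiA u.
have [R1 R2 R3 R4] := rel.
rewrite !mul0r !mulr0z ?subr0 ?oppr0 ?addr0 ?add0r in R1 R2 R3 R4.
pose nu := (s *+ 3 - X (sig 3) + Y (tau 3))%R.
have nu0 : phi nu = 0%R.
  rewrite /nu phiD phiS phiMn phiX phiY phi_s phi_sig phi_tau sigmodS // taumodS //.
  by rewrite R1; zmod_ring.
have [Xnu Ynu] := central _ nu0.
have YS : Y (sig 3) = 0%R by apply: com_y_sigmod.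
have XT : X (tau 3) = 0%R by apply: com_x_taumod.
have XYC u : X (Y u) = Y (X u) by apply: comC.
have XS : X (sig 3) = (s *+ 3 + Y s *+ 3 + Y (Y s))%R by apply: sigmod4.
have YT : Y (tau 3) = (- (s *+ 3 + X s *+ 3 + X (X s)))%R by apply: taumod4.
have XP := defect_XP XYC XT YT Xnu.
have YQ := defect_YQ XYC YS XS Ynu.
have XQ := defect_XQ s XYC YS XT.
pose P := (X s + sig 3 + X (sig 3))%R; pose Q := (- Y s + tau 3 + Y (tau 3))%R.
have P0 : phi (P - sig m.-1 *~ gamma)%R = 0%R.
  rewrite /P phiS 2!phiD phiMz !phiX phi_s !phi_sig sigmodS // R2.
  by rewrite subrr.
have Q0 : phi (Q - sig m.-1 *~ alpha)%R = 0%R.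
  rewrite /Q phiS 2!phiD phiMz phiN !phiY phi_s !phi_sig !phi_tau taumodS // R3.
  by rewrite subrr.
have [XP0 YP0] := central _ P0; have [XQ0 YQ0] := central _ Q0.
have Xlast : X (sig m.-1) = sig m.
  by rewrite /X /sig sigmodS ?prednK //; nat_lia.
have Ylast : Y (sig m.-1) = 0%R by apply: com_y_sigmod.
have YP : Y P = 0%R.
  by rewrite -YP0 /Y raddfB raddfMz /= -/Y Ylast mul0rz subr0.
have YQ' : Y Q = 0%R.
  by rewrite -YQ0 /Y raddfB raddfMz /= -/Y Ylast mul0rz subr0.
have XPg : X P = (sig m *~ gamma)%R.
  by apply/eqP; rewrite -subr_eq0 -XP0 /X raddfB raddfMz /= -/X Xlast.
have XQa : X Q = (sig m *~ alpha)%R.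
  by apply/eqP; rewrite -subr_eq0 -XQ0 /X raddfB raddfMz /= -/X Xlast.
have oppr_eq0' (v w : fmod_of cB) : w = 0%R -> v = (- w)%R -> v = 0%R.
  by move=> -> ->; apply: oppr0.
have sig_a : (sig m *~ alpha = 0)%R := oppr_eq0' _ _ YP (etrans (esym XQa) XQ).
have nu_0 : nu = 0%R := etrans (esym YQ) YQ'.
have sig_g : (sig m *~ gamma = 0)%R := oppr_eq0' _ _ nu_0 (etrans (esym XPg) XP).
(* Here e + 1 < m enters: tau_(e+1) is trivial in G, hence tau_(e+2) is trivial in H, and m >= e +
   2. *)
have tau_m : tau m = 0%R.
  have te2 : tau e.+2 = 0%R.
    rewrite /tau -taumodS; last nat_lia.
    have /central[//] : phi (tau e.+1) = 0%R by rewrite phi_tau R4.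
  have : e.+2 <= m by [].
  elim: (m) => // k IH; rewrite leq_eqVlt => /predU1P[<- //|]; rewrite ltnS => le_k.
  by rewrite /tau -taumodS ?[taumod _ _ _ k]IH ?raddf0 //; nat_lia.
have sig_m : sig m != 0%R.
  apply/eqP=> sig_m; have : 'L_m(H) = 1.
    rewrite (lcn_gen defH cB defL3H); last nat_lia.
    rewrite -/sig -/tau sig_m tau_m fmval0 Lm1 !setUid.
    by rewrite genGid.
  have {1}-> : m = m.-1.+1 by nat_lia.
  move/(lcn_nil_classP _ nilH); rewrite Ec; nat_lia.
split; [case/small_exponentP: sa sig_a | case/small_exponentP: sg sig_g] => -> //=;
  move/eqP; by rewrite ?mulrNz ?oppr_eq0 (negPf sig_m).
Qed.

(** * A 3-group of maximal class from the ring Z[omega] *)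

Section MaximalClassGroup.

Variable N' : nat.
Local Notation N := (3 ^ N'.+1)%N.
Local Notation V := ('Z_N * 'Z_N)%type.

(** The semidirect product of Z[omega] / N by C(3) is realised by affine permutations of [V]. *)
Definition translation_fun (v : V) : V -> V := fun u => (u + v)%R.

Fact translation_inj v : injective (translation_fun v).
Proof. exact: addIr. Qed.

Definition translation (v : V) : {perm V} := perm (translation_inj (v := v)).

(* Multiplication by omega on Z[omega] = Z + Z omega, modulo N. *)
Definition omega_fun (u : V) : V := (- u.2, u.1 - u.2)%R.

Fact omega_inj : injective omega_fun.
Proof.
move=> [a b] [c d] H; have /= := congr1 snd H; have /= /oppr_inj-> := congr1 fst H.
by move/addIr->.
Qed.

Definition omega : {perm V} := perm omega_inj.

Lemma translationD u v : translation (u + v)%R = translation u * translation v.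
Proof. by apply/permP=> z; rewrite permM !permE /translation_fun addrA. Qed.

Lemma translation_morphic : {in [set: V] &, {morph translation : u v / (u * v)%g}}.
Proof. by move=> u v _ _; exact: translationD. Qed.

Lemma translationN u : translation (- u)%R = (translation u)^-1.
Proof.
apply: (mulgI (translation u)); rewrite -translationD subrr mulgV.
by apply/permP=> z; rewrite permE perm1 /translation_fun addr0.
Qed.

Lemma translation_inj1 u : translation u = 1 -> u = 0%R.
Proof. by move/permP/(_ 0%R); rewrite permE perm1 /translation_fun add0r. Qed.

Lemma omega_funB u v : omega_fun (u - v)%R = (omega_fun u - omega_fun v)%R.
Proof.
by case: u v => [a b] [c d]; congr (_, _); rewrite /= ?opprB ?opprD ?opprK; ring.
Qed.

Lemma translationJ u : translation u ^ omega = translation (omega_fun u).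
Proof.
apply/permP=> z; rewrite -(permKV omega z); move: (omega^-1 z) => z'.
rewrite conjgE !permM permK !permE /translation_fun; case: z' u => [a b] [c d].
by congr (_, _); rewrite /=; ring.
Qed.

Lemma translation_comm u : [~ translation u, omega] = translation (omega_fun u - u)%R.
Proof. by rewrite commgEl translationJ addrC translationD translationN. Qed.

Lemma omega_cube : omega ^+ 3 = 1.
Proof.
apply/permP=> [[a b]]; rewrite !expgS expg0 mulg1 !permM perm1 !permE.
by congr (_, _); rewrite /=; ring.
Qed.

Lemma translationX u n : translation u ^+ n = translation (u *+ n)%R.
Proof.
elim: n => [|n IH]; last by rewrite expgS mulrS translationD IH.
by apply/permP=> z; rewrite perm1 permE /translation_fun mulr0n addr0.
Qed.

Definition delta_fun (u : V) : V := (omega_fun u - u)%R.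

(** This is [(omega - 1)^2 = - 3 omega], from [omega^2 + omega + 1 = 0]. *)
Lemma delta_fun2 u : delta_fun (delta_fun u) = (- (omega_fun u *+ 3))%R.
Proof. by case: u => [a b]; congr (_, _); rewrite /=; ring. Qed.

Lemma omega_fun0 : omega_fun 0%R = 0%R.
Proof. by have := omega_funB 0%R 0%R; rewrite !subrr. Qed.

Lemma omega_funMn u n : omega_fun (u *+ n)%R = (omega_fun u *+ n)%R.
Proof.
elim: n => [|n IH]; first by rewrite !mulr0n omega_fun0.
rewrite !mulrS -IH; move: (u *+ n)%R => v; case: u v {IH} => [a b] [c d].
by congr (_, _); rewrite /=; ring.
Qed.

Lemma delta_fun_iter i u : iter i.*2 delta_fun u = 0%R -> (u *+ 3 ^ i = 0)%R.
Proof.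
elim: i u => [|i IH] u; first by rewrite expn0 mulr1n.
rewrite doubleS !iterSr delta_fun2 => /IH /eqP.
rewrite mulNrn oppr_eq0 -mulrnA -expnS -omega_funMn => /eqP E.
by apply: omega_inj; rewrite E omega_fun0.
Qed.

Definition basis_vector : V := (1, 0)%R.

(** Up to a unit, [N'.*2] applications multiply by [3 ^ N'], which is not 0 modulo [3 ^ N'.+1]. *)
Lemma delta_fun_iter_neq0 j : j <= N'.*2 -> iter j delta_fun basis_vector <> 0%R.
Proof.
move=> le_j E; have d0 i : iter i delta_fun 0%R = 0%R.
  by elim: i => //= i ->; rewrite /delta_fun subr0 omega_fun0.
have : iter N'.*2 delta_fun basis_vector = 0%R.
  by rewrite -(subnK le_j) iterD E d0.
move/delta_fun_iter/(congr1 fst).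
have -> n : (basis_vector *+ n)%R.1 = (n%:R)%R by elim: n => // n IH; rewrite !mulrS -IH.
move/(congr1 val); rewrite /= val_Zp_nat; last by rewrite -[1%N](expn0 3) ltn_exp2l.
by rewrite modn_small ?ltn_exp2l //; apply/eqP; rewrite expn_eq0.
Qed.

Local Notation t := (translation basis_vector).

Definition translations : {group {perm V}} :=
  [group of Morphism translation_morphic @* [set: V]].

Lemma mem_translations u : translation u \in translations.
Proof. by apply/morphimP; exists u; rewrite ?inE. Qed.

Lemma abelian_translations : abelian translations.
Proof.
apply/centsP=> _ /morphimP[u _ _ ->] _ /morphimP[v _ _ ->].
by rewrite /commute /= -!translationD addrC.
Qed.

Lemma pgroup_translations : 3.-group translations.
Proof.
apply: morphim_pgroup; rewrite /pgroup cardsT card_prod card_ord Zp_cast.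
  by rewrite pnatM !pnatX.
by rewrite -[1%N](expn0 3) ltn_exp2l.
Qed.

Lemma omega_norm : omega \in 'N(translations).
Proof.
rewrite inE; apply/subsetP=> _ /imsetP[_ /morphimP[u _ _ ->] ->].
by rewrite translationJ mem_translations.
Qed.

Definition omega_group : {group {perm V}} := <<[set omega; t]>>%G.

Lemma pgroup_omega_group : 3.-group omega_group.
Proof.
have : 3.-group (<[omega]> <*> translations)%G.
  rewrite /= norm_joinEl ?cycle_subG ?omega_norm // pgroupM pgroup_translations andbT.
  have dvd3 : #[omega] %| 3 by rewrite order_dvdn omega_cube.
  exact: pnat_dvd dvd3 (pnat_id _).
apply: pgroupS; rewrite gen_subG; apply/subsetP=> z /set2P[] ->.
  by rewrite mem_gen // inE cycle_id.
by rewrite mem_gen // inE mem_translations orbT.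
Qed.

Lemma lcn2_omega_group : 'L_2(omega_group) \subset translations.
Proof.
have nA : omega_group \subset 'N(translations).
  rewrite gen_subG; apply/subsetP=> z /set2P[] ->; first exact: omega_norm.
  by apply: (subsetP (normG _)); apply: mem_translations.
apply: commg_gen_sub => // a b /set2P[] -> /set2P[] ->; rewrite ?commgg ?group1 //.
  by rewrite -invg_comm groupV translation_comm mem_translations.
by rewrite translation_comm mem_translations.
Qed.

Lemma iter_commutator_omega i u :
  iter i (fun v => [~ v, omega]) (translation u) = translation (iter i delta_fun u).
Proof. by elim: i => //= i ->; rewrite translation_comm. Qed.

(** With [omega] as [x] and a translation as [y], all tau_j and t_3 are trivial, so beta and delta
    are arbitrary. With d = omega - 1, the first relation is 3 d = d 3 and the second is d^2 + 3 + 3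
    d = 0. *)
Lemma omega_relations m e beta delta :
  relations m e omega t 0 beta 0 delta 0.
Proof.
have Esig j : elt_sigma omega t j = translation (iter (j - 3) delta_fun (basis_vector *+ 3)%R).
  by rewrite /elt_sigma translationX iter_commutator_omega.
have Etau j : elt_tau omega t j = 1.
  by rewrite /elt_tau omega_cube; elim: (j - 3) => //= i ->; rewrite comm1g.
have Es j : elt_s omega t j = translation (iter (j - 2) delta_fun (delta_fun basis_vector)).
  by rewrite /elt_s translation_comm iter_commutator_omega.
have Et : elt_t omega t 3 = 1.
  rewrite /elt_t /= translation_comm; apply/eqP/commgP.
  by rewrite /commute -!translationD addrC.
have e0 (g : {perm V}) : expgz g 0 = 1 by [].
have e1 z : expgz (1 : {perm V}) z = 1 by case: z => n; rewrite /= expg1n ?invg1.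
have T0 : translation 0%R = 1.
  by apply/permP=> z; rewrite permE perm1 /translation_fun addr0.
rewrite /relations !Esig !Etau !Es Et !mul0r !oppr0 !e0 !e1 !invg1 !mulg1.
split=> //.
  rewrite translationX; congr translation; rewrite /delta_fun /=.
  by rewrite omega_funMn mulrnBl.
rewrite -!translationD -T0; congr translation; rewrite /= delta_fun2 /delta_fun omega_funMn.
by congr (_, _); rewrite /=; ring.
Qed.

End MaximalClassGroup.

(** * Relations in direct products and homomorphic images *)

Section RelationsInProducts.

Variables (aT bT : finGroupType).
Implicit Types (p q : aT * bT).

Lemma pair_expg p n : p ^+ n = (p.1 ^+ n, p.2 ^+ n).
Proof. by elim: n => [|n IH]; rewrite ?expg0 // !expgS IH. Qed.

Lemma pair_iter_comm p q n : iter n (fun v => [~ v, q]) p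
  = (iter n (fun v => [~ v, q.1]) p.1, iter n (fun v => [~ v, q.2]) p.2).
Proof. by elim: n => [|n IH] /=; [case: p | rewrite IH]. Qed.

Lemma pair_expgz p z : expgz p z = (expgz p.1 z, expgz p.2 z).
Proof. by case: z => n; rewrite /= pair_expg. Qed.

Lemma pair_relations m e p q alpha beta gamma delta rho :
    relations m e p.1 q.1 alpha beta gamma delta rho ->
    relations m e p.2 q.2 alpha beta gamma delta rho ->
  relations m e p q alpha beta gamma delta rho.
Proof.
have Es j : elt_s p q j = (elt_s p.1 q.1 j, elt_s p.2 q.2 j).
  exact: pair_iter_comm.
have Et j : elt_t p q j = (elt_t p.1 q.1 j, elt_t p.2 q.2 j).
  exact: pair_iter_comm.
have Esig j : elt_sigma p q j = (elt_sigma p.1 q.1 j, elt_sigma p.2 q.2 j).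
  by rewrite /elt_sigma pair_iter_comm pair_expg.
have Etau j : elt_tau p q j = (elt_tau p.1 q.1 j, elt_tau p.2 q.2 j).
  by rewrite /elt_tau pair_iter_comm pair_expg.
move=> [R1 R2 R3 R4] [S1 S2 S3 S4].
split; rewrite ?Es ?Et !Esig ?Etau ?pair_expg ?pair_expgz /=.
- by congr (_, _).
- by congr (_, _).
- by congr (_, _).
by rewrite R4 S4.
Qed.

End RelationsInProducts.

Section RelationsUnderMorphisms.

Variables (hT gT : finGroupType) (H : {group hT}) (f : {morphism H >-> gT}).

Lemma morph_iter_comm h k n : h \in H -> k \in H ->
  let u := iter n (fun v => [~ v, h]) k in
  f u = iter n (fun v => [~ v, f h]) (f k) /\ u \in H.
Proof.
move=> Hh Hk /=; elim: n => [//|n [IH Hi]] /=.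
by rewrite morphR // IH groupR.
Qed.

Lemma morph_expgz g z : g \in H -> f (expgz g z) = expgz (f g) z.
Proof. by case: z => n Hg; rewrite /= ?morphV ?morphX ?groupX. Qed.

Lemma expgz_in g z : g \in H -> expgz g z \in H.
Proof. by case: z => n Hg; rewrite /= ?groupV groupX. Qed.

Lemma morph_relations m e h k alpha beta gamma delta rho : h \in H -> k \in H ->
    relations m e h k alpha beta gamma delta rho ->
  relations m e (f h) (f k) alpha beta gamma delta rho.
Proof.
move=> Hh Hk; have [Hkh Hh3 Hk3] : [/\ [~ k, h] \in H, h ^+ 3 \in H & k ^+ 3 \in H].
  by rewrite groupR // !groupX.
have Es j : f (elt_s h k j) = elt_s (f h) (f k) j /\ elt_s h k j \in H.
  by have := morph_iter_comm (j - 2) Hh Hkh; rewrite /= morphR.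
have Et j : f (elt_t h k j) = elt_t (f h) (f k) j /\ elt_t h k j \in H.
  by have := morph_iter_comm (j - 2) Hk Hkh; rewrite /= morphR.
have Esig j : f (elt_sigma h k j) = elt_sigma (f h) (f k) j /\ elt_sigma h k j \in H.
  by have := morph_iter_comm (j - 3) Hh Hk3; rewrite /= morphX.
have Etau j : f (elt_tau h k j) = elt_tau (f h) (f k) j /\ elt_tau h k j \in H.
  by have := morph_iter_comm (j - 3) Hk Hh3; rewrite /= morphX.
have Hs j := (Es j).2; have Ht j := (Et j).2.
have Hsig j := (Esig j).2; have Htau j := (Etau j).2.
have M3 a b c : a \in H -> b \in H -> c \in H -> f (a * b * c) = f a * f b * f c.
  by move=> Ha Hb Hc; rewrite !morphM ?groupM.
have He g z : g \in H -> expgz g z \in H by apply: expgz_in.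
move=> [R1 R2 R3 R4]; split.
- rewrite -(Es 2).1 -morphX // R1 M3 ?He ?groupV //.
  by rewrite [f _^-1]morphV // morph_expgz // !(Esig _).1 (Etau _).1.
- have := congr1 f R2; rewrite !M3 ?He // !morph_expgz //.
  by rewrite (Es _).1 !(Esig _).1 (Etau _).1.
- have := congr1 f R3; rewrite !M3 ?He ?groupV // !morph_expgz //.
  by rewrite [f _^-1]morphV // (Et _).1 !(Esig _).1 !(Etau _).1.
by rewrite -(Etau _).1 -(Esig _).1 R4 morph_expgz.
Qed.

End RelationsUnderMorphisms.

(** The modulus [3 ^ M.+1] leaves room, as [M.-1 <= M.*2], for gamma_M to be non-trivial before the
    quotient by gamma_(M+1) is taken; by nilpotency it stays non-trivial afterwards. *)
Lemma maximal_class_group M : 1 < M ->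
  exists (kT : finGroupType) (K : {group kT}) (a b : kT),
    [/\ K :=: <<[set a; b]>>, 3.-group K, abelian 'L_2(K), 'L_M.+1(K) = 1
      & 'L_M(K) != 1]
    /\ forall m e beta delta, relations m e a b 0 beta 0 delta 0.
Proof.
move=> lt1M; set K0 := omega_group M.
pose w := omega M; pose t := translation (basis_vector M).
have [Kw Kt] : w \in K0 /\ t \in K0 by rewrite !mem_gen ?set21 ?set22.
have pK0 : 3.-group K0 := pgroup_omega_group M.
have nilK0 := pgroup_nil pK0.
have nL : K0 \subset 'N('L_M.+1(K0)) := lcn_norm _ _.
have imL j : coset 'L_M.+1(K0) @* 'L_j(K0) = 'L_j(K0 / 'L_M.+1(K0)).
  by rewrite morphim_lcn.
have inL j : translation (iter j (@delta_fun M) (basis_vector M)) \in 'L_j.+1(K0).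
  elim: j => [|j IH] //=.
  by rewrite -translation_comm lcnSn mem_commg.
have notL : 'L_M(K0) != 1.
  apply/eqP=> L1; have := inL M.-1; rewrite prednK ?(ltnW lt1M) // L1 => /set1gP.
  by move/translation_inj1/delta_fun_iter_neq0; apply; nat_lia.
exists (coset_of 'L_M.+1(K0)), (K0 / 'L_M.+1(K0))%G, (coset _ w), (coset _ t).
split; last first.
  move=> m e beta delta.
  apply: (@morph_relations _ _ K0 [morphism of restrm nL (coset 'L_M.+1(K0))]) => //.
  exact: omega_relations.
split.
- have sS : [set w; t] \subset 'N('L_M.+1(K0)) by rewrite (subset_trans _ nL) ?subset_gen.
  rewrite /= quotient_gen //; congr <<_>>; rewrite /quotient morphimU.
  by rewrite !morphim_set1 // (subsetP nL).
- exact: quotient_pgroup.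
- rewrite -imL morphim_abelian //.
  exact: abelianS (lcn2_omega_group M) (abelian_translations M).
- by rewrite -imL; apply: trivg_quotient.
rewrite -imL -subG1.
have := quotient_sub1 (subset_trans (lcn_sub M K0) nL); rewrite /quotient => ->.
have := nil_comm_properl nilK0 (lcn_sub M K0) notL.
have LS j : 1 < j -> 'L_j.+1(K0) = [~: 'L_j(K0), K0] by case: j.
move=> /(_ K0); rewrite -(LS M lt1M) subsetI subxx lcn_norm => /(_ isT).
by rewrite properE => /andP[].
Qed.

Lemma relations_sigma0 (gT : finGroupType) m m' e (x y : gT) beta delta :
  relations m e x y 0 beta 0 delta 0 -> relations m' e x y 0 beta 0 delta 0.
Proof. by rewrite /relations !mul0r !oppr0. Qed.

(** For the subgroup of K x G this must come from the relations, as the kernel of its projection to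
    G is not yet known. Solved for x^3 and y^3, the relations contain besides s_3 and t_3 only
    commutators of these cubes, so both cubes descend one term at a time until gamma_3. *)
Lemma lcn3_gen_of_relations (gT : finGroupType) (G : {group gT}) (x y : gT) m e beta delta :
    G :=: <<[set x; y]>> -> 4 <= e -> relations m e x y 0 beta 0 delta 0 ->
  'L_3(G) = <<[set y ^+ 3; x ^+ 3] :|: 'L_4(G)>>.
Proof.
move=> defG le4e [_ R2 R3 _]; have [Gx Gy] := mem_gen2 defG.
pose s3 := elt_s x y 3; pose t3 := elt_t x y 3.
have Lst : s3 \in 'L_3(G) /\ t3 \in 'L_3(G).
  by rewrite !lcnSn !mem_commg.
have isol (a b c d : gT) : a * b * c = d -> b = a^-1 * d * c^-1.
  by move<-; rewrite -[a * b * c]mulgA mulKg mulgK.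
have isol1 (a b c d : gT) : a * b * c = d -> a = d * c^-1 * b^-1.
  by move<-; rewrite !mulgK.
have {}R2 : s3 * elt_sigma x y 3 * elt_sigma x y 4 = expgz (elt_tau x y e) delta.
  by rewrite R2 mul0r /= !mul1g.
have {}R3 : t3^-1 * elt_tau x y 3 * elt_tau x y 4 = expgz (elt_tau x y e) beta.
  by rewrite R3 mul0r /= !mul1g.
have deep i j : 0 < i -> 3 <= j -> y ^+ 3 \in 'L_i(G) -> x ^+ 3 \in 'L_i(G) ->
    elt_sigma x y j \in 'L_(i + (j - 3))(G) /\ elt_tau x y j \in 'L_(i + (j - 3))(G).
  case: i => // i _ _ Ly Lx; rewrite /elt_sigma /elt_tau.
  elim: (j - 3) => [|k [IHs IHt]]; first by rewrite addn0.
  by rewrite addnS addSn lcnSn !mem_commg.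
have step i : 0 < i <= 2 -> y ^+ 3 \in 'L_i(G) -> x ^+ 3 \in 'L_i(G) ->
    y ^+ 3 \in 'L_i.+1(G) /\ x ^+ 3 \in 'L_i.+1(G).
  case/andP=> i_gt0 le_i2 Ly Lx.
  have [Ls4 Lt4] := deep i 4 i_gt0 isT Ly Lx; rewrite addn1 in Ls4 Lt4.
  have [_ Lte] := deep i e i_gt0 (ltnW le4e) Ly Lx.
  have {}Lte : elt_tau x y e \in 'L_i.+1(G).
    by apply: (subsetP (lcn_sub_leq G _) _ Lte); nat_lia.
  have [Ls3 Lt3] := Lst; have sL3 := subsetP (lcn_sub_leq G (le_i2 : i.+1 <= 3)).
  have Ey : y ^+ 3 = s3^-1 * expgz (elt_tau x y e) delta * (elt_sigma x y 4)^-1.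
    exact: isol R2.
  have Ex : x ^+ 3 = t3 * expgz (elt_tau x y e) beta * (elt_tau x y 4)^-1.
    by rewrite -{1}[t3]invgK; apply: isol R3.
  split; [rewrite Ey | rewrite Ex]; apply: groupM; rewrite ?groupV //; apply: groupM;
    by rewrite ?groupV ?expgz_in // sL3.
have [Ly2 Lx2] : y ^+ 3 \in 'L_2(G) /\ x ^+ 3 \in 'L_2(G).
  by apply: step; rewrite ?lcn1 ?groupX.
have [Ly3 Lx3] := step 2 isT Ly2 Lx2.
have [Ls4 Lt4] := deep 3 4 isT isT Ly3 Lx3; rewrite addn1 in Ls4 Lt4.
have [_ Lte] := deep 3 e isT (ltnW le4e) Ly3 Lx3.
have {}Lte : elt_tau x y e \in 'L_4(G).
  by apply: (subsetP (lcn_sub_leq G _) _ Lte); nat_lia.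
apply: (lcn_gen_step defG (lcn2_gen defG)).
  by apply/subsetP=> z /set2P[] ->.
set W := <<_>>.
have sLW : 'L_4(G) \subset W by rewrite sub_gen ?subsetUr.
have [Wy Wx] : y ^+ 3 \in W /\ x ^+ 3 \in W by rewrite !mem_gen // !inE eqxx ?orbT.
have WL z : z \in 'L_4(G) -> z \in W by apply: subsetP.
have [Wy' Wx'] : (y ^+ 3)^-1 \in W /\ (x ^+ 3)^-1 \in W by rewrite !groupV.
have [Ws4' Wt4'] : (elt_sigma x y 4)^-1 \in W /\ (elt_tau x y 4)^-1 \in W.
  by rewrite !groupV; split; apply: WL.
have Wte i : expgz (elt_tau x y e) i \in W by apply: expgz_in; apply: WL.
move=> a b /set1P-> /set2P[] ->.
  rewrite (_ : [~ y, x, x] = expgz (elt_tau x y e) delta * (elt_sigma x y 4)^-1 * (y ^+ 3)^-1).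
    by apply: groupM => //; apply: groupM.
  exact: isol1 R2.
rewrite (_ : [~ y, x, y] = (expgz (elt_tau x y e) beta * (elt_tau x y 4)^-1 * (x ^+ 3)^-1)^-1).
  by rewrite groupV; apply: groupM => //; apply: groupM.
by apply: invg_inj; rewrite invgK; apply: isol1 R3.
Qed.

(** Above gamma_3 a factor 27; within it m - 3 generators sigma_3, ..., sigma_(m-1) and e - 2
    generators tau_3, ..., tau_e. Raising m by one costs a single factor 3. *)
Lemma card_of_relations (gT : finGroupType) (G : {group gT}) (x y : gT)
    (cA : abelian 'L_2(G)) m e alpha beta gamma delta :
    G :=: <<[set x; y]>> -> 'L_3(G) = <<[set y ^+ 3; x ^+ 3] :|: 'L_4(G)>> ->
    'L_m(G) = 1 -> 4 <= e -> e < m ->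
    mod_relations x y cA m e alpha beta gamma delta 0 ->
  #|G| <= 3 ^ (m + e - 2).
Proof.
move=> defG defL3 Lm1 le4e lt_em rel; apply: leq_trans (card_lcn3 defG cA defL3) _.
have nilG : nilpotent G by apply/lcnP; exists m; apply/trivgP; rewrite -Lm1 lcn_subS.
have Af (u : nat -> fmod_of cA) j : fmval (u j) \in 'L_2(G) by apply: fmodP.
pose B := chain (fun j => fmval (taumod x y cA j)) 1%G 3 (e - 2).
pose D := chain (fun j => fmval (sigmod x y cA j)) B 3 (m - 3).
have rho0 : (0 : int)%R != 0%R -> e.+1 < m by [].
have [_ _ _ R4] := rel; rewrite mulr0z oppr0 in R4.
have tau0 := taumod_vanish_e2 defG defL3 le4e lt_em rel.
have sig0 := sigmod_vanish defG cA defL3 Lm1 le4e lt_em.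
have Ee : 3 + (e - 2) = e.+1 by nat_lia.
have Em : 3 + (m - 3) = m by nat_lia.
have cB : #|B| <= 3 ^ (e - 2).
  apply: (card_chain1 cA (Af _)); rewrite ?Ee ?R4 ?tau0 ?fmval0 //.
  exact: (cube_descends_tau3 defG defL3 Lm1 le4e lt_em rel rho0).
have cD : #|D| <= 3 ^ (m - 3) * #|B|.
  apply: (card_chain cA (Af _)); rewrite ?Em ?sig0 ?fmval0_in //.
    by apply: chain_norm; rewrite ?sub1G.
  exact: (cube_descends_sig3 defG defL3 Lm1 le4e lt_em rel rho0).
have sLD : 'L_3(G) \subset D.
  apply: (lcn_sub_gen defG defL3 nilG (cA := cA)) => // j le3j.
    have [le_mj|lt_jm] := leqP m j; first by rewrite sig0 ?fmval0_in.
    by apply: chain_in; nat_lia.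
  apply: (subsetP (chain_sub _ _ _ _)); have [lt_je|lt_ej] := leqP j e.
    by apply: chain_in; nat_lia.
  have [le_e2|] := leqP e.+2 j; first by rewrite tau0 ?fmval0_in.
  by rewrite ltnS => ?; have -> : j = e.+1; [nat_lia | rewrite R4 fmval0_in].
have -> : m + e - 2 = 3 + ((m - 3) + (e - 2)) by nat_lia.
rewrite expnD leq_mul2l /= expnD.
apply: leq_trans (subset_leq_card sLD) (leq_trans cD _).
by rewrite leq_mul2l cB orbT.
Qed.

Lemma isog_quotient_lcn2 (hT gT : finGroupType) (H : {group hT}) (G : {group gT})
    (f : {morphism H >-> gT}) :
  f @* H = G -> 'ker f \subset 'L_2(H) -> H / 'L_2(H) \isog G / 'L_2(G).
Proof.
move=> imG skL; have imL : f @* 'L_2(H) = 'L_2(G) by rewrite morphim_lcn // imG.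
have Gf h : h \in H -> f h \in G by move=> Hh; rewrite -imG mem_morphim.
have nL := subsetP (lcn_norm 2 G).
have gM : {in H &, {morph (fun h => coset 'L_2(G) (f h)) : a b / a * b}}.
  by move=> a b Ha Hb /=; rewrite morphM // morphM ?nL ?Gf.
pose g := Morphism gM.
have <- : g @* H = G / 'L_2(G).
  apply/setP=> z; apply/morphimP/morphimP=> [[h _ Hh ->]|[w _ Gw ->]].
    by exists (f h); rewrite ?nL ?Gf.
  by move: Gw; rewrite -{1}imG => /morphimP[h _ Hh ->]; exists h.
have <- : 'ker g = 'L_2(H); last exact: first_isog.
apply/setP=> h; apply/idP/idP => [/morphpreP[Hh /set1P /= gh1]|Lh].
  apply: (mem_of_morphim (f := f)); rewrite ?lcn_sub // imL.
  by apply: coset_idr; rewrite ?nL ?Gf.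
have Hh := subsetP (lcn_sub 2 H) _ Lh.
by apply/morphpreP; split=> //; apply/set1P; rewrite /= coset_id // -imL mem_morphim.
Qed.

Lemma internal_of_relations (gT : finGroupType) (G : {group gT}) (x y : gT) m e beta delta :
    metabelian_3group_33 G -> G :=: <<[set x; y]>> ->
    inv_m G = m -> 4 <= e -> e < m -> #|G| = (3 ^ (m + e - 2))%N ->
    relations m e x y 0 beta 0 delta 0 ->
  internal_node G.
Proof.
move=> [pG cA tG] defG Em le4e lt_em cardG rel; have [Gx Gy] := mem_gen2 defG.
have nilG := pgroup_nil pG.
have Lm1 : 'L_m(G) = 1 by rewrite -Em lcn_inv_m.
have lt1m : 1 < m by nat_lia.
have [kT [K [a [b [[defK pK cK LK1 LKm] relK]]]]] := maximal_class_group lt1m.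
have [Ka Kb] := mem_gen2 defK.
pose H := <<[set (a, x); (b, y)]>>%G.
have [Hx Hy] : (a, x) \in H /\ (b, y) \in H by rewrite !mem_gen ?set21 ?set22.
have sHKG : H \subset setX K G.
  by rewrite gen_subG; apply/subsetP=> z /set2P[] ->; rewrite inE /= ?Ka ?Kb ?Gx ?Gy.
have pH : 3.-group H.
  apply: pgroupS sHKG _; rewrite /pgroup cardsX pnatM; exact/andP.
have nilH := pgroup_nil pH.
pose f1 := [morphism of restrm (subsetT H) (@fst kT gT)].
pose f2 := [morphism of restrm (subsetT H) (@snd kT gT)].
have im1 : f1 @* H = K.
  rewrite defK morphim_gen ?subset_gen // morphimU !morphim_set1 //.
have im2 : f2 @* H = G.
  rewrite defG morphim_gen ?subset_gen // morphimU !morphim_set1 //.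
have imL1 j : f1 @* 'L_j(H) = 'L_j(K) by rewrite morphim_lcn // im1.
have imL2 j : f2 @* 'L_j(H) = 'L_j(G) by rewrite morphim_lcn // im2.
have Lcomp j p : p \in 'L_j(H) -> p.1 \in 'L_j(K) /\ p.2 \in 'L_j(G).
  move=> Lp; have Hp := subsetP (lcn_sub j H) _ Lp.
  by rewrite -imL1 -imL2; split; [apply: (mem_morphim f1) | apply: (mem_morphim f2)].
have cH : abelian 'L_2(H).
  apply/centsP=> p /Lcomp[p1 p2] q /Lcomp[q1 q2].
  by congr (_, _); [apply: (centsP cK) | apply: (centsP cA)].
have LH1 : 'L_m.+1(H) = 1.
  apply/trivgP/subsetP=> -[p q] /Lcomp[/=]; rewrite LK1 => /set1gP-> Lq.
  have : q \in 'L_m(G) by apply: (subsetP (lcn_subS m G)).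
  by rewrite Lm1 => /set1gP->; apply: group1.
(* H projects onto K, whose class is exactly m. *)
have LHm : 'L_m(H) != 1.
  by apply: contraNneq LKm => L1; rewrite -imL1 L1 morphim1.
have relH : relations m.+1 e (a, x) (b, y) 0 beta 0 delta 0.
  by apply: pair_relations; [apply: relK | apply: relations_sigma0 rel].
have defL3 := lcn3_gen_of_relations (erefl : H :=: <<[set (a, x); (b, y)]>>) le4e relH.
have [Ax3 Ay3] := cubes_lcn2 defL3.
have cardH : #|H| <= 3 ^ (m.+1 + e - 2).
  apply: (card_of_relations (cA := cH) erefl defL3 LH1 le4e (ltnW lt_em)).
  by apply/(relationsE cH Hx Hy Ax3 Ay3); exact: relH.
have card_ker : #|'ker f2| <= 3.
  have := card_morphim f2 H; rewrite im2 setIid => EG.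
  have EH : (#|'ker f2| * #|G|)%N = #|H|.
    have sKH : 'ker f2 \subset H by apply/subsetP; apply: dom_ker.
    by rewrite EG; apply: (Lagrange sKH).
  have := cardH; rewrite -EH cardG.
  have -> : m.+1 + e - 2 = (m + e - 2).+1 by nat_lia.
  by rewrite expnS leq_pmul2r // expn_gt0.
have sLker : 'L_m(H) \subset 'ker f2.
  apply/subsetP=> p Lp; have Hp := subsetP (lcn_sub m H) _ Lp.
  by apply/kerP => //; apply/set1gP; rewrite -Lm1 -imL2 mem_morphim.
(* A non-trivial subgroup of a group of order at most 3 is the whole group. *)
have Eker : 'L_m(H) = 'ker f2.
  apply/eqP; rewrite eqEcard sLker /=.
  have := cardSg sLker; have := card_ker; have : 1 < #|'L_m(H)| by rewrite cardG_gt1.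
  move=> lt1 le3 /dvdnP[q Eq]; rewrite Eq in le3 *.
  case: q Eq le3 => [|[|q]] Eq le3; rewrite ?mul1n //.
  by have := leq_trans (leq_mul (isT : 2 <= q.+2) lt1) le3.
have Ec : nil_class H = m.
  apply/eqP; rewrite eqn_leq; apply/andP; split; first exact/(lcn_nil_classP _ nilH).
  rewrite leqNgt; apply: contra LHm => lt_c.
  by apply/eqP; rewrite -(prednK (ltnW lt1m)); apply/(lcn_nil_classP _ nilH); nat_lia.
exists _, H; split; last 1 first.
- by rewrite Ec Eker -[X in _ \isog X]im2 first_isog.
- split=> //; rewrite -tG; apply: isog_abelian_type; apply: (isog_quotient_lcn2 im2).
  by rewrite -Eker lcn_sub_leq.
by rewrite Ec; nat_lia.
Qed.

(** * The tables *)

Lemma card_abelian_type (gT : finGroupType) (G : {group gT}) :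
  abelian G -> #|G| = (\prod_(k <- abelian_type G) k)%N.
Proof.
move=> cGG; have [b defG <-] := abelian_structure cGG.
by rewrite -(bigdprod_card defG) big_map.
Qed.

Lemma kernel_index_lt5 a c : kernel_index a c < 5.
Proof. by rewrite /kernel_index; do 3?case: ifP. Qed.

Lemma kernel_pair_rho t beta delta rho :
    small_exponent beta -> small_exponent delta -> small_exponent rho -> rho != 0%R ->
  ~~ kernel_pair t (kernel_index (rho * delta) (rho * beta))%R (kernel_index beta delta).
Proof.
by case/small_exponentP=> ->; case/small_exponentP=> ->; case/small_exponentP=> ->; case: t.
Qed.

Lemma kernel_pair_zero t alpha beta gamma delta :
    small_exponent alpha -> small_exponent beta ->
    small_exponent gamma -> small_exponent delta ->
    kernel_pair t (kernel_index alpha gamma) (kernel_index beta delta) ->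
  alpha = 0%R /\ gamma = 0%R \/ beta = 0%R /\ delta = 0%R.
Proof.
case/small_exponentP=> ->; case/small_exponentP=> ->;
  case/small_exponentP=> ->; case/small_exponentP=> ->; case: t => //= _;
  by [left | right].
Qed.

(** Exchanging the generators exchanges M_1 with M_2 and carries each row of one table to a pattern
    of the other, within the same type. *)
Lemma kernel_pair_swap t a c : small_exponent a -> small_exponent c ->
  kernel_pair t 0 (kernel_index a c) = kernel_pair t (kernel_index c a) 0.
Proof. by case/small_exponentP=> ->; case/small_exponentP=> ->; case: t. Qed.

Lemma kernel_pair00 t : ~~ kernel_pair t 0 0.
Proof. by case: t. Qed.

Lemma terminal_table_mem t alpha gamma : alpha \in [:: 0; 1]%R -> small_exponent gamma ->
    kernel_pair t (kernel_index alpha gamma) 0 ->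
  (alpha, 0%R, gamma, 0%R, multiplet (kernel_index alpha gamma) 0 4 3) \in terminal_table t.
Proof.
by rewrite !inE => /orP[] /eqP->; case/small_exponentP=> ->; case: t => //= _;
  first [exact: mem_head | rewrite inE; apply/orP; right; exact: mem_head].
Qed.

Lemma internal_table_mem t beta delta : delta \in [:: 0; 1]%R -> small_exponent beta ->
    kernel_pair t 0 (kernel_index beta delta) ->
  (0%R, beta, 0%R, delta, multiplet 0 (kernel_index beta delta) 4 3) \in internal_table t.
Proof.
by rewrite !inE => /orP[] /eqP->; case/small_exponentP=> ->; case: t => //= _;
  first [exact: mem_head | rewrite inE; apply/orP; right; exact: mem_head].
Qed.

(** * Choice of signs and exchange of generators *)

Section Normalisation.

Variables (gT : finGroupType) (G : {group gT}) (m e : nat).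

Lemma given_by_table_renamed (x y z w : gT) rho table :
    renamed_generators x y z w -> given_by_table G m e z w rho table ->
  given_by_table G m e x y rho table.
Proof.
have inv2 (a b c : gT) : b \in [set a; a^-1] -> c \in [set b; b^-1] -> c \in [set a; a^-1].
  by case/set2P=> -> /set2P[] ->; rewrite ?invgK ?set21 ?set22.
move=> ren [x' [y' [alpha [beta [gamma [delta [kappa [ren' ? ? ? ?]]]]]]]].
exists x', y', alpha, beta, gamma, delta, kappa; split=> //.
case/orP: ren => /andP[Hz Hw]; case/orP: ren' => /andP[Hx Hy]; apply/orP.
- by left; rewrite (inv2 _ _ _ Hz Hx) (inv2 _ _ _ Hw Hy).
- by right; rewrite (inv2 _ _ _ Hw Hx) (inv2 _ _ _ Hz Hy).
- by right; rewrite (inv2 _ _ _ Hz Hx) (inv2 _ _ _ Hw Hy).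
by left; rewrite (inv2 _ _ _ Hw Hx) (inv2 _ _ _ Hz Hy).
Qed.

Hypotheses (cA : abelian 'L_2(G)) (nilG : nilpotent G) (Em : inv_m G = m).
Hypotheses (le4e : 4 <= e) (lt_em : e < m).
Hypothesis big_quotients : forall j, 3 <= j <= e -> 3 < #|'L_j(G) / 'L_j.+1(G)|.
Hypotheses (cardG : #|G| = (3 ^ (m + e - 2))%N) (index_lcn2 : #|G : 'L_2(G)| = 9).

Let Lm1 : 'L_m(G) = 1. Proof. by rewrite -Em lcn_inv_m. Qed.

(** If m = e + 1, then tau_(e+1) is trivial and rho <> 0 forces sigma_e = 0. Then gamma_e /
    gamma_(e+1) is generated by tau_e alone and has order at most 3, against the choice of e. *)
Lemma rho_neq0_lt (x y : gT) alpha beta gamma delta rho :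
    G :=: <<[set x; y]>> -> 'L_3(G) = <<[set y ^+ 3; x ^+ 3] :|: 'L_4(G)>> ->
    small_exponent rho -> mod_relations x y cA m e alpha beta gamma delta rho ->
  rho != 0%R -> e.+1 < m.
Proof.
move=> defG defL3 hrho rel rho0; have [Gx Gy] := mem_gen2 defG.
have [Ax3 Ay3] := cubes_lcn2 defL3.
rewrite ltn_neqAle lt_em andbT; apply/negP=> /eqP Ee1.
have [_ _ _ R4] := rel.
have te1 : taumod x y cA e.+1 = 0%R.
  apply/(@fmod_inj _ _ cA); rewrite fmval0.
  have := taumod_lcn defG cA defL3 (leqW (ltnW le4e)).
  by rewrite Ee1 Lm1 => /set1P.
have te2 := taumod_vanish_e2 defG defL3 le4e lt_em rel (leqnn e.+2).
have se0 : sigmod x y cA e = 0%R.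
  have small_mem : fmval (sigmod x y cA e *~ rho)%R \in 1%G.
    by move: R4; rewrite te1 -Ee1 /= => /esym/eqP; rewrite oppr_eq0 => /eqP->; rewrite fmval0.
  have [r0|] := fmvalMz_small hrho small_mem; first by rewrite r0 in rho0.
  by move/set1P=> s1; apply/(@fmod_inj _ _ cA); rewrite s1.
have lt3 : 3 < #|'L_e(G) / 'L_e.+1(G)| by apply: big_quotients; rewrite ltnW /=.
move: lt3; rewrite ltnNge => /negP[]; apply: (card_lcn_quotient_gen1 (u := taumod x y cA e)).
  by rewrite (lcn_gen defG cA defL3 (ltnW le4e)) gen_set2_absorb // se0 fmval0.
by rewrite taumod_cube // te1 te2 mul0rn addr0 oppr0 fmval0 group1.
Qed.

Lemma kernel_canonical (x y : gT) alpha beta gamma delta rho :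
    G :=: <<[set x; y]>> -> 'L_3(G) = <<[set y ^+ 3; x ^+ 3] :|: 'L_4(G)>> ->
    small_exponent alpha -> small_exponent beta ->
    small_exponent gamma -> small_exponent delta -> small_exponent rho ->
    mod_relations x y cA m e alpha beta gamma delta rho ->
  forall i : 'I_4, transfer_ker G (canonical_maximal G x y i) = kernel_group G x y
    (nth 0 [:: if rho == 0%R then kernel_index alpha gamma
               else kernel_index (rho * delta) (rho * beta);
            kernel_index beta delta; 4; 3] i).
Proof.
move=> defG defL3 ha hb hc hd hr rel.
have rho_em := rho_neq0_lt defG defL3 hr rel.
have big3 : 3 < #|'L_3(G) / 'L_4(G)| by apply: big_quotients; nat_lia.
case=> [[|[|[|[|//]]]] ?] /=.
- exact: (transfer_ker_M1 defG defL3 Lm1 le4e lt_em ha hb hc hd hr rel).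
- exact: (transfer_ker_M2 defG defL3 Lm1 le4e lt_em hb hd rel).
- exact: (transfer_ker_M3 defG defL3 Lm1 le4e lt_em rel).
exact: (transfer_ker_M4 defG defL3 Lm1 le4e lt_em rel).
Qed.

Lemma given_by_table_row (x y : gT) alpha beta gamma delta table :
    selected_generators G x y ->
    small_exponent alpha -> small_exponent beta ->
    small_exponent gamma -> small_exponent delta ->
    mod_relations x y cA m e alpha beta gamma delta 0 ->
    (alpha, beta, gamma, delta,
     multiplet (kernel_index alpha gamma) (kernel_index beta delta) 4 3) \in table ->
  given_by_table G m e x y 0 table.
Proof.
move=> sel ha hb hc hd rel row; have [defG defL3 _ _] := sel.
have [Gx Gy] := mem_gen2 defG; have [Ax3 Ay3] := cubes_lcn2 defL3.
exists x, y, alpha, beta, gamma, delta.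
exists (multiplet (kernel_index alpha gamma) (kernel_index beta delta) 4 3).
split=> //; first by rewrite /renamed_generators !set21.
  by apply/(relationsE cA Gx Gy Ax3 Ay3).
apply: is_multiplet_canonical; rewrite ?kernel_index_lt5 //.
exact: (kernel_canonical (rho := 0%R) defG defL3 ha hb hc hd).
Qed.

(** For alpha = -1 the generator [y] is inverted. This keeps gamma and, for gamma <> 0, interchanges
    the kernel indices 3 and 4, which belong to the same type. *)
Lemma terminal_row (x y : gT) t alpha gamma :
    selected_generators G x y -> small_exponent alpha -> small_exponent gamma ->
    mod_relations x y cA m e alpha 0 gamma 0 0 ->
    kernel_pair t (kernel_index alpha gamma) 0 ->
  given_by_table G m e x y 0 (terminal_table t).
Proof.
move=> sel ha hc rel kp; have [defG defL3 _ _] := sel.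
have [Gx Gy] := mem_gen2 defG; have [Ax3 Ay3] := cubes_lcn2 defL3.
have [a01|aN1] := boolP (alpha \in [:: 0; 1]%R).
  by apply: (given_by_table_row sel ha _ hc _ rel) => //; apply: terminal_table_mem.
have {aN1} Ea : alpha = (-1)%R.
  by move: aN1; rewrite !inE; case/small_exponentP: ha => ->.
have ren : renamed_generators x y x y^-1.
  by rewrite /renamed_generators set21 set22.
apply: (given_by_table_renamed ren).
have relV := mod_relations_invy Gx Gy Ay3 rel.
apply: (given_by_table_row _ _ _ hc _ relV) => //; rewrite ?Ea //.
  by apply: selected_generators_signs sel; rewrite ?set21 ?set22.
apply: terminal_table_mem => //; move: kp; rewrite Ea.
by case/small_exponentP: hc => ->; case: t.
Qed.

Lemma internal_row (x y : gT) t beta delta :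
    selected_generators G x y -> small_exponent beta -> small_exponent delta ->
    mod_relations x y cA m e 0 beta 0 delta 0 ->
    kernel_pair t 0 (kernel_index beta delta) ->
  given_by_table G m e x y 0 (internal_table t).
Proof.
move=> sel hb hd rel kp; have [defG defL3 _ _] := sel.
have [Gx Gy] := mem_gen2 defG; have [Ax3 Ay3] := cubes_lcn2 defL3.
have [d01|dN1] := boolP (delta \in [:: 0; 1]%R).
  by apply: (given_by_table_row sel _ hb _ hd rel) => //; apply: internal_table_mem.
have {dN1} Ed : delta = (-1)%R.
  by move: dN1; rewrite !inE; case/small_exponentP: hd => ->.
have ren : renamed_generators x y x^-1 y.
  by rewrite /renamed_generators set21 set22.
apply: (given_by_table_renamed ren).
have sigm := sigmod_vanish defG cA defL3 Lm1 le4e lt_em (leqnn m).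
have relV := mod_relations_invx Gx Gy Ax3 Ay3 (leq_ltn_trans (leq0n e) lt_em) sigm rel.
apply: (given_by_table_row _ _ hb _ _ relV) => //; rewrite ?Ed //.
  by apply: selected_generators_signs sel; rewrite ?set21 ?set22.
apply: internal_table_mem => //; move: kp; rewrite Ed.
by case/small_exponentP: hb => ->; case: t.
Qed.

Lemma renamed_swap (x y : gT) : renamed_generators x y y x.
Proof. by rewrite /renamed_generators !set21 orbT. Qed.

Lemma swapped_selection (x y : gT) alpha beta gamma delta :
    e.+1 = m -> selected_generators G x y ->
    mod_relations x y cA m e alpha beta gamma delta 0 ->
  selected_generators G y x /\ mod_relations y x cA m e delta gamma beta alpha 0.
Proof.
move=> Ee sel rel; have [defG defL3 _ _] := sel.
have [Gx Gy] := mem_gen2 defG.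
have Es : inv_s G = (inv_m G).-1.
  apply: (inv_s_last defG cA defL3 nilG index_lcn2 big_quotients); rewrite ?Em //.
  exact: ltnW.
split; first by apply: (selected_generators_swap cA nilG index_lcn2 Es) => //; nat_lia.
have sigm := sigmod_vanish defG cA defL3 Lm1 le4e lt_em (leqnn m).
have := mod_relations_swap Gx Gy (leq_ltn_trans (leq0n e) lt_em) sigm rel.
by rewrite Ee -{2}Ee.
Qed.

End Normalisation.

Theorem theorem3p3 (gT : finGroupType) (G : {group gT}) (n m e : nat)
    (x y : gT) (alpha beta gamma delta rho : int) (t : section_d)
    (hG : metabelian_3group_33 G)
    (hn : #|G| = (3 ^ n)%N)
    (hm : (nil_class G).+1 = m)
    (he : inv_e G = e)
    (hen : e = (n - m + 2)%N)
    (he4 : (4 <= e)%N)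
    (hxy : selected_generators G x y)
    (halpha : small_exponent alpha) (hbeta : small_exponent beta)
    (hgamma : small_exponent gamma) (hdelta : small_exponent delta)
    (hrho : small_exponent rho)
    (hrel : relations m e x y alpha beta gamma delta rho)
    (htype : has_transfer_type G (type_d t)) :
  is_inv_k G 0
  /\ (terminal_node G -> given_by_table G m e x y rho (terminal_table t))
  /\ (internal_node G -> given_by_table G m e x y rho (internal_table t)).
Proof.
subst m; have [pG cA tG] := hG; have nilG := pgroup_nil pG.
have Em : inv_m G = (nil_class G).+1 by [].
have [lt_em big_quo] := inv_e_bounds he he4.
have index9 : #|G : 'L_2(G)| = 9.
  rewrite -card_quotient ?lcn_norm // card_abelian_type ?sub_der1_abelian //.
  by rewrite tG !big_cons big_nil.
have cardG : #|G| = (3 ^ ((nil_class G).+1 + e - 2))%N by rewrite hn; congr (_ ^ _)%N; nat_lia.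
have [defG defL3 Hx Hy] := hxy; have [Gx Gy] := mem_gen2 defG.
have [Ax3 Ay3] := cubes_lcn2 defL3.
have relM := proj1 (relationsE cA Gx Gy Ax3 Ay3 _ _ _ _ _ _ _) hrel.
have kerC := kernel_canonical nilG Em he4 lt_em big_quo cardG index9 defG defL3
  halpha hbeta hgamma hdelta hrho relM.
have kp := has_transfer_type_kernels defG defL3 pG index9 _ _ kerC htype.
have {kp} kp := kp (ltac:(by case: ifP; rewrite kernel_index_lt5)) (kernel_index_lt5 _ _).
have rho0 : rho = 0%R.
  apply/eqP/negPn/negP=> rho0; rewrite (negPf rho0) in kp.
  by rewrite (negPf (kernel_pair_rho t hbeta hdelta hrho rho0)) in kp.
rewrite {}rho0 /= in hrel relM kp *.
have tau0 : taumod x y cA e.+1 = 0%R.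
  by have [_ _ _ ->] := relM; rewrite mulr0z oppr0.
split.
  exact: (is_inv_k0 defG defL3 nilG index9 he (ltnW he4) lt_em tau0).
have swap := swapped_selection nilG Em he4 lt_em big_quo cardG index9 _ hxy relM.
have row1 := terminal_row nilG Em he4 lt_em big_quo cardG index9.
have row2 := internal_row nilG Em he4 lt_em big_quo cardG index9.
case: (kernel_pair_zero halpha hbeta hgamma hdelta kp) => -[Ea Ec];
  rewrite {}Ea {}Ec in hrel relM kp swap *.
(* Here alpha = gamma = 0. A terminal node must have e = m - 1, since the product construction makes
   G internal in any case; then the exchange of generators leads to the terminal table. *)
- split=> node; last exact: row2 hxy hbeta hdelta relM kp.
  have [Ee|neq] := eqVneq e.+1 (nil_class G).+1.
    have [sel' rel'] := swap Ee; apply: (given_by_table_renamed (renamed_swap x y)).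
    by apply: (row1 _ _ _ _ _ _ sel' hdelta hbeta rel'); rewrite -(kernel_pair_swap t hbeta hdelta).
  by case: node; apply: internal_of_relations hG defG Em he4 lt_em cardG hrel.
split=> node; first exact: row1 hxy halpha hgamma relM kp.
have [Ee|neq] := eqVneq e.+1 (nil_class G).+1.
  have [sel' rel'] := swap Ee; apply: (given_by_table_renamed (renamed_swap x y)).
  by apply: (row2 _ _ _ _ _ _ sel' hgamma halpha rel'); rewrite (kernel_pair_swap t hgamma halpha).
(* An internal node with beta = delta = 0 and e < m - 1 would have two total kernels, which no type
   of section d allows. *)
have lt_e1m : e.+1 < (nil_class G).+1 by rewrite ltn_neqAle neq.
have [a0 c0] := internal_alpha_gamma defG defL3 Em he4 lt_e1m halpha hgamma relM node.
by move: kp; rewrite a0 c0 (negPf (kernel_pair00 t)).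
Qed.
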